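(* Let $U:\mathbb{R}\to(-\infty,\infty]$ be measurable with $U(x)=U(-x)$ for all $x$, satisfying (i) $\inf_x U(x)>-\infty$ and $0<\int_{\mathbb{R}} e^{-U(x)}\,dx<\infty$, and (ii) either $U$ is twice continuously differentiable on $\mathbb{R}$, or there is $0<K<\infty$ such that $U$ is twice continuously differentiable on $(-K,K)$ and $U(x)=\infty$ for $|x|>K$. Then there exist constants $C(U),c(U)>0$, depending only on $U$, such that for every $n\ge 2$, if $\varphi$ is sampled from $\mu_{\mathbb{T}_n^2,\mathbf 0,U}$, then for every $v\in V(\mathbb{T}_n^2)$ with $\|v\|_1\ge(\log n)^2$: \begin{align*} &\operatorname{Var}(\varphi_v)\ge c(U)\log(1+\|v\|_1),\\ &\mathbb{P}\big(|\varphi_v|\le \delta\sqrt{\log(1+\|v\|_1)}\big)\le C(U)\delta^{2/3}\quad\text{for all }\delta\ge \tfrac{1}{\sqrt{\log(1+\|v\|_1)}},\\ &\mathbb{P}\big(|\varphi_v|\ge c(U)t\sqrt{\log(1+\|v\|_1)}\big)\ge c(U)e^{-C(U)t^2}\quad\text{for all }1\le t\le \tfrac{1+\sqrt{\|v\|_1}}{1+\log n}. \end{align*} Moreover $\mathbb{P}\big(\max_{v\in V(\mathbb{T}_n^2)}|\varphi_v|\ge c(U)\log n\big)\ge \tfrac12$.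
   Context: For $n\ge1$, $\mathbb{T}_n^2$ is the discrete torus with vertex set $V(\mathbb{T}_n^2)=\{-n+1,\dots,n\}^2$, where $(a,b)$ and $(c,d)$ are adjacent if they agree in one coordinate and differ by exactly $1$ modulo $2n$ in the other; $E(\mathbb{T}_n^2)$ is its edge set. $\mathbf 0=(0,0)$ and $\|(v_1,v_2)\|_1=|v_1|+|v_2|$ (with $v_1,v_2\in\{-n+1,\dots,n\}$). For a symmetric measurable potential $U$ with $\inf U>-\infty$ and $0<\int e^{-U}<\infty$, the random surface measure $\mu_{\mathbb{T}_n^2,\mathbf 0,U}$ is the probability measure on $\varphi:V(\mathbb{T}_n^2)\to\mathbb{R}$ given by $$d\mu_{\mathbb{T}_n^2,\mathbf 0,U}(\varphi)=\frac{1}{Z_{\mathbb{T}_n^2,\mathbf 0,U}}\exp\Big(-\sum_{(v,w)\in E(\mathbb{T}_n^2)}U(\varphi_v-\varphi_w)\Big)\delta_0(d\varphi_{\mathbf 0})\prod_{v\ne\mathbf 0}d\varphi_v,$$ with $d\varphi_v$ Lebesgue measure, $\delta_0$ the Dirac mass at $0$, and $Z_{\mathbb{T}_n^2,\mathbf 0,U}$ the normalizing constant (each edge counted once). *)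

(* Defs.v *)
From HB Require Import structures.
From mathcomp Require Import all_boot all_order all_algebra.
From mathcomp Require Import all_classical all_reals all_analysis.
From mathcomp Require Import measurable_realfun.
Set Implicit Arguments. Unset Strict Implicit. Unset Printing Implicit Defensive.
Import Order.TTheory GRing.Theory Num.Theory.
Import numFieldNormedType.Exports.
Local Open Scope classical_set_scope.
Local Open Scope ring_scope.

(* Vertices of the torus T_n^2: a pair (a,b) of ordinals in 'I_(2n); the   *)
(* ordinal k represents the coordinate k - (n-1) in {-n+1,...,n}.          *)
Definition vertex (n : nat) : finType := ('I_(2 * n) * 'I_(2 * n))%type.

Definition coord (n : nat) (k : 'I_(2 * n)) : int := (k : nat)%:Z - (n.-1)%:Z.

Definition is_origin (n : nat) (v : vertex n) : bool :=
  (coord v.1 == 0%R) && (coord v.2 == 0%R).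

Definition l1norm (n : nat) (v : vertex n) : nat :=
  (`|coord v.1| + `|coord v.2|)%N.

Definition cyc_adj (n : nat) (a b : 'I_(2 * n)) : bool :=
  ((a.+1 %% (2 * n))%N == b) || ((b.+1 %% (2 * n))%N == a).

Definition torus_adj (n : nat) (v w : vertex n) : bool :=
  ((v.1 == w.1) && cyc_adj v.2 w.2) || ((v.2 == w.2) && cyc_adj v.1 w.1).

Section Surface.
Variable R : realType.
Local Open Scope ereal_scope.

(* Hamiltonian: sum over the edge set E(T_n^2), each edge counted once    *)
(* (an edge {v,w} is listed once as the ordered pair with v before w).    *)
Definition hamiltonian (U : R -> \bar R) (n : nat) (phi : vertex n -> R) : \bar R :=
  \sum_(p : vertex n * vertex n |
        torus_adj p.1 p.2 && (enum_rank p.1 < enum_rank p.2)%N)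
     U (phi p.1 - phi p.2)%R.

Definition weight (U : R -> \bar R) (n : nat) (phi : vertex n -> R) : \bar R :=
  expeR (- hamiltonian U phi).

(* Iterated Lebesgue integral of F over the coordinates listed in s,      *)
(* the other coordinates being given by phi.  For nonnegative measurable  *)
(* F this is (Tonelli) the integral against the product Lebesgue measure. *)
Fixpoint iint (n : nat) (s : seq (vertex n)) (F : (vertex n -> R) -> \bar R)
  (phi : vertex n -> R) : \bar R :=
  if s is v :: s' then
    \int[@lebesgue_measure R]_x iint s' F (fun u => if u == v then x else phi u)
  else F phi.

(* integral of F against  prod_{v <> 0} d phi_v  with phi_0 = 0 *)
Definition pin_integral (n : nat) (F : (vertex n -> R) -> \bar R) : \bar R :=
  iint [seq v <- enum (vertex n) | ~~ is_origin v] F (fun _ => 0%R).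

Definition partition_fn (U : R -> \bar R) (n : nat) : \bar R :=
  pin_integral (weight U (n:=n)).

Definition Emu (U : R -> \bar R) (n : nat) (g : (vertex n -> R) -> \bar R) : \bar R :=
  pin_integral (fun phi => weight U phi * g phi) * ((fine (partition_fn U n))^-1)%:E.

Definition Pmu (U : R -> \bar R) (n : nat) (A : set (vertex n -> R)) : \bar R :=
  Emu U (fun phi => (\1_A phi)%:E).

Definition Varmu (U : R -> \bar R) (n : nat) (v : vertex n) : \bar R :=
  let m2 := Emu U (fun phi => ((phi v) ^+ 2)%:E) in
  let m1 := Emu U (fun phi => (Num.max (phi v) 0)%:E)
            - Emu U (fun phi => (Num.max (- phi v) 0)%:E) in
  if m2 == +oo then +oo else m2 - m1 * m1.

End Surface.

Definition C2_on (R : realType) (D : set R) (u : R -> R) : Prop :=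
  forall x, D x ->
    [/\ derivable u x 1, derivable (derive1 u) x 1 &
        {for x, continuous (derive1 (derive1 u))}].

(* Main.v *)
Require Import Defs.
From HB Require Import structures.
From mathcomp Require Import all_boot all_order all_algebra.
From mathcomp Require Import all_classical all_reals all_analysis.
From mathcomp Require Import measurable_realfun.
From mathcomp Require Import zify ring lra.
Set Implicit Arguments. Unset Strict Implicit. Unset Printing Implicit Defensive.
Import Order.TTheory GRing.Theory Num.Theory.
Import numFieldNormedType.Exports.
Local Open Scope classical_set_scope.
Local Open Scope ring_scope.

(** Write [exp (- U) = h0 + h1], where [h1] carries little mass and [h0] changes
    only to second order under symmetric shifts: [h0 (g + d) h0 (g - d)] dominates
    [h0 g ^ 2] up to a factor [exp (C d ^ 2)] and an error of size [d ^ 2 h1].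
    Expanding the product over the edges gives a mixture over the random set [b] of
    edges that carry [h1].  The torus measure is reflection positive, so the
    chessboard estimate bounds the probability that [b] contains a given set [S] by
    [eps ^ #|S|]; hence, away from a small event, the first-passage distance in
    which the edges of [b] are free is comparable to the graph distance.

    Given [b], shift the surface by [tau] and by [- tau], where [tau] is a
    logarithmic profile in that first-passage distance: it is constant across the
    edges of [b], has height [a] at [v], vanishes outside a ball of radius of order
    [4 ^ q] and has energy of order [a ^ 2 / q].  By Cauchy-Schwarz the probability
    of an event is at most that of its two shifts, up to a factor
    [exp (C a ^ 2 / q)].  Comparing a window with its disjoint translates gives the
    small ball bound, comparing [|phi v| < x] with [|phi v| >= x] gives the tail and
    the variance, and comparing the event that all heights are small with the
    disjoint events that exactly one of many separated sites is large gives the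
    maximum. *)

(** * Iterated integrals *)

(** The symmetric-shift argument needs an upper bound on [U''] along the shifted gradients; none is
    available far out on the line or near [K]. Gradients outside a compact set are therefore left to
    [h1], and no shift acts across the edges that carry it. Truncation alone would not do: at the
    border of its support a compactly supported [h0] cannot satisfy [h0 (g + d) h0 (g - d) >= (1 -
    O(d ^ 2)) h0 g ^ 2]. This is why [h1] keeps a fraction [eta] of [h] everywhere and a multiple of
    [d ^ 2 h1] is added to the shifted [h0]: once the sum over [b] is taken, the addition costs only
    a factor [1 + C d ^ 2] per edge. The shift may depend on [b] but not on the surface, so that it
    remains a translation of Lebesgue measure. The value [eps = 32 ^ - 2] comes from a path count:
    words of [L] steps with marked positions number [8 ^ L], and at least half of the positions are
    marked, so each length contributes at most [(8 / 32) ^ L]. *)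

Section RealLine.
Context {R : realType}.
Local Open Scope ereal_scope.
Notation leb := (@lebesgue_measure R).

Lemma ge0_integral_translate (f : R -> \bar R) (c : R) :
  measurable_fun setT f -> (forall x, 0 <= f x) ->
  \int[leb]_x f (x + c)%R = \int[leb]_x f x.
Proof.
move=> mf f0.
have mp : measurable_fun setT ((fun x => x + c)%R : measurableTypeR R -> measurableTypeR R).
  exact: measurable_funD.
rewrite [RHS](eq_measure_integral (pushforward leb ((fun x => x + c)%R : measurableTypeR R -> measurableTypeR R))).
  by rewrite (ge0_integral_pushforward mp)//= ?preimage_setT.
move=> A mA _.
apply: lebesgue_measure_unique => //= _ [[a b]] _ <-.
rewrite /pushforward.
rewrite [X in _ = leb X](_ : _ = `](a - c)%R, (b - c)%R]%classic); last first.
  by apply/seteqP; split => x /=; rewrite !in_itv/= ltrBlDr lerBrDr.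
rewrite /= !lebesgue_measure_itv/= !lte_fin ltrD2r.
by case: ifP => // _; rewrite -!EFinB; congr (_%:E); ring.
Qed.

Lemma ge0_integral_opp (f : R -> \bar R) :
  measurable_fun setT f -> (forall x, 0 <= f x) ->
  \int[leb]_x f (- x)%R = \int[leb]_x f x.
Proof.
move=> mf f0.
rewrite [RHS](eq_measure_integral (pushforward leb (-%R : measurableTypeR R -> measurableTypeR R))).
  by rewrite (ge0_integral_pushforward)//= ?preimage_setT.
by move=> A mA _; exact/esym/lebesgue_measureN.
Qed.

End RealLine.

Section Iint.
Context {R : realType} {n : nat}.
Local Open Scope ereal_scope.
Notation V := (vertex n).
Notation leb := (@lebesgue_measure R).
Implicit Types (F G : (V -> R) -> \bar R) (phi : V -> R) (s : seq V).

Definition upd phi (v : V) (x : R) : V -> R := fun u => if u == v then x else phi u.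

(* Joint measurability on [V -> R], tested on all measurable families: this is
   stable under substitution by construction and avoids choosing a product
   sigma-algebra on the function space. *)
Definition jmeas {W : Type} {d'} {Y : measurableType d'} (F : (W -> R) -> Y) : Prop :=
  forall d (X : measurableType d) (x : W -> X -> R),
    (forall v, measurable_fun setT (x v)) ->
    measurable_fun setT (fun z => F (fun v => x v z)).

Definition jnn F : Prop := jmeas F /\ forall phi, 0 <= F phi.

Lemma jmeas_upd F phi v : jmeas F -> measurable_fun setT (fun x => F (upd phi v x)).
Proof.
move=> mF; apply: (mF _ _ (fun u x => upd phi v x u)) => u.
by rewrite /upd; case: (u == v).
Qed.

Lemma jnn_iint s F : jnn F -> jnn (iint s F).
Proof.
elim: s => //= v s IH FF; have {IH} [mI I0] := IH FF.
split; last by move=> phi; apply: integral_ge0.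
move=> d X x mx.
pose f (p : X * measurableTypeR R) := iint s F (upd (fun u => x u p.1) v p.2).
apply: (measurable_fun_fubini_tonelli_F (m2 := leb) f); last by move=> p; exact: I0.
apply: (mI _ _ (fun u (p : X * measurableTypeR R) => if u == v then p.2 else x u p.1)) => u.
case: (u == v); first exact: measurable_snd.
by apply: measurableT_comp => //; exact: mx.
Qed.

Lemma iint_ge0 s F phi : jnn F -> 0 <= iint s F phi.
Proof. by move=> /(jnn_iint s)[]. Qed.

Lemma jnn_comp_iint_upd s F phi v : jnn F ->
  measurable_fun setT (fun x => iint s F (upd phi v x)).
Proof. by move=> /(jnn_iint s)[mI _]; exact: jmeas_upd. Qed.

Lemma eq_iint s F G phi : (forall psi, F psi = G psi) -> iint s F phi = iint s G phi.
Proof. by move=> FG; have -> : F = G by apply/funext. Qed.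

Lemma le_iint s F G phi : jnn F -> jnn G -> (forall psi, F psi <= G psi) ->
  iint s F phi <= iint s G phi.
Proof.
move=> FF GG FG; elim: s phi => //= v s IH phi.
by apply: ge0_le_integral => //; try (by move=> x _; exact: iint_ge0);
   exact: jnn_comp_iint_upd.
Qed.

Lemma iint_cat s1 s2 F phi : iint (s1 ++ s2) F phi = iint s1 (iint s2 F) phi.
Proof.
by elim: s1 phi => //= v s1 IH phi; apply: eq_integral => x _; rewrite IH.
Qed.

Lemma jnnD F G : jnn F -> jnn G -> jnn (fun phi => F phi + G phi).
Proof.
move=> [mF F0] [mG G0]; split; last by move=> phi; exact: adde_ge0.
by move=> d X x mx; apply: emeasurable_funD; [exact: mF|exact: mG].
Qed.

Lemma jnnM F G : jnn F -> jnn G -> jnn (fun phi => F phi * G phi).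
Proof.
move=> [mF F0] [mG G0]; split; last by move=> phi; exact: mule_ge0.
by move=> d X x mx; apply: emeasurable_funM; [exact: mF|exact: mG].
Qed.

Lemma jnn_cst (c : \bar R) : 0 <= c -> jnn (fun=> c).
Proof. by move=> c0; split => // d X x mx. Qed.

Lemma jnnZ c F : 0 <= c -> jnn F -> jnn (fun phi => c * F phi).
Proof. by move=> c0 FF; apply: jnnM => //; exact: jnn_cst. Qed.

Lemma iintD s F G phi : jnn F -> jnn G ->
  iint s (fun phi => F phi + G phi) phi = iint s F phi + iint s G phi.
Proof.
move=> FF GG; elim: s phi => //= v s IH phi.
rewrite -ge0_integralD//; try (by move=> x _; exact: iint_ge0);
  try exact: jnn_comp_iint_upd.
by apply: eq_integral => x _; rewrite IH.
Qed.

Lemma iintZ s (c : R) F phi : (0 <= c)%R -> jnn F ->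
  iint s (fun phi => c%:E * F phi) phi = c%:E * iint s F phi.
Proof.
move=> c0 FF; elim: s phi => //= v s IH phi.
rewrite -ge0_integralZl//; try (by move=> x _; exact: iint_ge0);
  try exact: jnn_comp_iint_upd.
by apply: eq_integral => x _; rewrite IH.
Qed.

Lemma iint0 s phi : iint s (fun=> 0) phi = 0 :> \bar R.
Proof.
elim: s phi => //= v s IH phi; apply: integral0_eq => x _; exact: IH.
Qed.

Lemma jnn_sum (I : Type) (r : seq I) (P : pred I) (F : I -> (V -> R) -> \bar R) :
  (forall i, P i -> jnn (F i)) -> jnn (fun phi => \sum_(i <- r | P i) F i phi).
Proof.
move=> FF; elim: r => [|i r IH].
  have -> : (fun phi => \sum_(i <- [::] | P i) F i phi) = (fun=> 0).
    by apply/funext => phi; rewrite big_nil.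
  exact: jnn_cst.
have -> : (fun phi => \sum_(i <- i :: r | P i) F i phi) =
  (fun phi => (if P i then F i phi else 0) + \sum_(i <- r | P i) F i phi).
  by apply/funext => phi; rewrite big_cons; case: (P i); rewrite ?add0e.
by apply: jnnD => //; case: (boolP (P i)) => Pi; [exact: FF|exact: jnn_cst].
Qed.

Lemma iint_sum s (I : Type) (r : seq I) (P : pred I) (F : I -> (V -> R) -> \bar R) phi :
  (forall i, P i -> jnn (F i)) ->
  iint s (fun phi => \sum_(i <- r | P i) F i phi) phi = \sum_(i <- r | P i) iint s (F i) phi.
Proof.
move=> FF; elim: r => [|i r IH].
  by rewrite big_nil (@eq_iint s _ (fun=> 0)) ?iint0// => psi; rewrite big_nil.
rewrite big_cons -IH; case: (boolP (P i)) => Pi.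
  rewrite -iintD//; [|exact: FF|exact: jnn_sum].
  by apply: eq_iint => psi; rewrite big_cons Pi.
by apply: eq_iint => psi; rewrite big_cons (negbTE Pi).
Qed.

Definition indep (T : Type) (F : (V -> R) -> T) (v : V) : Prop :=
  forall phi x, F (upd phi v x) = F phi.

Lemma iint_swap (v w : V) s F phi : jnn F ->
  iint (v :: w :: s) F phi = iint (w :: v :: s) F phi.
Proof.
move=> FF; have [->//|vw] := eqVneq v w.
rewrite /=.
have [mI I0] := jnn_iint s FF.
pose f (p : measurableTypeR R * measurableTypeR R) := iint s F (upd (upd phi v p.1) w p.2).
have mf : measurable_fun setT f.
  apply: (mI _ _ (fun u (p : measurableTypeR R * measurableTypeR R) =>
     if u == w then p.2 else if u == v then p.1 else phi u)) => u.
  case: (u == w); first exact: measurable_snd.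
  by case: (u == v) => //; exact: measurable_fst.
have := fubini_tonelli (m1 := leb) (m2 := leb) f mf (fun p => I0 _).
rewrite /f /= => E.
transitivity (\int[leb]_x \int[leb]_y iint s F (upd (upd phi v x) w y)); first reflexivity.
rewrite E; apply: eq_integral => y _; apply: eq_integral => x _.
congr (iint s F _); apply/funext => u; rewrite /upd.
have [->|_] := eqVneq u w; last reflexivity.
by rewrite eq_sym (negbTE vw).
Qed.

Lemma eq_iint_tail v s1 s2 F phi : (forall psi, iint s1 F psi = iint s2 F psi) ->
  iint (v :: s1) F phi = iint (v :: s2) F phi.
Proof. by move=> E /=; apply: eq_integral => x _. Qed.

Lemma perm_iint s1 s2 F phi : perm_eq s1 s2 -> jnn F -> iint s1 F phi = iint s2 F phi.
Proof.
move=> + FF; elim: s1 s2 phi => [s2 phi|v s1 IH s2 phi].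
  by rewrite perm_sym => /perm_nilP ->.
rewrite perm_sym => /perm_consP [i [u [def_rot]]]; rewrite perm_sym => s1u.
rewrite (eq_iint_tail _ _ (fun psi => IH u psi s1u)) -def_rot {IH s1u def_rot u}.
have H w t1 t2 psi : iint (w :: t1 ++ t2) F psi = iint (t1 ++ w :: t2) F psi.
  by elim: t1 psi => // a t1 IH psi; rewrite cat_cons iint_swap//; exact: eq_iint_tail.
rewrite -[in RHS](cat_take_drop i s2) /rot.
elim: (drop i s2) (take i s2) phi => [t phi|a t1 IH t2 phi]; first by rewrite cats0.
by rewrite cat_cons -H; apply: eq_iint_tail => psi; exact: IH.
Qed.

Lemma indep_iint s F v : v \in s -> indep (iint s F) v.
Proof.
elim: s => //= w s IH; rewrite inE => vs phi x /=.
apply: eq_integral => y _.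
have [vw|vw] := eqVneq v w.
  by congr (iint _ _ _); apply/funext => u; rewrite /upd vw; case: (u == w).
have {}vs : v \in s by move: vs; rewrite (negbTE vw).
rewrite -[RHS](IH vs _ x); congr (iint _ _ _); apply/funext => u; rewrite /upd.
by have [->|//] := eqVneq u w; rewrite eq_sym (negbTE vw).
Qed.

(** The vertex set is finite, so [phi] can be turned into [psi] one coordinate at a time. The use is
    for integrals whose base points differ only where they are integrated out. *)
Lemma indep_agree (T : Type) (G : (V -> R) -> T) phi psi :
  (forall v, phi v != psi v -> indep G v) -> G phi = G psi.
Proof.
move=> H.
pose mix (t : seq V) := fun v => if v \in t then psi v else phi v.
have M t : G (mix t) = G phi.
  elim: t => [|v t IH]; first by congr G; apply/funext.
  rewrite -IH; have [vt|vt] := boolP (v \in t).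
    congr G; apply/funext => u; rewrite /mix inE.
    by have [->|] := eqVneq u v; rewrite ?vt.
  have [e|ne] := eqVneq (phi v) (psi v).
    congr G; apply/funext => u; rewrite /mix inE.
    by have [->|//] := eqVneq u v; rewrite (negbTE vt) e.
  rewrite -[RHS](H v ne _ (psi v)); congr G; apply/funext => u; rewrite /mix /upd inE.
  by have [->|//] := eqVneq u v.
rewrite -(M (enum V)); congr G; apply/funext => v.
by rewrite /mix mem_enum.
Qed.

Lemma indep_iintI s F v : indep F v -> indep (iint s F) v.
Proof.
move=> Fv; elim: s => //= w s IH phi x /=.
apply: eq_integral => y _.
have [<-|vw] := eqVneq v w.
  by congr (iint _ _ _); apply/funext => u; rewrite /upd; case: (u == v).
rewrite -[RHS](IH _ x); congr (iint _ _ _); apply/funext => u; rewrite /upd.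
by have [->|//] := eqVneq u w; rewrite eq_sym (negbTE vw).
Qed.

Lemma iintZ_indep s F G phi : jnn F -> jnn G -> (forall v, v \in s -> indep G v) ->
  iint s (fun phi => G phi * F phi) phi = G phi * iint s F phi.
Proof.
move=> FF GG Gs; elim: s Gs phi => //= v s IH Gs phi.
rewrite -ge0_integralZl//; try exact: jnn_comp_iint_upd;
  try (by move=> x _; exact: iint_ge0); try (by case: GG).
apply: eq_integral => x _; rewrite IH; last by move=> w ws; apply: Gs; rewrite inE ws orbT.
by rewrite -[in RHS](Gs v _ _ x)//; exact: mem_head.
Qed.

Lemma iint_translate s F (tau : V -> R) phi : jnn F ->
  iint s (fun psi => F (fun v => psi v + tau v)%R) phi = iint s F (fun v => phi v + tau v)%R.
Proof.
move=> FF; elim: s phi => //= v s IH phi.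
rewrite -[RHS](@ge0_integral_translate _ _ (tau v)); last 2 first.
- exact: jnn_comp_iint_upd.
- by move=> x; exact: iint_ge0.
apply: eq_integral => x _; rewrite IH; congr (iint _ _ _); apply/funext => u.
by rewrite /= /upd; case: eqVneq => // ->.
Qed.

Lemma iint_opp s F phi : jnn F ->
  iint s (fun psi => F (fun v => - psi v)%R) phi = iint s F (fun v => - phi v)%R.
Proof.
move=> FF; elim: s phi => //= v s IH phi.
rewrite -[RHS]ge0_integral_opp; last 2 first.
- exact: jnn_comp_iint_upd.
- by move=> x; exact: iint_ge0.
apply: eq_integral => x _; rewrite IH; congr (iint _ _ _); apply/funext => u.
by rewrite /=; case: eqVneq => // ->.
Qed.

Lemma iint_relabel (th : V -> V) s F phi : involutive th ->
  iint (map th s) F phi = iint s (fun psi => F (fun v => psi (th v))) (fun v => phi (th v)).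
Proof.
move=> thK; elim: s phi => [|v s IH] phi /=.
  by congr F; apply/funext => v; rewrite thK.
apply: eq_integral => x _; rewrite IH; congr (iint _ _ _); apply/funext => u /=.
by rewrite (inj_eq (can_inj thK)).
Qed.

(* A function invariant under adding constants has the same integral
   whichever vertex is pinned at height 0. *)
Lemma iint_repin (p q : V) s F : jnn F -> p != q -> uniq s -> p \notin s -> q \notin s ->
  (forall v, (v == p) || (v == q) || (v \in s)) ->
  (forall phi c, F (fun v => phi v + c)%R = F phi) ->
  iint (q :: s) F (fun=> 0%R) = iint (p :: s) F (fun=> 0%R).
Proof.
move=> FF pq us ps qs all Finv /=.
rewrite -[RHS]ge0_integral_opp; last 2 first.
- exact: jnn_comp_iint_upd.
- by move=> x; exact: iint_ge0.
apply: eq_integral => x _.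
(* Lowering everything by the height [x] of [q] puts [q] at 0 and [p] at [- x]; on [s] the base
   point is integrated out. *)
have := @iint_translate s F (fun=> - x)%R (fun u => if u == q then x else 0)%R FF.
under eq_iint do rewrite Finv.
move=> ->; apply: indep_agree => v; have := all v.
have [->|vp] := eqVneq v p; first by rewrite (negbTE pq) add0r eqxx.
have [->|vq] := eqVneq v q; first by rewrite subrr eqxx.
by move=> /= vs _; exact: indep_iint.
Qed.

End Iint.

(** * The torus as a graph *)

Lemma val_ordS N (i : 'I_N) : nat_of_ord (ordS i) = (if i.+1 == N then 0 else i.+1)%N.
Proof.
have := ltn_ord i; rewrite /= leq_eqVlt => /orP[/eqP ->|lt]; first by rewrite modnn eqxx.
by rewrite modn_small// ltn_eqF.
Qed.

Lemma val_ord_pred N (i : 'I_N) : nat_of_ord (ord_pred i) = (if i == 0 :> nat then N.-1 else i.-1)%N.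
Proof.
have := ltn_ord i; rewrite /=; case: eqP => [->|/eqP i0] lt; first by rewrite add0n modn_small//; lia.
rewrite (_ : (i + N).-1 = i.-1 + N)%N; last by lia.
by rewrite modnDr modn_small//; lia.
Qed.

Lemma ord_eqE N (i j : 'I_N) : (i == j) = (nat_of_ord i == nat_of_ord j).
Proof. by []. Qed.

Section Edges.
Context {n : nat}.
Notation V := (vertex n).

(* The edge [(v, false)] leaves [v] in the first coordinate direction,
   [(v, true)] in the second. *)
Definition edge : finType := (vertex n * bool)%type.

Definition src (e : edge) : V := e.1.
Definition tgt (e : edge) : V :=
  if e.2 then (e.1.1, ordS e.1.2) else (ordS e.1.1, e.1.2).
(** The neighbour that precedes [e.1] in direction [e.2]; here the pair encodes a vertex with a
    direction rather than the edge leaving it. *)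
Definition tgtV (e : edge) : V :=
  if e.2 then (e.1.1, ord_pred e.1.2) else (ord_pred e.1.1, e.1.2).

Lemma tgtVK (d : bool) : cancel (fun v : V => tgt (v, d)) (fun v => tgtV (v, d)).
Proof. by case: d => -[x y]; rewrite /tgt /tgtV /= ordSK. Qed.
Lemma tgtK (d : bool) : cancel (fun v : V => tgtV (v, d)) (fun v => tgt (v, d)).
Proof. by case: d => -[x y]; rewrite /tgt /tgtV /= ord_predK. Qed.

Hypothesis n2 : (1 < n)%N.

Lemma cyc_adjE (a b : 'I_(2 * n)) : cyc_adj a b = (b == ordS a) || (b == ord_pred a).
Proof.
rewrite /cyc_adj -(can2_eq (@ordSK _) (@ord_predK _)) -!val_eqE /=.
by congr orb; rewrite eq_sym.
Qed.

Lemma torus_adjE (v w : V) : torus_adj v w =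
  (w \in [:: tgt (v, false); tgtV (v, false); tgt (v, true); tgtV (v, true)]).
Proof.
case: v w => [a b] [c d]; rewrite /torus_adj !cyc_adjE !inE /tgt /tgtV /= !xpair_eqE.
by rewrite (eq_sym a) (eq_sym b) !andb_orr orbC -!orbA;
   do !(case: (_ == _) => //=).
Qed.

(** This needs cycles of length at least 4: on a cycle of length 2 both neighbours in a direction
    coincide, and edges indexed by [(v, d)] would be counted twice. *)
Lemma uniq_neighbours (v : V) :
  uniq [:: tgt (v, false); tgtV (v, false); tgt (v, true); tgtV (v, true)].
Proof.
case: v => [a b]; rewrite /= !inE /tgt /tgtV /= !xpair_eqE !ord_eqE.
rewrite !val_ordS !val_ord_pred.
have := ltn_ord a; have := ltn_ord b.
by do !(case: ifP => ?); lia.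
Qed.

(** The squares of both sides are the product over ordered adjacent pairs, grouped by pair on one
    side and by vertex with its four neighbours on the other. Nonnegativity removes the square. *)
Lemma prod_edges {R : realType} (F : V -> V -> R) :
  (forall v w, F v w = F w v) -> (forall v w, 0 <= F v w) ->
  \prod_(p : V * V | torus_adj p.1 p.2 && (enum_rank p.1 < enum_rank p.2)%N) F p.1 p.2 =
  \prod_(e : edge) F (src e) (tgt e).
Proof.
move=> Fsym F0.
suff: (\prod_(p : V * V | torus_adj p.1 p.2 && (enum_rank p.1 < enum_rank p.2)%N) F p.1 p.2) ^+ 2
  = (\prod_(e : edge) F (src e) (tgt e)) ^+ 2.
  by move/eqP; rewrite eqrXn2// ?prodr_ge0// => /eqP.
have sym (v w : V) : torus_adj v w = torus_adj w v.
  rewrite /torus_adj /cyc_adj; rewrite (eq_sym v.1) (eq_sym v.2).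
  by rewrite [X in _ && X || _]orbC [X in _ || (_ && X)]orbC.
have irr (v : V) : torus_adj v v = false.
  by have /= := uniq_neighbours v; rewrite torus_adjE !inE;
     case: v => [a b]; rewrite /tgt /tgtV /= !xpair_eqE !ord_eqE !val_ordS !val_ord_pred;
     move=> _; have := ltn_ord a; have := ltn_ord b; do !(case: ifP => ?); lia.
transitivity (\prod_(p : V * V | torus_adj p.1 p.2) F p.1 p.2).
  rewrite [RHS](bigID (fun p : V * V => (enum_rank p.1 < enum_rank p.2)%N)) /= expr2; congr (_ * _).
  rewrite [RHS](reindex_inj (h := fun p : V * V => (p.2, p.1))) /=; last first.
    by move=> [a b] [c d] [-> ->].
  apply: eq_big => [[v w]|[v w] _] //=.
  rewrite sym -leqNgt [in RHS]leq_eqVlt; case: (boolP (torus_adj w v)) => //= wv.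
  case: (eqVneq v w) wv => [->|vw _]; first by rewrite irr.
  case: eqP => //= e; have := @ord_inj _ _ _ e; move=> /enum_rank_inj e2; by rewrite e2 eqxx in vw.
rewrite -(pair_big_dep xpredT (@torus_adj n) F) /=.
have E v : \prod_(w | torus_adj v w) F v w =
  (F v (tgt (v, false)) * F v (tgt (v, true))) * (F v (tgtV (v, false)) * F v (tgtV (v, true))).
  rewrite (eq_bigl (fun w => w \in [:: tgt (v, false); tgtV (v, false); tgt (v, true); tgtV (v, true)])); last first.
    by move=> w; exact: torus_adjE.
  rewrite -big_uniq ?uniq_neighbours//= !big_cons big_nil; ring.
have E2 : \prod_(e : edge) F (src e) (tgt e) = \prod_v (F v (tgt (v, false)) * F v (tgt (v, true))).
  rewrite (eq_bigr (fun e : edge => F e.1 (tgt (e.1, e.2)))); last by case.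
  rewrite -(pair_big xpredT xpredT (fun v d => F v (tgt (v, d)))) /=.
  by apply: eq_bigr => v _; rewrite big_bool/= mulrC.
rewrite (eq_bigr _ (fun v _ => E v)) big_split /= -E2 expr2; congr (_ * _).
rewrite E2 !big_split /=; congr (_ * _).
  rewrite (reindex_inj (can_inj (tgtVK false))) /=.
  by apply: eq_bigr => v _; rewrite tgtVK Fsym.
rewrite (reindex_inj (can_inj (tgtVK true))) /=.
by apply: eq_bigr => v _; rewrite tgtVK Fsym.
Qed.

End Edges.
Arguments edge : clear implicits.

(** * Boltzmann weights as products of edge kernels *)

Section Weight.
Context {R : realType} {n : nat}.
Notation V := (vertex n).
Notation E := (edge n).

Definition wt (k : E -> R -> R) (phi : V -> R) : R :=
  \prod_(e : E) k e (phi (src e) - phi (tgt e)).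

Lemma wt_ge0 k phi : (forall e x, 0 <= k e x) -> 0 <= wt k phi.
Proof. by move=> k0; apply: prodr_ge0. Qed.

Lemma jmeas_edge (f : R -> R) (v w : V) : measurable_fun setT f ->
  jmeas (fun phi : V -> R => f (phi v - phi w) : measurableTypeR R).
Proof.
by move=> mf d X x mx; exact: (measurableT_comp mf (measurable_funB (mx v) (mx w))).
Qed.

Lemma jmeas_prod (I : Type) (r : seq I) (P : pred I) (F : I -> (V -> R) -> R) :
  (forall i, jmeas (F i : _ -> measurableTypeR R)) ->
  jmeas (fun phi => \prod_(i <- r | P i) F i phi : measurableTypeR R).
Proof.
move=> mF d X x mx; elim: r => [|i r IH].
  rewrite [X in measurable_fun _ X](_ : _ = fun=> 1); first exact: measurable_cst.
  by apply/funext => z; rewrite big_nil.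
rewrite [X in measurable_fun _ X](_ : _ = fun z => (if P i then F i (x^~ z) else 1) *
  \prod_(i <- r | P i) F i (x^~ z)); last first.
  by apply/funext => z; rewrite big_cons; case: (P i); rewrite ?mul1r.
apply: measurable_funM => //; case: (P i); last exact: measurable_cst.
exact: mF.
Qed.

Lemma jnn_EFin (F : (V -> R) -> R) : jmeas (F : _ -> measurableTypeR R) ->
  (forall phi, 0 <= F phi) -> jnn (fun phi => (F phi)%:E).
Proof.
move=> mF F0; split; last by move=> phi; rewrite lee_fin.
by move=> d X x mx; apply/measurable_EFinP; exact: mF.
Qed.

Lemma jmeas_wt (k : E -> R -> R) : (forall e, measurable_fun setT (k e)) ->
  jmeas (wt k : _ -> measurableTypeR R).
Proof. by move=> mk; apply: jmeas_prod => e; exact: jmeas_edge. Qed.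

Lemma jnn_wt (k : E -> R -> R) : (forall e, measurable_fun setT (k e)) -> (forall e x, 0 <= k e x) ->
  jnn (fun phi => (wt k phi)%:E).
Proof. by move=> mk k0; apply: jnn_EFin => [|phi]; [exact: jmeas_wt|exact: wt_ge0]. Qed.

Lemma wt_shift k phi c : wt k (fun v => phi v + c) = wt k phi.
Proof. by apply: eq_bigr => e _; congr (k e _); ring. Qed.

(** As no term is [-oo], the sum is [+oo] exactly when some term is, and then both sides are 0;
    infinite potentials need no separate treatment. *)
Lemma expeRN_sum (I : Type) (r : seq I) (P : pred I) (f : I -> \bar R) :
  (forall i, f i != -oo%E) ->
  expeR (- (\sum_(i <- r | P i) f i)%E)%E = (\prod_(i <- r | P i) fine (expeR (- f i)))%:E.
Proof.
move=> fN; elim: r => [|i r IH]; first by rewrite !big_nil /= oppr0 expR0.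
rewrite !big_cons; case: (P i) => //.
have sN : (\sum_(j <- r | P j) f j)%E != -oo%E.
  elim/big_ind: _ => // x y xN yN.
  by rewrite adde_eq_ninfty negb_or xN.
rewrite EFinM -IH; have := fN i; case: (f i) => //= [a _|_].
  case: (\sum_(j <- r | P j) f j)%E sN => //= [b _|_]; first by rewrite -EFinM -expRD opprD.
  by rewrite mule0.
by rewrite addye//= mul0e.
Qed.

Definition boltz (U : R -> \bar R) (x : R) : R := fine (expeR (- U x)).

Lemma weightE (U : R -> \bar R) (phi : V -> R) : (1 < n)%N ->
  (forall x, U x != -oo%E) -> (forall x, U (- x) = U x) ->
  weight U phi = (wt (fun=> boltz U) phi)%:E.
Proof.
move=> n2 UN Us; rewrite /weight /hamiltonian expeRN_sum//; congr EFin.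
rewrite (prod_edges n2 (F := fun v w => boltz U (phi v - phi w)))//.
  by move=> v w; rewrite /boltz -[in RHS]Us opprB.
by move=> v w; rewrite /boltz fine_ge0// expeR_ge0.
Qed.

End Weight.

(** * Reflection positivity *)

Section Cycle.
Context {n : nat} (n0 : (0 < n)%N).
Notation N := (2 * n)%N.
Notation I := 'I_(2 * n).
Implicit Types (i j : I) (a : nat).

(** The offset of [i] counted forward from [j] around the cycle. Reflections and foldings are
    defined in this coordinate, which reduces their identities to linear arithmetic. *)
Definition off j i : nat := if (j <= i)%N then (i - j)%N else (i + N - j)%N.
Definition pos j a : I := insubd j (if (j + a < N)%N then j + a else j + a - N)%N.
Definition antip j : I := pos j n.

Lemma val_pos j a : (a < N)%N ->
  nat_of_ord (pos j a) = (if (j + a < N)%N then j + a else j + a - N)%N.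
Proof.
move=> aN; rewrite /pos val_insubd; have := ltn_ord j.
by case: ifP => //; case: ifP; lia.
Qed.

Lemma ltn_off j i : (off j i < N)%N.
Proof. by rewrite /off; have := ltn_ord j; have := ltn_ord i; case: ifP; lia. Qed.

Lemma offK j : cancel (off j) (pos j).
Proof.
move=> i; apply: ord_inj; rewrite val_pos ?ltn_off// /off.
by have := ltn_ord j; have := ltn_ord i; case: ifP; case: ifP; lia.
Qed.

Lemma posK j a : (a < N)%N -> off j (pos j a) = a.
Proof.
move=> aN; rewrite /off val_pos//.
by have := ltn_ord j; case: ifP; case: ifP; lia.
Qed.

(* reflection of the sites through the line [j]: [x |-> 2 j - x] *)
Definition refl j i : I := pos j (if off j i == 0%N then 0 else N - off j i)%N.

(* reflection of the unit cells [[i, i + 1]] through the line [j] *)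
Definition rcell j i : I := pos j (N.-1 - off j i).

(* folding of the cells onto the half circle that starts at [j] *)
Definition fold j i : I := if (off j i < n)%N then i else rcell j i.

Lemma off_refl j i : off j (refl j i) = (if off j i == 0%N then 0 else N - off j i)%N.
Proof. by rewrite /refl posK//; have := ltn_off j i; case: ifP; lia. Qed.

Lemma off_inj j : injective (off j).
Proof. exact: can_inj (offK j). Qed.

Lemma reflK j : involutive (refl j).
Proof.
move=> i; apply: (@off_inj j); rewrite !off_refl; have := ltn_off j i.
by do !case: ifP; lia.
Qed.

Lemma off_rcell j i : off j (rcell j i) = (N.-1 - off j i)%N.
Proof. by rewrite /rcell posK//; lia. Qed.

Lemma rcellK j : involutive (rcell j).
Proof.
move=> i; apply: (@off_inj j); rewrite !off_rcell; have := ltn_off j i; lia.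
Qed.

Lemma off_ordS j i : off j (ordS i) = (if (off j i).+1 == N then 0 else (off j i).+1)%N.
Proof.
rewrite /off val_ordS; have := ltn_ord j; have := ltn_ord i.
by do !case: ifP; lia.
Qed.

Lemma rcellE j i : rcell j i = refl j (ordS i).
Proof.
apply: (@off_inj j); rewrite off_rcell off_refl off_ordS; have := ltn_off j i.
by do !case: ifP; lia.
Qed.

Lemma ordS_rcell j i : ordS (rcell j i) = refl j i.
Proof. by apply: (can_inj (reflK j)); rewrite reflK -rcellE rcellK. Qed.

Lemma odd_refl j i : odd (refl j i) = odd i.
Proof.
rewrite /refl val_pos; last by have := ltn_off j i; case: ifP; lia.
rewrite /off; have := ltn_ord j; have := ltn_ord i.
by do !case: ifP; lia.
Qed.

Lemma odd_ordS i : odd (ordS i) = ~~ odd i.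
Proof. by rewrite val_ordS; have := ltn_ord i; case: ifP; lia. Qed.

Lemma off_antip j i :
  off (antip j) i = (if (off j i < n)%N then off j i + n else off j i - n)%N.
Proof.
rewrite /off /antip val_pos; last lia.
have := ltn_ord j; have := ltn_ord i.
by do !case: ifP; lia.
Qed.

Lemma rcell_antip j i : rcell (antip j) i = rcell j i.
Proof.
apply: (@off_inj j); rewrite off_rcell.
have := off_antip j (rcell (antip j) i); rewrite off_rcell off_antip.
have := ltn_off j i; have := ltn_off j (rcell (antip j) i).
by do !case: ifP; lia.
Qed.

Lemma fold_antip j i : fold (antip j) i = if (off j i < n)%N then rcell j i else i.
Proof.
rewrite /fold off_antip rcell_antip.
by have := ltn_off j i; do !case: ifP => //; lia.
Qed.

(** The folding is based [n - m] steps before [j], so its half circle ends exactly where the run of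
    [m] cells from [j] ends, and the run is mirrored onto the next [m] cells. The case [m == n]
    keeps the offset below the length of the cycle. *)
Lemma fold_run j m a : (0 < m)%N -> (m <= n)%N -> (a < 2 * m)%N ->
  fold (pos j (if m == n then 0 else N + m - n)%N) (pos j a) =
  pos j (if (a < m)%N then a else (2 * m).-1 - a)%N.
Proof.
move=> m0 mn am; set j0 := pos j _.
have Hb : ((if m == n then 0 else N + m - n) < N)%N by case: ifP; lia.
have o k : (k < 2 * m)%N -> off j0 (pos j k) = (n - m + k)%N.
  move=> km; rewrite /j0 /off !val_pos//; last lia.
  have := ltn_ord j.
  by case: ifP => /eqP; do !case: ifP; lia.
rewrite /fold o//; case: ifP => am1; first by rewrite ifT//; lia.
rewrite ifF; last lia.
apply: (@off_inj j0); rewrite off_rcell !o//; lia.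
Qed.

End Cycle.

(** * The chessboard estimate on a cycle *)

Section Chessboard1.
Context {R : realType} {n : nat} (n0 : (0 < n)%N) {T : finType}.
Notation N := (2 * n)%N.
Notation cfg := {ffun 'I_(2 * n) -> T}.
Variable F : cfg -> R.
Hypothesis F0 : forall c, 0 < F c.

Definition foldc (j : 'I_(2 * n)) (c : cfg) : cfg := [ffun i => c (fold j i)].

Hypothesis FR : forall j c, F c ^+ 2 <= F (foldc j c) * F (foldc (antip j) c).

(* Chessboard estimate on a cycle: the normalized functional [rho] below is
   maximal at some configuration, foldings preserve maximality, and repeated
   foldings double a run of equal cells until the configuration is constant. *)
Lemma chessboard_cycle c : F c ^+ N <= \prod_i F [ffun=> c i].
Proof.
pose P (c : cfg) := \prod_i F [ffun=> c i].
have P0 d : 0 < P d by apply: prodr_gt0.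
pose rho d := F d ^+ N / P d.
have rho0 d : 0 < rho d by rewrite divr_gt0// exprn_gt0.
have Pfold j d : P (foldc j d) * P (foldc (antip j) d) = P d ^+ 2.
  rewrite /P -big_split /= expr2.
  rewrite [X in _ = _ * X](reindex_inj (can_inj (rcellK n0 j))) /= -big_split.
  apply: eq_bigr => i _; rewrite !ffunE fold_antip// /fold.
  by case: ifP => // _; rewrite mulrC.
have rhofold j d : rho d ^+ 2 <= rho (foldc j d) * rho (foldc (antip j) d).
  rewrite /rho mulrACA -invfM Pfold expr_div_n ler_pM2r ?invr_gt0 ?exprn_gt0//.
  by rewrite -exprM mulnC exprM -exprMn lerXn2r// ?nnegrE ?sqr_ge0// mulr_ge0// ltW.
have [m mmax] : exists m, forall d, rho d <= rho m.
  pose x := [arg max_(d > c) rho d]%O.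
  exists x => d; rewrite /x; case: arg_maxP => // i _; exact.
pose M d := forall d', rho d' <= rho d.
have Mfold j d : M d -> M (foldc j d).
  (* The values of [rho] at the two foldings have product at least [rho d ^ 2], and neither exceeds
     the maximum [rho d], so both are maximal. *)
  move=> Md d'; apply: (le_trans (Md d')).
  rewrite -(ler_pM2r (rho0 d)) -expr2; apply: (le_trans (rhofold j d)).
  by rewrite ler_pM2l//; exact: Md.
have N0 : (0 < N)%N by lia.
pose j := Ordinal N0.
have runs p : exists d, M d /\
    exists t, forall a, (a < minn (2 ^ p) N)%N -> d (pos j a) = t.
  elim: p => [|p [d [Md [t dt]]]].
    exists m; split => //; exists (m (pos j 0)) => a.
    by rewrite expn0 (minn_idPl N0) ltnS leqn0 => /eqP ->.
  (* [2 * n] need not be a power of 2: once the run exceeds a half circle, only [n] of its cells are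
     used, and one folding fills the cycle. *)
  pose r := minn (2 ^ p) n.
  have r0 : (0 < r)%N by rewrite /r leq_min expn_gt0.
  have rn : (r <= n)%N by rewrite /r geq_minr.
  have rp : (r <= 2 ^ p)%N by rewrite /r geq_minl.
  exists (foldc (pos j (if r == n then 0 else N + r - n)%N) d); split; first exact: Mfold.
  exists t => a; rewrite expnS => amin.
  have a2r : (a < 2 * r)%N by move: amin; rewrite /r; lia.
  rewrite ffunE fold_run//; apply: dt; rewrite leq_min.
  by case: ifP; lia.
have [d [Md [t dt]]] := runs N.
have dE : d = [ffun=> t].
  apply/ffunP => i; rewrite ffunE -(offK n0 j i) dt// leq_min ltn_off// andbT.
  exact: ltn_trans (ltn_off n0 j i) (ltn_expl _ _).
have := Md c; have -> : rho d = 1.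
  rewrite /rho /P (eq_bigr (fun=> F d)) => [|i _]; last first.
    by congr F; apply/ffunP => k; rewrite dE !ffunE.
  by rewrite prodr_const card_ord divff// gt_eqF// exprn_gt0.
by rewrite /rho ler_pdivrMr ?mul1r.
Qed.

End Chessboard1.

(** * The reflection inequality for iterated integrals *)

Section ReflectionPositivity.
Context {R : realType} {n : nat}.
Local Open Scope ereal_scope.
Notation V := (vertex n).

(** Stated for extended reals, it can be used under an integral without any finiteness check; [l] is
    optimized once the integrals are known to be finite. *)
Lemma mule_AMGM (x y : \bar R) (l : R) : (0 < l)%R -> 0 <= x -> 0 <= y ->
  x * y <= (l / 2)%:E * (x * x) + ((2 * l)^-1)%:E * (y * y).
Proof.
move=> l0; have l2 : (0 < l / 2)%R by rewrite divr_gt0.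
have l3 : (0 < (2 * l)^-1)%R by rewrite invr_gt0 mulr_gt0.
have cle (a b : \bar R) : 0 <= b -> a <= +oo + b.
  by move=> b0; rewrite addye ?leey//; case: b b0.
case: x y => [x| |] [y| |] //=.
- move=> _ _; rewrite -!EFinM -EFinD lee_fin -subr_ge0.
  have -> : (l / 2 * (x * x) + (2 * l)^-1 * (y * y) - x * y = (l * x - y) ^+ 2 / (2 * l))%R.
    by field; lra.
  by apply: divr_ge0; rewrite ?sqr_ge0// mulr_ge0// ltW.
- move=> x0 _; have -> : ((2 * l)^-1)%:E * (+oo * +oo) = +oo :> \bar R.
    by rewrite mulyy gt0_muley.
  by rewrite addeC; apply: cle; rewrite -!EFinM lee_fin !mulr_ge0// ltW.
- move=> _ y0; have -> : (l / 2)%:E * (+oo * +oo) = +oo :> \bar R.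
    by rewrite mulyy gt0_muley.
  by apply: cle; rewrite -!EFinM lee_fin !mulr_ge0// ltW.
- move=> _ _; have -> : (l / 2)%:E * (+oo * +oo) = +oo :> \bar R.
    by rewrite mulyy gt0_muley.
  by apply: cle; rewrite !mule_ge0// lee_fin ltW.
Qed.

Implicit Types (s : seq V) (phi : V -> R).

Lemma iint_factor s0 s1 s2 (GL GR : (V -> R) -> \bar R) phi : jnn GL -> jnn GR ->
  (forall v, v \in s2 -> indep GL v) -> (forall v, v \in s1 -> indep GR v) ->
  iint (s0 ++ s1 ++ s2) (fun psi => GL psi * GR psi) phi =
  iint s0 (fun psi => iint s1 GL psi * iint s2 GR psi) phi.
Proof.
move=> FL FR iL iR; rewrite iint_cat; apply: eq_iint => psi; rewrite iint_cat.
have E2 x : iint s2 (fun psi => GL psi * GR psi) x = GL x * iint s2 GR x.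
  exact: iintZ_indep.
rewrite (eq_iint _ _ E2).
under eq_iint do rewrite muleC.
rewrite iintZ_indep//; first by rewrite muleC.
- exact: jnn_iint.
- by move=> v vs; apply: indep_iintI; exact: iR.
Qed.

(* Reflection through lines of sites: conditionally on the heights on the fixed
   lines the two halves are independent, so the Cauchy-Schwarz inequality
   (here in the form 2ab <= l a^2 + b^2 / l) suffices. *)
Lemma reflection_ineq (th : V -> V) s0 sL (GL GR : (V -> R) -> \bar R) phi (l : R) :
  involutive th -> (0 < l)%R -> jnn GL -> jnn GR ->
  (forall v, [\/ th v = v, v \in sL | v \in map th sL]) ->
  (forall v, v \in map th sL -> indep GL v) -> (forall v, v \in sL -> indep GR v) ->
  iint (s0 ++ sL ++ map th sL) (fun psi => GL psi * GR psi) phi <=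
    (l / 2)%:E * iint (s0 ++ sL ++ map th sL) (fun psi => GL psi * GL (psi \o th)) phi +
    ((2 * l)^-1)%:E * iint (s0 ++ sL ++ map th sL) (fun psi => GR (psi \o th) * GR psi) phi.
Proof.
move=> thK l0 FL FR cov iL iR.
have jth G : jnn G -> jnn (fun psi => G (psi \o th)).
  move=> [mG G0]; split => // d X x mx.
  by apply: (mG _ _ (fun v => x (th v))) => v; exact: mx.
have ith G v : indep G (th v) -> indep (fun psi => G (psi \o th)) v.
  move=> iG psi x; rewrite -[RHS](iG _ x); congr G; apply/funext => u.
  by rewrite /upd /= (can2_eq thK thK).
have thsL v : v \in sL -> th v \in map th sL by move=> vs; apply/mapP; exists v.
have sthL v : v \in map th sL -> th v \in sL by move=> /mapP[w ws ->]; rewrite thK.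
have iL' v : v \in sL -> indep (fun psi => GL (psi \o th)) v.
  by move=> vs; apply: ith; apply: iL; exact: thsL.
have iR' v : v \in map th sL -> indep (fun psi => GR (psi \o th)) v.
  by move=> vs; apply: ith; apply: iR; exact: sthL.
have EL psi : iint (map th sL) (fun psi => GL (psi \o th)) psi = iint sL GL psi.
  rewrite iint_relabel// (@eq_iint _ _ _ _ GL) => [|chi]; last first.
    by congr GL; apply/funext => v /=; rewrite thK.
  apply: indep_agree => v; case: (cov v) => [->|vs _|vs _]; first by rewrite eqxx.
    exact: indep_iint.
  by apply: indep_iintI; exact: iL.
have ER psi : iint sL (fun psi => GR (psi \o th)) psi = iint (map th sL) GR psi.
  rewrite iint_relabel//; apply: indep_agree => v.
  case: (cov v) => [->|vs _|vs _]; first by rewrite eqxx.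
    exact: indep_iint.
  by apply: indep_iintI; exact: iR'.
rewrite !iint_factor//; try exact: jth.
have FA := jnn_iint sL FL; have FB := jnn_iint (map th sL) FR.
apply: (@le_trans _ _ (iint s0 (fun psi => (l / 2)%:E * (iint sL GL psi * iint sL GL psi) +
   ((2 * l)^-1)%:E * (iint (map th sL) GR psi * iint (map th sL) GR psi)) phi)).
  apply: le_iint.
  - exact: jnnM.
  - by apply: jnnD; apply: jnnZ; rewrite ?lee_fin ?divr_ge0 ?invr_ge0 ?mulr_ge0 ?ltW//; exact: jnnM.
  - by move=> psi; apply: mule_AMGM => //; exact: iint_ge0.
rewrite iintD//; try (apply: jnnZ; rewrite ?lee_fin ?divr_ge0 ?invr_ge0 ?mulr_ge0 ?ltW//; exact: jnnM).
rewrite !iintZ//; try exact: jnnM; try (by rewrite ?divr_ge0 ?invr_ge0 ?mulr_ge0 ?ltW).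
have E1 psi : iint sL GL psi * iint (map th sL) (fun psi => GL (psi \o th)) psi =
  iint sL GL psi * iint sL GL psi by rewrite EL.
have E2 psi : iint sL (fun psi => GR (psi \o th)) psi * iint (map th sL) GR psi =
  iint (map th sL) GR psi * iint (map th sL) GR psi by rewrite ER.
by rewrite (eq_iint _ _ E1) (eq_iint _ _ E2).
Qed.

End ReflectionPositivity.

Section Pinning.
Context {R : realType} {n : nat}.
Notation V := (vertex n).

Definition unpinned (p : V) : seq V := [seq v <- enum V | v != p].

Lemma uniq_unpinned p : uniq (unpinned p).
Proof. by rewrite filter_uniq// enum_uniq. Qed.

Lemma mem_unpinned p v : (v \in unpinned p) = (v != p).
Proof. by rewrite mem_filter mem_enum andbT. Qed.

Definition ipin (p : V) (F : (V -> R) -> \bar R) : \bar R := iint (unpinned p) F (fun=> 0).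

Lemma ipin_repin p q F : jnn F -> (forall phi c, F (fun v => phi v + c) = F phi) ->
  ipin p F = ipin q F.
Proof.
move=> FF Finv; have [->//|pq] := eqVneq p q.
pose s := [seq v <- enum V | (v != p) && (v != q)].
have us : uniq s by rewrite filter_uniq// enum_uniq.
have ms v : (v \in s) = (v != p) && (v != q) by rewrite mem_filter mem_enum andbT.
have perm a b : a != b -> s =i [pred v | (v != a) && (v != b)] -> perm_eq (unpinned a) (b :: s).
  move=> ab sE; apply: uniq_perm => [||v]; first exact: uniq_unpinned.
    by rewrite /= us andbT sE inE eqxx andbF.
  by rewrite mem_unpinned inE sE inE; have [->|vb] := eqVneq v b; rewrite ?andbT// eq_sym ab.
rewrite /ipin (perm_iint _ (perm p q pq _) FF); last by move=> v; rewrite ms inE.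
rewrite (perm_iint _ (perm q p _ _) FF); last 2 first.
- by rewrite eq_sym.
- by move=> v; rewrite ms inE andbC.
apply: iint_repin => //; try by rewrite ms eqxx ?andbF.
by move=> v; rewrite ms; case: (v == p) => //; case: (v == q).
Qed.

End Pinning.

(** * The chessboard estimate on the torus *)

Section Torus.
Context {R : realType} {n : nat} (n0 : (0 < n)%N).
Notation V := (vertex n).
Notation N := (2 * n)%N.

Definition origin0 : 'I_N := insubd (Ordinal (ltac:(lia) : (0 < 2 * n)%N)) n.-1.
Definition origin : V := (origin0, origin0).

Lemma is_originE (v : V) : is_origin v = (v == origin).
Proof.
have o : nat_of_ord origin0 = n.-1 by rewrite val_insubd ifT//; lia.
case: v => a b; rewrite /is_origin /origin xpair_eqE /coord !subr_eq0 /= !ord_eqE !o.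
by [].
Qed.

Lemma pin_integralE (F : (V -> R) -> \bar R) : pin_integral F = ipin origin F.
Proof.
rewrite /pin_integral /ipin /unpinned; congr (iint _ _ _).
by apply: eq_filter => v; rewrite is_originE.
Qed.

Variables (a0 a1 : R -> R).
Hypotheses (a0m : measurable_fun setT a0) (a1m : measurable_fun setT a1).
Hypotheses (a0_ge0 : forall x, 0 <= a0 x) (a1_ge0 : forall x, 0 <= a1 x).
Hypotheses (a0N : forall x, a0 (- x) = a0 x) (a1N : forall x, a1 (- x) = a1 x).

(* An edge class is a pair (direction, parity of the line containing it); every
   unit cell has exactly one edge in each class.  [cell d p t i1 i2 j1 j2] is the
   weight of the cell with corners [{i1, i2} x {j1, j2}], whose edge in the class
   [(d, p)] carries [a1] instead of [a0] when [t] holds. *)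
Definition aweight (b : bool) : R -> R := if b then a1 else a0.

Definition cell (d p t : bool) (i1 i2 j1 j2 : 'I_N) (phi : V -> R) : R :=
  aweight [&& t, ~~ d & odd j1 == p] (phi (i1, j1) - phi (i2, j1)) *
  aweight [&& t, ~~ d & odd j2 == p] (phi (i1, j2) - phi (i2, j2)) *
  (aweight [&& t, d & odd i1 == p] (phi (i1, j1) - phi (i1, j2)) *
   aweight [&& t, d & odd i2 == p] (phi (i2, j1) - phi (i2, j2))).

(** Each edge borders two cells and hence occurs twice in the product; [a0] and [a1] will be square
    roots of the actual edge kernels. *)
Definition cells d p (c : V -> bool) (phi : V -> R) : R :=
  \prod_(f : V) cell d p (c f) f.1 (ordS f.1) f.2 (ordS f.2) phi.

Lemma aweight_ge0 b x : 0 <= aweight b x.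
Proof. by case: b. Qed.
Lemma aweightN b x : aweight b (- x) = aweight b x.
Proof. by case: b; rewrite /= ?a0N ?a1N. Qed.
Lemma maweight b : measurable_fun setT (aweight b).
Proof. by case: b. Qed.

Lemma cell_ge0 d p t i1 i2 j1 j2 phi : 0 <= cell d p t i1 i2 j1 j2 phi.
Proof. by rewrite !mulr_ge0// aweight_ge0. Qed.

Lemma jmeas_cell d p t i1 i2 j1 j2 :
  jmeas (cell d p t i1 i2 j1 j2 : _ -> measurableTypeR R).
Proof.
move=> d' X x mx.
by do 2 (apply: measurable_funM);
  apply: (@jmeas_edge R n (aweight _) _ _ (maweight _) _ _ x mx).
Qed.

Lemma cell_flip1 d p t i1 i2 j1 j2 phi :
  cell d p t i1 i2 j1 j2 phi = cell d p t i2 i1 j1 j2 phi.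
Proof.
rewrite /cell -[in LHS](aweightN _ (phi (i1, j1) - phi (i2, j1))).
rewrite -[in LHS](aweightN _ (phi (i1, j2) - phi (i2, j2))) !opprB; ring.
Qed.

Lemma jnn_prodcell d p (c : V -> bool) (P : pred V) :
  jnn (fun phi => (\prod_(f | P f) cell d p (c f) f.1 (ordS f.1) f.2 (ordS f.2) phi)%:E).
Proof.
apply: jnn_EFin => [|phi]; last by apply: prodr_ge0 => f _; exact: cell_ge0.
by apply: jmeas_prod => f; exact: jmeas_cell.
Qed.

Lemma jnn_cells d p c : jnn (fun phi => (cells d p c phi)%:E).
Proof. exact: jnn_prodcell. Qed.

Lemma cells_shift d p c phi x : cells d p c (fun v => phi v + x) = cells d p c phi.
Proof.
apply: eq_bigr => f _; rewrite /cell.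
by congr (aweight _ _ * aweight _ _ * (aweight _ _ * aweight _ _)); ring.
Qed.

Definition cellsZ d p c : \bar R := ipin origin (fun phi => (cells d p c phi)%:E).

Definition fold1 (j : 'I_N) (c : V -> bool) : V -> bool := fun f => c (fold j f.1, f.2).

Definition th (j : 'I_N) (v : V) : V := (refl j v.1, v.2).
Definition thc (j : 'I_N) (f : V) : V := (rcell j f.1, f.2).

Lemma thK j : involutive (th j).
Proof. by move=> [x y]; rewrite /th /= reflK. Qed.
Lemma thcK j : involutive (thc j).
Proof. by move=> [x y]; rewrite /thc /= rcellK. Qed.

Lemma cell_th j d p t (f : V) phi :
  cell d p t f.1 (ordS f.1) f.2 (ordS f.2) (phi \o th j) =
  cell d p t (thc j f).1 (ordS (thc j f).1) (thc j f).2 (ordS (thc j f).2) phi.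
Proof.
case: f => x y; rewrite cell_flip1 /thc [in RHS]/= ordS_rcell// rcellE//.
by rewrite /cell !odd_refl.
Qed.

Lemma indep_prodcell d p (c : V -> bool) (P : pred V) (v : V) :
  (forall f, P f -> v.1 != f.1 /\ v.1 != ordS f.1) ->
  indep (fun phi : V -> R => (\prod_(f | P f) cell d p (c f) f.1 (ordS f.1) f.2 (ordS f.2) phi)%:E) v.
Proof.
move=> H phi x; congr EFin; apply: eq_bigr => f /H[v1 v2].
have E a b : a \in [:: f.1; ordS f.1] -> upd phi v x (a, b) = phi (a, b).
  rewrite /upd; case: v v1 v2 {H} => v w /= v1 v2.
  by rewrite !inE => /orP[]/eqP ->; rewrite xpair_eqE eq_sym ?(negbTE v1) ?(negbTE v2).
by rewrite /cell !E// !inE eqxx ?orbT.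
Qed.

(** Repinning at a vertex on the axis makes the pinning symmetric. The cells then split into two
    halves exchanged by the reflection, and no cell depends on a vertex strictly inside the other
    half. *)
Lemma cellsZ_reflect d p c j (l : R) : 0 < l ->
  (cellsZ d p c <= (l / 2)%:E * cellsZ d p (fold1 j c) +
    ((2 * l)^-1)%:E * cellsZ d p (fold1 (antip j) c))%E.
Proof.
move=> l0.
pose L := fun i : 'I_N => (off j i < n)%N.
pose q : V := (j, j).
have repin c' : cellsZ d p c' = ipin q (fun phi => (cells d p c' phi)%:E).
  apply: ipin_repin; first exact: jnn_cells.
  by move=> phi x; rewrite cells_shift.
rewrite !repin.
pose s0 := [seq v <- enum V | ((off j v.1 == 0%N) || (off j v.1 == n)) && (v != q)].
pose sL := [seq v <- enum V | (0 < off j v.1 < n)%N].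
have in0 v : (v \in s0) = ((off j v.1 == 0%N) || (off j v.1 == n)) && (v != q).
  by rewrite mem_filter mem_enum andbT.
have inL v : (v \in sL) = (0 < off j v.1 < n)%N by rewrite mem_filter mem_enum andbT.
have inR v : (v \in map (th j) sL) = (n < off j v.1)%N.
  apply/mapP/idP => [[[x y]]|nv].
    by rewrite inL /= => /andP[x0 xn] -> /=; rewrite off_refl//; case: ifP; lia.
  exists (th j v); last by rewrite thK.
  rewrite inL /=; case: v nv => a b /= nv; rewrite off_refl//.
  by have := ltn_off n0 j a; case: ifP; lia.
have permE : perm_eq (unpinned q) (s0 ++ sL ++ map (th j) sL).
  apply: uniq_perm; first exact: uniq_unpinned.
    have usL : uniq sL by rewrite filter_uniq ?enum_uniq.
    rewrite !cat_uniq usL (map_inj_uniq (can_inj (thK j))) usL filter_uniq ?enum_uniq//= andbT.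
    apply/andP; split; apply/hasPn => v; rewrite ?mem_cat ?inR ?in0 ?inL; case: v => a b /=; lia.
  move=> v; rewrite mem_unpinned !mem_cat inR in0 inL; case: v => a b /=.
  have [[-> _]|] := eqVneq (a, b) q; last by lia.
  by rewrite /off leqnn subnn; lia.
pose W c' (P : pred V) phi := (\prod_(f | P f) cell d p (c' f) f.1 (ordS f.1) f.2 (ordS f.2) phi)%:E.
have FW c' P : jnn (W c' P) by exact: jnn_prodcell.
have WE c' phi : (cells d p c' phi)%:E = (W c' (fun f => L f.1) phi * W c' (fun f => ~~ L f.1) phi)%E.
  by rewrite /W -EFinM; congr EFin; exact: bigID.
have Wth c' (P : pred V) phi :
    W c' P (phi \o th j) = W (fun f => c' (thc j f)) (fun f => P (thc j f)) phi.
  rewrite /W; congr EFin; rewrite (reindex_inj (can_inj (thcK j))).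
  by apply: eq_bigr => f _; rewrite cell_th thcK.
have Lr i : L (rcell j i) = ~~ L i by rewrite /L off_rcell//; have := ltn_off n0 j i; lia.
have E1 phi : (W c (fun f => L f.1) phi * W c (fun f => L f.1) (phi \o th j))%E =
   (cells d p (fold1 j c) phi)%:E.
  rewrite WE Wth; congr (_ * _)%E; congr EFin; apply: eq_big => f //=; rewrite ?Lr//.
    by move=> Lf; rewrite /fold1 /fold -/(L f.1) Lf; case: f Lf.
  by rewrite /fold1 /fold -/(L f.1) => /negbTE ->; case: f.
have E2 phi : (W c (fun f => ~~ L f.1) (phi \o th j) * W c (fun f => ~~ L f.1) phi)%E =
   (cells d p (fold1 (antip j) c) phi)%:E.
  rewrite WE Wth; congr (_ * _)%E; congr EFin; apply: eq_big => f //=; rewrite ?Lr ?negbK//.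
    by rewrite /fold1 fold_antip// -/(L f.1) => ->; case: f.
  by rewrite /fold1 fold_antip// -/(L f.1) => /negbTE ->; case: f.
rewrite /ipin !(perm_iint _ permE); try exact: jnn_cells.
rewrite (eq_iint _ _ (WE c)).
have := @reflection_ineq R n (th j) s0 sL _ _ (fun=> 0) l (thK j) l0
  (FW c (fun f => L f.1)) (FW c (fun f => ~~ L f.1)).
rewrite (eq_iint _ _ E1) (eq_iint _ _ E2); apply.
- case=> x y; rewrite inR inL /=.
  have [l1|l1] := ltnP n (off j x); first by constructor 3.
  have [l2|l2] := boolP (0 < off j x < n)%N; first by constructor 2.
  constructor 1; rewrite /th /=; congr pair.
  by apply: (@off_inj _ n0 j); rewrite off_refl//; case: ifP; lia.
- case=> x y; rewrite inR /= => nv; apply: indep_prodcell => -[a b] /= Lf.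
  have := ltn_off n0 j a.
  by split; apply/eqP => vf; move: nv Lf; rewrite vf /L ?off_ordS//; try (case: ifP); lia.
- case=> x y; rewrite inL /= => vL; apply: indep_prodcell => -[a b] /= Lf.
  have := ltn_off n0 j a.
  by split; apply/eqP => vf; move: vL Lf; rewrite vf /L ?off_ordS//; try (case: ifP); lia.
Qed.

Definition sw (v : V) : V := (v.2, v.1).
Lemma swK : involutive sw. Proof. by case. Qed.

(** Exchanging the coordinates turns the estimate for columns into one for rows, with the other edge
    direction. *)
Lemma cellsZ_swap d p c : cellsZ d p c = cellsZ (~~ d) p (c \o sw).
Proof.
rewrite /cellsZ /ipin.
have swo : sw origin = origin by [].
rewrite (@perm_iint _ _ _ (map sw (unpinned origin))); last exact: jnn_cells.
  rewrite iint_relabel; last exact: swK.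
  apply: eq_iint => phi; congr EFin; rewrite /cells (reindex_inj (can_inj swK)) /=.
  apply: eq_bigr => f _; rewrite /cell /= negbK.
  by rewrite [LHS]mulrC; congr (_ * _); congr (_ * _); congr (aweight _ _); rewrite ?andbA.
apply: uniq_perm; rewrite ?(map_inj_uniq (can_inj swK)) ?uniq_unpinned//.
move=> v; rewrite -[in RHS](swK v) (mem_map (can_inj swK)) !mem_unpinned.
by rewrite -[in LHS]swo (can2_eq swK swK).
Qed.

Hypothesis cellsZ_gt0 : forall d p c, (0 < cellsZ d p c)%E.
Hypothesis cellsZ_fin : forall d p c, (cellsZ d p c < +oo)%E.

Let f d p c : R := fine (cellsZ d p c).
Let f_gt0 d p c : 0 < f d p c.
Proof. by rewrite fine_gt0// cellsZ_gt0 cellsZ_fin. Qed.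
Let fE d p c : cellsZ d p c = (f d p c)%:E.
Proof. by rewrite fineK// ge0_fin_numE ?cellsZ_fin// ltW. Qed.

Lemma cellsZ_CS d p c j : f d p c ^+ 2 <= f d p (fold1 j c) * f d p (fold1 (antip j) c).
Proof.
have x0 := f_gt0 d p c; have a0' := f_gt0 d p (fold1 j c).
have b0' := f_gt0 d p (fold1 (antip j) c).
set x := f d p c in x0 *; set a := f _ _ (fold1 j c) in a0' *; set b := f _ _ _ in b0' *.
have l0 : 0 < x / a by exact: divr_gt0.
(* With [l = x / a] the first term is [x / 2], and the inequality rearranges to [x ^ 2 <= a * b]. *)
have := cellsZ_reflect d p c j l0; rewrite !fE -/x -/a -/b -!EFinM -EFinD lee_fin.
have -> : x / a / 2 * a + (2 * (x / a))^-1 * b = x / 2 + a * b / (2 * x).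
  by field; lra.
move=> H; have {}H : x / 2 <= a * b / (2 * x) by lra.
move: H; rewrite ler_pdivlMr ?mulr_gt0// => H.
apply: le_trans H; rewrite expr2; lra.
Qed.

(** The cycle estimate applies with whole columns of marks as the states of its cells. *)
Lemma chessboard_columns d p (c : V -> bool) :
  f d p c ^+ N <= \prod_(i : 'I_N) f d p (fun v => c (i, v.2)).
Proof.
pose T := {ffun 'I_N -> bool}.
pose F (C : {ffun 'I_N -> T}) := f d p (fun v => C v.1 v.2).
have H := @chessboard_cycle R n n0 T F (fun C => f_gt0 _ _ _).
have := H _ [ffun i => [ffun j => c (i, j)]].
rewrite /F (_ : (fun v : V => _) = c); last first.
  by apply/funext => -[x y]; rewrite !ffunE.
move=> /(_ _)/le_trans; apply.
  move=> j C; have := cellsZ_CS d p (fun v => C v.1 v.2) j.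
  rewrite /fold1 /=; congr (_ <= f _ _ _ * f _ _ _);
    by apply/funext => v; rewrite ffunE.
rewrite le_eqVlt; apply/orP; left; apply/eqP; apply: eq_bigr => i _.
by congr f; apply/funext => v; rewrite !ffunE.
Qed.

(** The columns are equalized first; the resulting configurations depend on one coordinate only and
    are equalized in the other direction after a swap. *)
Lemma chessboard d p (c : V -> bool) :
  f d p c ^+ (N * N) <= \prod_(v : V) f d p (fun=> c v).
Proof.
have rows (r : 'I_N -> bool) :
    f d p (fun v => r v.2) ^+ N <= \prod_(j : 'I_N) f d p (fun=> r j).
  rewrite /f cellsZ_swap; apply: (le_trans (chessboard_columns _ _ _)).
  rewrite le_eqVlt; apply/orP; left; apply/eqP; apply: eq_bigr => i _.
  by rewrite /f [in RHS]cellsZ_swap.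
rewrite exprM; apply: le_trans (_ : (\prod_(i : 'I_N) f d p (fun v => c (i, v.2))) ^+ N <= _).
  apply: lerXn2r; last exact: chessboard_columns.
    by rewrite nnegrE exprn_ge0// ltW.
  by rewrite nnegrE prodr_ge0// => i _; rewrite ltW.
rewrite [X in _ <= X](eq_bigr (fun v : V => f d p (fun=> c (v.1, v.2)))); last by case.
rewrite -(pair_big xpredT xpredT (fun i j => f d p (fun=> c (i, j)))) /= -prodrXl.
apply: ler_prod => i _; apply/andP; split; first by rewrite exprn_ge0 ?ltW.
exact: (rows (fun j => c (i, j))).
Qed.

End Torus.

(** * Partition function bounds and the Peierls estimate *)

Section Tree.
Context {R : realType} {n : nat}.
Notation V := (vertex n).
Notation E := (edge n).
Notation leb := (@lebesgue_measure R).

(** A vertex of maximal rank is the parent of no vertex in [s], so its height occurs in a single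
    factor. It is integrated first, and translation invariance makes the result independent of the
    height of its parent. *)
Lemma iint_tree (s : seq V) (par : V -> V) (rank : V -> nat) (k : V -> R -> R) phi :
  uniq s -> (forall v, v \in s -> (rank (par v) < rank v)%N) ->
  (forall v, measurable_fun setT (k v)) -> (forall v x, 0 <= k v x) ->
  iint s (fun psi => (\prod_(v <- s) k v (psi v - psi (par v)))%:E) phi =
  (\prod_(v <- s) \int[leb]_x (k v x)%:E)%E.
Proof.
move=> us rk mk k0.
have FF (r : seq V) : jnn (fun psi => (\prod_(v <- r) k v (psi v - psi (par v)))%:E).
  apply: jnn_EFin => [|psi]; last by apply: prodr_ge0 => v _; exact: k0.
  by apply: jmeas_prod => v; apply: (@jmeas_edge R n (k _)).
have [m] := ubnP (size s); elim: m s us rk phi => // m IH s us rk phi sm.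
case: (posnP (size s)) => [/size0nil ->|s0]; first by rewrite /= !big_nil.
have [v vs vmax] : exists2 v, v \in s & forall w, w \in s -> (rank w <= rank v)%N.
  case: s s0 {us rk sm} => // x0 s _.
  pose v := [arg max_(i > x0 | i \in x0 :: s) rank i].
  exists v; first by rewrite /v; case: arg_maxnP => //; rewrite mem_head.
  by move=> w ws; rewrite /v; case: arg_maxnP => [|i _]; [rewrite mem_head|apply].
pose s' := rem v s.
have us' : uniq s' by exact: rem_uniq.
have vs' : v \notin s' by rewrite mem_rem_uniqF.
have perm : perm_eq s (s' ++ [:: v]) by rewrite (perm_trans (perm_to_rem vs))// -cat1s perm_catC.
have s'P w : w \in s' -> w \in s /\ w != v.
  by rewrite mem_rem_uniq// inE => /andP[].
rewrite (perm_big _ perm) big_cat big_seq1 /= (perm_iint _ perm (FF s)) iint_cat.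
rewrite -(IH s' us' _ phi); last 2 first.
- by move=> w /s'P[ws _]; exact: rk.
- by rewrite size_rem// prednK.
pose c := (\int[leb]_x (k v x)%:E)%E.
transitivity (iint s' (fun psi => c * (\prod_(w <- s') k w (psi w - psi (par w)))%:E)%E phi); last first.
  have c0 : (0 <= c)%E by apply: integral_ge0 => x _; rewrite lee_fin.
  rewrite muleC (@iintZ_indep _ _ _ _ (fun=> c))//; exact: jnn_cst.
apply: eq_iint => psi /=.
have pv : par v != v by apply: contraTneq (rk v vs) => ->; rewrite ltnn.
pose P := \prod_(w <- s') k w (psi w - psi (par w)).
transitivity (\int[leb]_x ((k v (x - psi (par v)))%:E * P%:E))%E.
  apply: eq_integral => x _; rewrite -EFinM; congr EFin.
  rewrite (perm_big _ perm) big_cat big_seq1 /= mulrC; congr (_ * _).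
    by rewrite eqxx (negbTE pv).
  rewrite /P; apply: eq_big_seq => w ws'.
  have [ws wv] := s'P _ ws'; rewrite (negbTE wv) ifF//.
  by apply: contraTF (rk w ws) => /eqP ->; rewrite -leqNgt vmax.
under eq_integral do rewrite muleC.
rewrite ge0_integralZl//; last 3 first.
- by apply/measurable_EFinP; apply: measurableT_comp => //; exact: measurable_funB.
- by move=> x _; rewrite lee_fin.
- by rewrite lee_fin prodr_ge0.
rewrite muleC; congr (_ * _)%E; rewrite /c.
rewrite -[RHS](@ge0_integral_translate _ _ (- psi (par v)))//.
  exact/measurable_EFinP.
by move=> x; rewrite lee_fin.
Qed.

End Tree.

Section TorusTree.
Context {R : realType} {n : nat} (n0 : (0 < n)%N).
Notation V := (vertex n).
Notation E := (edge n).
Notation N := (2 * n)%N.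
Notation leb := (@lebesgue_measure R).

Definition zero_ord : 'I_N := Ordinal (ltac:(lia) : (0 < 2 * n)%N).
Definition corner : V := (zero_ord, zero_ord).

(* Comb with spine in direction [~~ d] and teeth in direction [d]. *)
Definition tree_dir (d : bool) (v : V) : bool :=
  if (0 < nat_of_ord (if d then v.2 else v.1))%N then d else ~~ d.
Definition tree_edge d v : E := (tgtV (v, tree_dir d v), tree_dir d v).

Lemma tgt_tree_edge d v : tgt (tree_edge d v) = v.
Proof. by rewrite /tree_edge; move: (tree_dir d v) => d'; exact: (tgtK d' v). Qed.

Lemma tree_edge_inj d : injective (tree_edge d).
Proof. exact: can_inj (tgt_tree_edge d). Qed.

Lemma tree_rank d v : v != corner ->
  ((src (tree_edge d v)).1 + (src (tree_edge d v)).2 < v.1 + v.2)%N.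
Proof.
case: v => x y; rewrite /corner xpair_eqE !ord_eqE /= => xy.
have := val_ord_pred y; have := val_ord_pred x.
rewrite /tree_edge /src /tgtV /tree_dir [(x, y).1]/= [(x, y).2]/=.
by move: (ord_pred x) (ord_pred y) => px py; case: d => /=;
  [case: (ltnP 0 y)|case: (ltnP 0 x)] => ? /=; do ?(case: ifP => ? //=); lia.
Qed.

Lemma card_vertex : #|V| = (N * N)%N.
Proof. by rewrite card_prod card_ord. Qed.

Lemma card_edge : #|E| = (2 * (N * N))%N.
Proof. by rewrite card_prod card_bool card_vertex mulnC. Qed.

(** Kernels off the comb are bounded by [H0], and the rest is integrated as a tree. The direction
    [d] of the teeth is free, so that the comb can follow a prescribed edge class. *)
Lemma ipin_wt_ub d (k : E -> R -> R) (H0 : R) (J : E -> R) : 1 <= H0 ->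
  (forall e, measurable_fun setT (k e)) -> (forall e x, 0 <= k e x <= H0) ->
  (forall e x, k e (- x) = k e x) -> (forall e, 0 <= J e) ->
  (forall e, (\int[leb]_x (k e x)%:E <= (J e)%:E)%E) ->
  (ipin (corner) (fun phi => (wt k phi)%:E) <=
    (H0 ^+ (2 * (N * N)) * \prod_(v | v != corner) J (tree_edge d v))%:E)%E.
Proof.
move=> H1 mk kH kN J0 kJ.
have k0 e x : 0 <= k e x by have /andP[] := kH e x.
pose G (phi : V -> R) := \prod_(v <- unpinned corner) k (tree_edge d v) (phi v - phi (src (tree_edge d v))).
have FG : jnn (fun phi => (G phi)%:E).
  apply: jnn_EFin => [|psi]; last by apply: prodr_ge0 => v _; exact: k0.
  by apply: jmeas_prod => v; apply: (@jmeas_edge R n (k _)).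
have H00 : 0 <= H0 by lra.
have bnd phi : ((wt k phi)%:E <= (H0 ^+ (2 * (N * N)))%:E * (G phi)%:E)%E.
  rewrite -EFinM lee_fin /wt.
  pose T := [set tree_edge d v | v in [set v | v != corner]]%SET.
  rewrite (bigID (mem T)) /= mulrC; apply: ler_pM; try by apply: prodr_ge0.
    apply: (@le_trans _ _ (\prod_(e in (~: T)%SET) H0)).
      rewrite [X in _ <= X](eq_bigl (fun e => e \notin T)); last by move=> e; rewrite !inE.
      by apply: ler_prod => e _; exact: kH.
    by rewrite prodr_const -card_edge ler_weXn2l// max_card.
  rewrite big_imset/=; last by move=> v w _ _; exact: tree_edge_inj.
  rewrite le_eqVlt; apply/orP; left; apply/eqP.
  rewrite /G /unpinned big_filter big_enum_cond /=.
  apply: eq_big => v; first by rewrite inE.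
  by rewrite tgt_tree_edge -[in LHS]kN opprB.
rewrite /ipin; apply: (le_trans (le_iint _ _ _ _ bnd)); first exact: jnn_wt.
  by apply: jnnZ => //; rewrite lee_fin exprn_ge0.
rewrite iintZ ?exprn_ge0// EFinM; apply: lee_pmul => //.
- by rewrite lee_fin exprn_ge0.
- exact: iint_ge0.
rewrite (@iint_tree _ _ _ _ (fun v : V => (v.1 + v.2)%N) (fun v => k (tree_edge d v)))//; last 2 first.
- exact: uniq_unpinned.
- by move=> v; rewrite mem_unpinned; exact: tree_rank.
rewrite -prodEFin /unpinned big_filter big_enum_cond /=.
have PE (P : pred V) : (0 <= \prod_(v | P v) \int[leb]_x (k (tree_edge d v) x)%:E)%E.
  by apply: prode_ge0 => v _; apply: integral_ge0 => x _; rewrite lee_fin.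
suff : (0 <= \prod_(v | v != corner) \int[leb]_x (k (tree_edge d v) x)%:E <=
  \prod_(v | v != corner) (J (tree_edge d v))%:E)%E by case/andP.
elim/big_ind2: _ => [|a b a' b' /andP[a0 ab] /andP[a0' ab']|v _].
- by rewrite lexx lee_fin ler01.
- by rewrite mule_ge0//=; apply: lee_pmul.
- by rewrite kJ andbT; apply: integral_ge0 => x _; rewrite lee_fin.
Qed.

End TorusTree.

Section LowerBound.
Context {R : realType} {n : nat} (n0 : (0 < n)%N).
Notation V := (vertex n).
Notation E := (edge n).
Notation N := (2 * n)%N.
Notation leb := (@lebesgue_measure R).

(** Only surfaces within [r] of the height at the corner are kept: each of the two edges per vertex
    contributes at least [c], and each free height [2 * r]. As [2 * r <= 1], a factor for the pinned
    vertex may be included as well. *)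
Lemma ipin_wt_lb (k : E -> R -> R) (c r : R) : 0 <= c -> 0 < r -> 2 * r <= 1 ->
  (forall e, measurable_fun setT (k e)) -> (forall e x, 0 <= k e x) ->
  (forall e x, `|x| <= 2 * r -> c <= k e x) ->
  (((c ^+ 2 * (2 * r)) ^+ (N * N))%:E <= ipin (corner n0) (fun phi => (wt k phi)%:E))%E.
Proof.
move=> c0 r0 r1 mk k0 ck.
pose g : R -> R := \1_(`[- r, r]%classic).
have mg : measurable_fun setT g by exact: measurable_indic.
have g0 x : 0 <= g x by rewrite /g indicE.
pose G (phi : V -> R) := \prod_(v <- unpinned (corner n0)) g (phi v - phi (corner n0)).
have FG : jnn (fun phi => (G phi)%:E).
  apply: jnn_EFin => [|psi]; last by apply: prodr_ge0.
  by apply: jmeas_prod => v; exact: jmeas_edge.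
have bnd phi : ((c ^+ (2 * (N * N)))%:E * (G phi)%:E <= (wt k phi)%:E)%E.
  rewrite -EFinM lee_fin.
  have [near|] := boolP [forall v, `|phi v - phi (corner n0)| <= r].
    have G1 : G phi <= 1.
      by apply: prodr_ile1 => v _; rewrite g0 /g indicE /=; case: (_ \in _).
    apply: (@le_trans _ _ (c ^+ (2 * (N * N)))); first by rewrite ler_piMr// exprn_ge0.
    rewrite /wt -card_edge -prodr_const; apply: ler_prod => e _; rewrite c0/= ck//.
    have /forallP near' := near.
    have -> : phi (src e) - phi (tgt e) = (phi (src e) - phi (corner n0)) - (phi (tgt e) - phi (corner n0)) by ring.
    by rewrite (le_trans (ler_normB _ _))// mulrDl mul1r lerD.
  move=> /forallPn[v vfar]; have vr : v != corner n0.
    by apply: contraNneq vfar => ->; rewrite subrr normr0 ltW.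
  rewrite /G (bigD1_seq v) ?mem_unpinned ?uniq_unpinned//= {1}/g indicE memNset ?mul0r ?mulr0.
    exact: wt_ge0.
  by rewrite /= in_itv/= -ler_norml; exact/negP.
rewrite /ipin; apply: le_trans (le_iint _ _ _ _ bnd); last 2 first.
- by apply: jnnZ => //; rewrite lee_fin exprn_ge0.
- exact: jnn_wt.
rewrite iintZ ?exprn_ge0//.
rewrite (@iint_tree _ _ _ _ (fun v : V => (v != corner n0 : nat)%N) (fun=> g))//; last 2 first.
- exact: uniq_unpinned.
- by move=> v; rewrite mem_unpinned eqxx => ->.
rewrite (eq_bigr (fun=> (2 * r)%:E)) => [|v _]; last first.
  rewrite integral_indic//= setIT lebesgue_measure_itv/= lte_fin ifT; last by lra.
  by rewrite -EFinB; congr EFin; ring.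
rewrite prodEFin -EFinM lee_fin /unpinned big_filter big_enum_cond /= prodr_const.
rewrite exprMn -exprM; apply: ler_wpM2l; first exact: exprn_ge0.
apply: ler_wiXn2l => //; first by lra.
by rewrite -card_vertex max_card.
Qed.

End LowerBound.

Section EdgeClass.
Context {R : realType} {n : nat} (n0 : (0 < n)%N).
Notation V := (vertex n).
Notation E := (edge n).
Notation N := (2 * n)%N.

Definition in_class (d p : bool) (e : E) : bool :=
  (e.2 == d) && (odd (if d then e.1.1 else e.1.2) == p).

(* the unique edge of the class [(d, p)] in the boundary of the cell [f] *)
Definition cell_edge (d p : bool) (f : V) : E :=
  if d then ((if odd f.1 == p then f.1 else ordS f.1, f.2), true)
  else ((f.1, if odd f.2 == p then f.2 else ordS f.2), false).

Lemma cell_edge_class d p e : in_class d p e -> cell_edge d p e.1 = e.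
Proof.
by case: e => -[x y] b; rewrite /in_class /cell_edge; case: d => /= /andP[/eqP -> ->].
Qed.

Variables (a0 a1 : R -> R).
Hypotheses (a0N : forall x, a0 (- x) = a0 x) (a1N : forall x, a1 (- x) = a1 x).

(** An edge of [S] is the class edge of both cells it borders, so it receives [a1] twice, while
    every other edge receives [a0] twice. *)
Lemma cells_wt d p (S : {set E}) phi : (forall e, e \in S -> in_class d p e) ->
  cells a0 a1 d p (fun f => cell_edge d p f \in S) phi =
  wt (fun e x => aweight a0 a1 (e \in S) x ^+ 2) phi.
Proof.
move=> Sd; pose aw e := aweight a0 a1 (e \in S) (phi (src e) - phi (tgt e)).
have cellE (f : V) : cell a0 a1 d p (cell_edge d p f \in S) f.1 (ordS f.1) f.2 (ordS f.2) phi =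
    aw (f, false) * aw (tgt (f, true), false) * (aw (f, true) * aw (tgt (f, false), true)).
  case: f => x y.
  have cl (e : E) (b : bool) : b = in_class d p e ->
      (in_class d p e -> cell_edge d p (x, y) = e) ->
      (cell_edge d p (x, y) \in S) && b = (e \in S).
    move=> -> H; apply/andP/idP => [[+ ed]|eS]; first by rewrite H.
    by have ed := Sd _ eS; rewrite H.
  rewrite /cell /aw /src.
  congr (aweight a0 a1 _ _ * aweight a0 a1 _ _ * (aweight a0 a1 _ _ * aweight a0 a1 _ _));
    apply: cl; rewrite /in_class /cell_edge /tgt /=; case: d {Sd aw} => //=.
  - by move=> ->.
  - by rewrite odd_ordS// => /eqP <-; case: (odd y).
  - by move=> ->.
  - by rewrite odd_ordS// => /eqP <-; case: (odd x).
rewrite /cells (eq_bigr _ (fun f _ => cellE f)) !big_split /=.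
have re d' b : \prod_(f : V) aw (tgt (f, d'), b) = \prod_(f : V) aw (f, b).
  by rewrite [RHS](reindex_inj (can_inj (tgtVK d'))).
rewrite !re /wt [RHS](eq_bigr (fun e : E => aw (e.1, e.2) ^+ 2)); last by case.
rewrite -(pair_big xpredT xpredT (fun v b => aw (v, b) ^+ 2)) /=.
rewrite [RHS](eq_bigr (fun v => aw (v, true) ^+ 2 * aw (v, false) ^+ 2)); last first.
  by move=> v _; rewrite big_bool.
by rewrite big_split /= !prodrXl !expr2 mulrC.
Qed.

End EdgeClass.

(** The teeth in direction [d] run along the lines of the class; [n] of these lines with [n]
    vertices each are exhibited. This is a quarter of all vertices, which explains the outer fourth
    powers in the hypothesis [small] of the Peierls estimate. *)
Lemma card_class_tree {n : nat} (n0 : (0 < n)%N) d p :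
  (n * n <= #|[set v : vertex n | (v != corner n0) && in_class d p (tree_edge d v)]%SET|)%N.
Proof.
pose u (a : 'I_n) : 'I_(2 * n) := insubd (zero_ord n0) a.+1.
pose w (b : 'I_n) : 'I_(2 * n) := insubd (zero_ord n0) (b.*2 + p)%N.
have uE a : nat_of_ord (u a) = a.+1.
  by rewrite val_insubd ifT//; have := ltn_ord a; lia.
have wE b : nat_of_ord (w b) = (b.*2 + p)%N.
  by rewrite val_insubd ifT//; have := ltn_ord b; lia.
pose g (ab : 'I_n * 'I_n) : vertex n := if d then (w ab.2, u ab.1) else (u ab.1, w ab.2).
have ginj : injective g.
  have uw a b a' b' : u a = u a' -> w b = w b' -> (a, b) = (a', b').
    move=> /(congr1 (@nat_of_ord _)) + /(congr1 (@nat_of_ord _)); rewrite !uE !wE => ea eb.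
    by congr pair; apply: ord_inj; lia.
  move=> [a b] [a' b']; rewrite /g; case: (d) => /= -[e1 e2]; exact: uw.
have <- : #|[set g x | x in [set: 'I_n * 'I_n]]%SET| = (n * n)%N.
  by rewrite card_imset// cardsT card_prod card_ord.
apply: subset_leq_card; apply/fintype.subsetP => v /imsetP[[a b] _ ->].
have odw : odd (w b) = p by rewrite wE oddD odd_double addFb oddb.
rewrite inE /in_class /tree_edge /tree_dir /g /tgtV.
by case: (d) => /=; rewrite uE /= ?odw !eqxx ?andbT /corner xpair_eqE !ord_eqE uE /= ?andbF.
Qed.

(** * The Peierls estimate *)

Section Peierls.
Context {R : realType} {n : nat} (n0 : (0 < n)%N).
Notation V := (vertex n).
Notation E := (edge n).
Notation N := (2 * n)%N.
Notation leb := (@lebesgue_measure R).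

Variables (h h1 : R -> R) (s H0 Jm c r J1 eps : R).
Hypotheses (mh : measurable_fun setT h) (mh1 : measurable_fun setT h1).
Hypotheses (hN : forall x, h (- x) = h x) (h1N : forall x, h1 (- x) = h1 x).
Hypotheses (h_bnd : forall x, 0 <= h x <= H0) (h1_h : forall x, s * h x <= h1 x <= h x).
Hypotheses (s01 : 0 < s <= 1) (H01 : 1 <= H0) (Jm1 : 1 <= Jm).
Hypotheses (hJ : (\int[leb]_x (h x)%:E <= Jm%:E)%E) (h1J : (\int[leb]_x (h1 x)%:E <= J1%:E)%E).
Hypotheses (c0 : 0 < c) (r0 : 0 < r) (r1 : 2 * r <= 1) (J10 : 0 <= J1) (J11 : J1 <= 1).
Hypotheses (hc : forall x, `|x| <= 2 * r -> c <= h x).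
Hypotheses (eps01 : 0 < eps <= 1).
(** A comparison per block of four vertices: on the left the upper bound when a whole edge class
    carries [h1], on the right [eps ^ 16] times the lower bound for [Z]. *)
Hypothesis small : (H0 ^+ 2 * Jm) ^+ 4 * J1 <= (eps ^+ 4 * (c ^+ 2 * (2 * r))) ^+ 4.

Let h0 x : 0 <= h x. Proof. by have /andP[] := h_bnd x. Qed.
Let s0 : 0 < s. Proof. by case/andP: s01. Qed.
Let H00 : 0 <= H0. Proof. exact: le_trans ler01 H01. Qed.
Let Jm0 : 0 <= Jm. Proof. exact: le_trans ler01 Jm1. Qed.
Let e0 : 0 < eps. Proof. by case/andP: eps01. Qed.
Let K0 : 0 <= c ^+ 2 * (2 * r). Proof. by rewrite !mulr_ge0// ?exprn_ge0// ltW. Qed.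
Let h10 x : 0 <= h1 x.
Proof. by have /andP[+ _] := h1_h x; apply: le_trans; rewrite mulr_ge0// ltW. Qed.
Let h1h x : h1 x <= h x. Proof. by have /andP[] := h1_h x. Qed.

(** Divided by [Z], the integral of [wt (badwt S)] is the probability that all edges of [S] carry
    [h1] in the mixture. *)
Definition badwt (S : {set E}) (e : E) : R -> R := if e \in S then h1 else h.

Let mbadwt S e : measurable_fun setT (badwt S e). Proof. by rewrite /badwt; case: ifP. Qed.
Let badwt0 S e x : 0 <= badwt S e x. Proof. by rewrite /badwt; case: ifP. Qed.
Let badwth S e x : badwt S e x <= h x. Proof. by rewrite /badwt; case: ifP. Qed.
Let badwtN S e x : badwt S e (- x) = badwt S e x. Proof. by rewrite /badwt; case: ifP. Qed.

Let a0 x := Num.sqrt (h x).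
Let a1 x := Num.sqrt (h1 x).
Let msqrt (f : R -> R) : measurable_fun setT f -> measurable_fun setT (fun x => Num.sqrt (f x)).
Proof.
move=> mf; apply: (measurableT_comp _ mf).
by apply: continuous_measurable_fun; exact: sqrt_continuous.
Qed.
Let ma0 : measurable_fun setT a0. Proof. exact: msqrt. Qed.
Let ma1 : measurable_fun setT a1. Proof. exact: msqrt. Qed.
Let a0_ge0 x : 0 <= a0 x. Proof. exact: sqrtr_ge0. Qed.
Let a1_ge0 x : 0 <= a1 x. Proof. exact: sqrtr_ge0. Qed.
Let a0N x : a0 (- x) = a0 x. Proof. by rewrite /a0 hN. Qed.
Let a1N x : a1 (- x) = a1 x. Proof. by rewrite /a1 h1N. Qed.

Definition Z : \bar R := ipin (origin n0) (fun phi : V -> R => (wt (fun=> h) phi)%:E).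

Let wt_repin (k : E -> R -> R) : (forall e, measurable_fun setT (k e)) -> (forall e x, 0 <= k e x) ->
  ipin (origin n0) (fun phi => (wt k phi)%:E) = ipin (corner n0) (fun phi => (wt k phi)%:E).
Proof.
by move=> mk k0; apply: ipin_repin => [|phi x]; [exact: jnn_wt|rewrite wt_shift].
Qed.

Lemma Z_lb : (((c ^+ 2 * (2 * r)) ^+ (N * N))%:E <= Z)%E.
Proof.
rewrite /Z wt_repin//; by apply: ipin_wt_lb => //; exact: ltW.
Qed.

Lemma Z_gt0 : (0 < Z)%E.
Proof.
by apply: lt_le_trans Z_lb; rewrite lte_fin exprn_gt0// mulr_gt0 ?exprn_gt0 ?mulr_gt0.
Qed.

Lemma Z_fin : (Z < +oo)%E.
Proof.
rewrite /Z wt_repin//.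
apply: le_lt_trans (@ipin_wt_ub R n n0 false (fun=> h) H0 (fun=> Jm) _ _ _ _ _ _) _ => //.
by rewrite ltry.
Qed.

Let cellsE d p (S : {set E}) phi : (forall e, e \in S -> in_class d p e) ->
  cells a0 a1 d p (fun f => cell_edge d p f \in S) phi = wt (badwt S) phi.
Proof.
move=> Sd; rewrite cells_wt//; apply: eq_bigr => e _.
by rewrite /badwt /aweight; case: ifP => _; rewrite sqr_sqrtr.
Qed.

Let cellsZE d p (S : {set E}) : (forall e, e \in S -> in_class d p e) ->
  cellsZ n0 a0 a1 d p (fun f => cell_edge d p f \in S) = ipin (origin n0) (fun phi => (wt (badwt S) phi)%:E).
Proof. by move=> Sd; apply: eq_iint => phi; rewrite cellsE. Qed.

Let cellsZ0 d p : cellsZ n0 a0 a1 d p (fun=> false) = Z.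
Proof.
have := @cellsZE d p finset.set0; rewrite (_ : (fun f => _) = fun=> false); last first.
  by apply/funext => f; rewrite inE.
move=> ->; last by move=> e; rewrite inE.
apply: eq_iint => phi; congr EFin; apply: eq_bigr => e _.
by rewrite /badwt inE.
Qed.

Let a1a0 x : Num.sqrt s * a0 x <= a1 x <= a0 x.
Proof.
rewrite /a0 /a1 -sqrtrM ?(ltW s0)//.
by have /andP[? ?] := h1_h x; apply/andP; split; exact: ler_wsqrtr.
Qed.

(** The lower bound, through [s > 0], makes every [cellsZ] positive, as the chessboard estimate
    requires; the upper bound makes it finite. *)
Let cells_comp d p (f : V -> bool) (phi : V -> R) : Num.sqrt s ^+ 4 ^+ #|V| * cells a0 a1 d p (fun=> false) phi <=
    cells a0 a1 d p f phi <= cells a0 a1 d p (fun=> false) phi.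
Proof.
have t0 : 0 <= Num.sqrt s by exact: sqrtr_ge0.
have t1 : Num.sqrt s <= 1 by rewrite -sqrtr1; apply: ler_wsqrtr; case/andP: s01.
have aw b x : Num.sqrt s * a0 x <= aweight a0 a1 b x <= a0 x.
  by case: b => /=; rewrite ?a1a0// lexx andbT ler_piMl.
have awl b x : Num.sqrt s * a0 x <= aweight a0 a1 b x by have /andP[] := aw b x.
have awr b x : aweight a0 a1 b x <= a0 x by have /andP[] := aw b x.
have aw0 b x : 0 <= aweight a0 a1 b x by exact: aweight_ge0.
have ta0 x : 0 <= Num.sqrt s * a0 x by exact: mulr_ge0.
have mono4 x1 x2 x3 x4 y1 y2 y3 y4 : 0 <= x1 <= y1 -> 0 <= x2 <= y2 -> 0 <= x3 <= y3 ->
    0 <= x4 <= y4 -> x1 * x2 * (x3 * x4) <= y1 * y2 * (y3 * y4) :> R.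
  move=> /andP[? ?] /andP[? ?] /andP[? ?] /andP[? ?].
  by apply: ler_pM; rewrite ?mulr_ge0//; apply: ler_pM.
rewrite -prodr_const -big_split /=; apply/andP; split; apply: ler_prod => v _.
  rewrite mulr_ge0 ?exprn_ge0 ?cell_ge0//= /cell.
  set x1 := aweight _ _ (_ && _) _; set x2 := aweight _ _ (_ && _) _.
  set x3 := aweight _ _ (_ && _) _; set x4 := aweight _ _ (_ && _) _.
  have -> : Num.sqrt s ^+ 4 * (x1 * x2 * (x3 * x4)) =
     (Num.sqrt s * x1) * (Num.sqrt s * x2) * ((Num.sqrt s * x3) * (Num.sqrt s * x4)) by ring.
  by apply: mono4; rewrite ta0/= awl.
by rewrite cell_ge0//= /cell; apply: mono4; rewrite aw0/= awr.
Qed.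

Let cellsZ_gt0 d p f : (0 < cellsZ n0 a0 a1 d p f)%E.
Proof.
pose t := Num.sqrt s ^+ 4 ^+ #|V|.
have t0 : 0 < t by rewrite !exprn_gt0// sqrtr_gt0.
apply: (@lt_le_trans _ _ (t%:E * cellsZ n0 a0 a1 d p (fun=> false))%E).
  by rewrite mule_gt0 ?lte_fin// cellsZ0 Z_gt0.
rewrite /cellsZ /ipin -iintZ ?(ltW t0)//; last exact: jnn_cells.
apply: le_iint => [||phi].
- by apply: jnnZ; [rewrite lee_fin ltW|exact: jnn_cells].
- exact: jnn_cells.
- by rewrite -EFinM lee_fin; have /andP[] := cells_comp d p f phi.
Qed.

Let cellsZ_fin d p f : (cellsZ n0 a0 a1 d p f < +oo)%E.
Proof.
apply: le_lt_trans Z_fin; rewrite -(cellsZ0 d p).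
apply: le_iint => [||phi]; try exact: jnn_cells.
by rewrite lee_fin; have /andP[] := cells_comp d p f phi.
Qed.

(** The comb is chosen with its teeth in the class, so at least [n * n] tree edges contribute [J1];
    then [small] is raised to the power [n * n]. *)
Lemma cellsZ1 d p : (cellsZ n0 a0 a1 d p (fun=> true) <= (eps ^+ 4 ^+ (N * N))%:E * Z)%E.
Proof.
pose S := [set e : E | in_class d p e]%SET.
have := @cellsZE d p S; rewrite (_ : (fun f => _) = fun=> true); last first.
  apply/funext => -[x y]; rewrite inE /in_class /cell_edge.
  by case: d {S} => /=; case: ifPn => // H; rewrite odd_ordS//; move: H; case: odd; case: p.
move=> ->; last by move=> e; rewrite inE.
rewrite wt_repin//.
pose J (e : E) := if in_class d p e then J1 else Jm.
apply: le_trans (@ipin_wt_ub R n n0 d (badwt S) H0 J _ _ _ _ _ _) _ => //.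
- by move=> e x; rewrite badwt0/=; apply: le_trans (badwth S e x) _; have /andP[] := h_bnd x.
- by move=> e; rewrite /J; case: ifP.
- by move=> e; rewrite /J /badwt inE; case: ifP.
apply: (@le_trans _ _ ((eps ^+ 4 ^+ (N * N)) * (c ^+ 2 * (2 * r)) ^+ (N * N))%:E); last first.
  by rewrite EFinM lee_pmul2l ?lte_fin ?exprn_gt0 ?Z_lb//; case/andP: eps01.
rewrite lee_fin -exprMn.
have -> : (N * N = 4 * (n * n))%N by rewrite mulnACA.
rewrite [leRHS]exprM.
apply: (@le_trans _ _ (((H0 ^+ 2 * Jm) ^+ 4 * J1) ^+ (n * n))); last first.
  apply: lerXn2r => //; rewrite nnegrE.
    by rewrite !mulr_ge0// !exprn_ge0// !mulr_ge0 ?exprn_ge0.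
  by rewrite exprn_ge0// mulr_ge0 ?exprn_ge0// ltW.
have -> : H0 ^+ (2 * (4 * (n * n))) = (H0 ^+ 2) ^+ 4 ^+ (n * n) by rewrite -!exprM mulnA.
have -> : ((H0 ^+ 2 * Jm) ^+ 4 * J1) ^+ (n * n) =
    (H0 ^+ 2) ^+ 4 ^+ (n * n) * (Jm ^+ 4 ^+ (n * n) * J1 ^+ (n * n)).
  by rewrite mulrA -[in RHS]exprMn -[in RHS]exprMn -[in RHS]exprMn.
apply: ler_wpM2l; first by rewrite !exprn_ge0.
pose T := [set v : V | (v != corner n0) && in_class d p (tree_edge d v)]%SET.
rewrite (bigID (fun v => in_class d p (tree_edge d v))) /= mulrC; apply: ler_pM.
- by apply: prodr_ge0 => v _; rewrite /J; case: ifP.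
- by apply: prodr_ge0 => v _; rewrite /J; case: ifP.
- apply: (@le_trans _ _ (\prod_(v : V | (v != corner n0) && ~~ in_class d p (tree_edge d v)) Jm)).
    by apply: ler_prod => v /andP[_ /negbTE nv]; rewrite /J nv Jm0 lexx.
  rewrite prodr_const -exprM; apply: ler_weXn2l => //.
  by apply: leq_trans (max_card _) _; rewrite card_vertex mulnACA.
- rewrite (eq_bigr (fun=> J1)); last by move=> v /andP[_ nv]; rewrite /J nv.
  rewrite prodr_const; apply: ler_wiXn2l => //.
  by apply: leq_trans (card_class_tree n0 d p) _; rewrite cardsE.
Qed.

(** In the chessboard product each marked cell gives the factor of [cellsZ1] and every other cell
    gives [Z]; a root of order [N * N] is then taken. Distinct edges of [S] mark distinct cells,
    those based at their sources. *)
Lemma badwt_class_bound d p (S : {set E}) : (forall e, e \in S -> in_class d p e) ->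
  (ipin (origin n0) (fun phi => (wt (badwt S) phi)%:E) <= (eps ^+ 4 ^+ #|S|)%:E * Z)%E.
Proof.
move=> Sd; rewrite -(cellsZE Sd).
pose b (f : V) := cell_edge d p f \in S.
have fK g : (fine (cellsZ n0 a0 a1 d p g))%:E = cellsZ n0 a0 a1 d p g.
  by rewrite fineK// ge0_fin_numE ?cellsZ_fin// ltW.
have ZK : (fine Z)%:E = Z by rewrite fineK// ge0_fin_numE ?Z_fin// ltW// Z_gt0.
have Zf0 : 0 < fine Z by rewrite fine_gt0// Z_gt0 Z_fin.
have e40 : 0 < eps ^+ 4 by rewrite exprn_gt0.
have e41 : eps ^+ 4 <= 1 by rewrite exprn_ile1 ?(ltW e0)//; case/andP: eps01.
have NN0 : (0 < N * N)%N by rewrite !muln_gt0 n0.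
rewrite -fK -ZK -EFinM lee_fin.
have cb := chessboard ma0 ma1 a0_ge0 a1_ge0 a0N a1N cellsZ_gt0 cellsZ_fin d p b.
have card_b : (#|S| <= #|[set f in b]%SET|)%N.
  rewrite -(card_in_imset (f := fst) (D := S)); last first.
    move=> e e' /Sd ed /Sd ed' ee'.
    by rewrite -(cell_edge_class ed) -(cell_edge_class ed') ee'.
  apply: subset_leq_card; apply/fintype.subsetP => f /imsetP[e eS ->].
  by rewrite inE unfold_in /b cell_edge_class// Sd.
suff : fine (cellsZ n0 a0 a1 d p b) <= eps ^+ 4 ^+ #|[set f in b]%SET| * fine Z.
  move=> /le_trans; apply; apply: ler_wpM2r; first exact: ltW.
  by apply: ler_wiXn2l => //; exact: ltW.
have f0 g : 0 <= fine (cellsZ n0 a0 a1 d p g) by rewrite fine_ge0// ltW.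
have q0 : 0 <= eps ^+ 4 ^+ #|[set f in b]%SET| * fine Z.
  by rewrite mulr_ge0 ?(ltW Zf0)// exprn_ge0// ltW.
rewrite -(ler_pXn2r NN0) ?nnegrE//.
apply: (le_trans cb).
apply: (@le_trans _ _ (\prod_(v : V) ((if b v then eps ^+ 4 ^+ (N * N) else 1) * fine Z))).
  apply: ler_prod => v _; rewrite f0/=.
  rewrite -lee_fin fK EFinM ZK; case: (b v); first exact: cellsZ1.
  by rewrite mul1e cellsZ0.
rewrite big_split /= prodr_const card_vertex -big_mkcond /= prodr_const -(cardsE b).
rewrite [leRHS]exprMn le_eqVlt; apply/orP; left; apply/eqP; congr (_ * _).
by rewrite -!exprM; congr (_ ^+ _); rewrite -!mulnA; congr (_ * _)%N; rewrite [RHS]mulnC !mulnA.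
Qed.

(** One of the four edge classes contains at least a quarter of [S]; only this part is kept, and the
    factor [eps ^ 4] per edge compensates for the loss. *)
Lemma peierls (S : {set E}) :
  (ipin (origin n0) (fun phi => (wt (badwt S) phi)%:E) <= (eps ^+ #|S|)%:E * Z)%E.
Proof.
pose T d p := (S :&: [set e | in_class d p e])%SET.
have [d [p dp]] : exists d p, (#|S| <= 4 * #|T d p|)%N.
  have sub : (#|S| <= #|T false false| + #|T false true| + (#|T true false| + #|T true true|))%N.
    apply: leq_trans (_ : #|((T false false :|: T false true) :|: (T true false :|: T true true))%SET| <= _)%N.
      apply: subset_leq_card; apply/fintype.subsetP => -[[x y] d] eS.
      rewrite !inE eS /in_class /=; clear; case: d => /=.
        by case: (odd x).
      by case: (odd y).
    by do ?(apply: leq_trans (leq_card_setU _ _) _; apply: leq_add).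
  have [l|l] := leqP #|S| (4 * #|T false false|)%N; first by exists false, false.
  have [l2|l2] := leqP #|S| (4 * #|T false true|)%N; first by exists false, true.
  have [l3|l3] := leqP #|S| (4 * #|T true false|)%N; first by exists true, false.
  exists true, true; clear - sub l l2 l3; lia.
have HT e : e \in T d p -> in_class d p e by rewrite !inE => /andP[].
apply: (@le_trans _ _ (ipin (origin n0) (fun phi => (wt (badwt (T d p)) phi)%:E))).
  apply: le_iint => [||phi]; try exact: jnn_wt.
  rewrite lee_fin; apply: ler_prod => e _; rewrite badwt0/= /badwt inE.
  by case: (e \in S) => //=; case: ifP.
apply: (le_trans (badwt_class_bound HT)); apply: lee_wpmul2r; first exact: ltW Z_gt0.
rewrite lee_fin -exprM; apply: ler_wiXn2l => //; first exact: ltW.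
by case/andP: eps01.
Qed.

End Peierls.

(** * Symmetric shifts *)

(* What the delocalization argument needs to know about h = exp(-U): a splitting
   h = h0 + h1 such that long sets of edges carrying h1 are exponentially rare
   and h0 is stable under symmetric shifts, up to a correction by h1 of second
   order in the size of the shift. *)
Record splitting (R : realType) (h h0 h1 : R -> R) (eps C d0 : R) : Prop := Splitting {
  sp_mh0 : measurable_fun setT h0;
  sp_mh1 : measurable_fun setT h1;
  sp_sum : forall x, h x = h0 x + h1 x;
  sp_h0 : forall x, 0 <= h0 x;
  sp_h1 : forall x, 0 <= h1 x;
  sp_even : forall x, h (- x) = h x;
  sp_C : 0 <= C;
  sp_d0 : 0 < d0;
  sp_eps : 0 < eps;
  sp_Z0 : forall n (n0 : (0 < n)%N), (0 < Z n0 h)%E;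
  sp_Zy : forall n (n0 : (0 < n)%N), (Z n0 h < +oo)%E;
  sp_peierls : forall n (n0 : (0 < n)%N) (S : {set edge n}),
    (ipin (origin n0) (fun phi => (wt (badwt h h1 S) phi)%:E) <= (eps ^+ #|S|)%:E * Z n0 h)%E;
  sp_edge : forall d g, `|d| <= d0 -> h0 g ^+ 2 <=
    expR (C * d ^+ 2) * ((h0 (g + d) + C * d ^+ 2 * h1 (g + d)) *
                         (h0 (g - d) + C * d ^+ 2 * h1 (g - d))) }.

Section MerminWagner.
Context {R : realType} {n : nat} (n0 : (0 < n)%N).
Variables (h h0 h1 : R -> R) (eps C d0 : R).
Hypothesis sp : splitting h h0 h1 eps C d0.
Notation V := (vertex n).
Notation E := (edge n).
Notation I := (ipin (origin n0)).
Notation Z := (Z n0 h).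

Definition jset (A : set (V -> R)) : Prop := jmeas ((\1_A : (V -> R) -> R) : _ -> measurableTypeR R).

Definition pr (A : set (V -> R)) : R :=
  fine (I (fun phi => (wt (fun=> h) phi * \1_A phi)%:E)) / fine Z.

Let h_ge0 x : 0 <= h x.
Proof. by rewrite (sp_sum sp) addr_ge0 ?(sp_h0 sp) ?(sp_h1 sp). Qed.
Let mh : measurable_fun setT h.
Proof.
rewrite (_ : h = (fun x => h0 x + h1 x)); last by apply/funext => x; rewrite (sp_sum sp).
by apply: measurable_funD; [exact: (sp_mh0 sp)|exact: (sp_mh1 sp)].
Qed.
Let wh0 (phi : V -> R) : 0 <= wt (fun=> h) phi :> R. Proof. exact: wt_ge0. Qed.

Let Zf : 0 < fine Z. Proof. by rewrite fine_gt0// (sp_Z0 sp) (sp_Zy sp). Qed.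
Let ZK : (fine Z)%:E = Z.
Proof. by rewrite fineK// ge0_fin_numE ?(sp_Zy sp)// ltW// (sp_Z0 sp). Qed.

Lemma jnn_mul (F G : (V -> R) -> R) : jmeas (F : _ -> measurableTypeR R) ->
  jmeas (G : _ -> measurableTypeR R) -> (forall phi, 0 <= F phi) -> (forall phi, 0 <= G phi) ->
  jnn (fun phi => (F phi * G phi)%:E).
Proof.
move=> mF mG F0 G0; apply: jnn_EFin => [|phi]; last exact: mulr_ge0.
by move=> d X x mx; apply: measurable_funM; [exact: mF|exact: mG].
Qed.


Lemma jnn_pr A : jset A -> jnn (fun phi : V -> R => (wt (fun=> h) phi * \1_A phi)%:E).
Proof. by move=> mA; apply: jnn_mul => //; apply: jmeas_wt. Qed.

Lemma prE A : jset A ->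
  I (fun phi => (wt (fun=> h) phi * \1_A phi)%:E) = ((pr A)%:E * Z)%E.
Proof.
move=> mA; rewrite /pr EFinM -ZK -[in RHS]EFinM -[in RHS]EFinM divfK ?gt_eqF//.
rewrite fineK// ge0_fin_numE; last by apply: iint_ge0; exact: jnn_pr.
apply: le_lt_trans (sp_Zy sp n0); apply: le_iint => [||phi]; first exact: jnn_pr.
  exact: jnn_wt.
by rewrite lee_fin ler_piMr.
Qed.

Lemma pr_ge0 A : jset A -> 0 <= pr A.
Proof.
by move=> mA; rewrite divr_ge0 ?(ltW Zf)// fine_ge0// iint_ge0//; exact: jnn_pr.
Qed.

Lemma pr_le (A : set (V -> R)) (x : R) : jset A ->
  (I (fun phi => (wt (fun=> h) phi * \1_A phi)%:E) <= x%:E * Z)%E -> pr A <= x.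
Proof.
by move=> mA; rewrite prE// -ZK -!EFinM lee_fin ler_pM2r.
Qed.

Lemma pr_sub (A B : set (V -> R)) : jset A -> jset B -> A `<=` B -> pr A <= pr B.
Proof.
move=> mA mB AB; apply: pr_le => //; rewrite -prE//.
apply: le_iint => [||phi]; try exact: jnn_pr.
rewrite lee_fin ler_wpM2l// !indicE.
by have [/set_mem /AB /mem_set ->|] := boolP (phi \in A); rewrite ?ler01.
Qed.

Lemma pr_sum (J : Type) (r : seq J) (P : pred J) (A : J -> set (V -> R)) :
  (forall j, jset (A j)) -> (forall phi, \sum_(j <- r | P j) (\1_(A j) phi : R) <= 1) ->
  \sum_(j <- r | P j) pr (A j) <= 1.
Proof.
move=> mA s1; rewrite -lee_fin -(@lee_pmul2r _ (fine Z)%:E) ?lte_fin// ZK mul1e.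
rewrite -sumEFin ge0_sume_distrl; last by move=> j _; rewrite lee_fin pr_ge0.
under eq_bigr do rewrite -prE//.
rewrite /ipin -iint_sum; last by move=> j _; exact: jnn_pr.
apply: le_iint => [||phi].
- by apply: jnn_sum => j _; exact: jnn_pr.
- exact: jnn_wt.
- by rewrite sumEFin lee_fin -mulr_sumr ler_piMr.
Qed.

Lemma jsetC A : jset A -> jset (~` A).
Proof.
move=> mA d X x mx.
rewrite [X in measurable_fun _ X](_ : _ = fun z => 1 - \1_A (fun v => x v z)); last first.
  apply/funext => z; rewrite !indicE in_setC.
  by case: (_ \in _); rewrite ?subrr ?subr0.
by apply: measurable_funB => //; exact: mA.
Qed.

Lemma pr_setC A : jset A -> pr A + pr (~` A) = 1.
Proof.
move=> mA; have mC := jsetC mA.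
apply: (@mulIf _ (fine Z)); first by rewrite gt_eqF.
apply: EFin_inj; rewrite mul1r EFinM ZK EFinD ge0_muleDl ?lee_fin ?pr_ge0// -!prE//.
rewrite /ipin -iintD; try exact: jnn_pr.
apply: eq_iint => phi; rewrite -EFinD -mulrDr !indicE in_setC.
by case: (_ \in _); rewrite ?addr0 ?add0r mulr1.
Qed.

Definition fb (b : {set E}) (e : E) : R -> R := if e \in b then h1 else h0.

Let mfb b e : measurable_fun setT (fb b e).
Proof. by rewrite /fb; case: ifP => _; [exact: (sp_mh1 sp)|exact: (sp_mh0 sp)]. Qed.
Let fb0 b e x : 0 <= fb b e x.
Proof. by rewrite /fb; case: ifP => _; [exact: (sp_h1 sp)|exact: (sp_h0 sp)]. Qed.

Lemma wt_expand (k0 k1 : E -> R -> R) phi :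
  wt (fun e x => k0 e x + k1 e x) phi =
  \sum_(b : {set E}) wt (fun e => if e \in b then k1 e else k0 e) phi.
Proof.
rewrite /wt (eq_bigr (fun e => k1 e (phi (src e) - phi (tgt e)) + k0 e (phi (src e) - phi (tgt e)))).
  by rewrite bigA_distr; apply: eq_bigr => b _; apply: eq_bigr => e _; case: ifP.
by move=> e _; rewrite addrC.
Qed.

Lemma wt_fb (phi : V -> R) : wt (fun=> h) phi = \sum_(b : {set E}) wt (fb b) phi :> R.
Proof.
rewrite -(wt_expand (fun=> h0) (fun=> h1)); apply: eq_bigr => e _; exact: (sp_sum sp).
Qed.

(** Forbidding [h0] on [S] leaves exactly the terms of the expansion with [S] inside [b], which
    links the Peierls estimate to the mixture. *)
Lemma badwt_fb (S : {set E}) phi :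
  wt (badwt h h1 S) phi = \sum_(b : {set E} | S \subset b) wt (fb b) phi.
Proof.
have -> : wt (badwt h h1 S) phi = wt (fun e x => (if e \in S then 0 else h0 x) + h1 x) phi.
  by apply: eq_bigr => e _; rewrite /badwt; case: ifP; rewrite ?add0r// (sp_sum sp).
rewrite (wt_expand (fun e x => if e \in S then 0 else h0 x) (fun=> h1)).
rewrite (bigID (fun b : {set E} => S \subset b)) /= [X in _ + X]big1 ?addr0.
  apply: eq_bigr => b /fintype.subsetP Sb; apply: eq_bigr => e _; rewrite /fb.
  by case: ifPn => // eb; rewrite ifF//; apply: contraNF eb; exact: Sb.
move=> b /subsetPn[e eS eb]; rewrite /wt (bigD1 e)//= (negbTE eb) eS mul0r//.
Qed.

Lemma ipin_translate (F : (V -> R) -> \bar R) (tau : V -> R) : jnn F -> tau (origin n0) = 0 ->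
  I (fun psi => F (fun v => psi v + tau v)) = I F.
Proof.
move=> FF t0; rewrite /ipin iint_translate//; apply: indep_agree => v.
rewrite add0r => tv; apply: indep_iint; rewrite mem_unpinned.
by apply: contraNneq tv => ->; rewrite t0.
Qed.

Variables (G : {set E} -> bool) (tau : {set E} -> V -> R) (tb : E -> R).
Hypothesis tau0 : forall b, G b -> tau b (origin n0) = 0.
Hypothesis tau_b : forall b e, G b -> e \in b -> tau b (src e) = tau b (tgt e).
Hypothesis tau_tb : forall b e, G b -> `|tau b (src e) - tau b (tgt e)| <= tb e.
Hypothesis tb_d0 : forall e, tb e <= d0.

(** The correction uses the bound [tb e] and not the gradient of [tau b]: a kernel independent of
    [b] is what allows the sum over [b] to be turned back into a product. *)
Let K e x := h0 x + C * tb e ^+ 2 * h1 x.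
Let kb (b : {set E}) (e : E) : R -> R := if e \in b then h1 else K e.

Let C0 : 0 <= C. Proof. exact: (sp_C sp). Qed.
Let mK e : measurable_fun setT (K e).
Proof.
apply: measurable_funD; first exact: (sp_mh0 sp).
by apply: measurable_funM => //; exact: (sp_mh1 sp).
Qed.
Let K0 e x : 0 <= K e x.
Proof.
apply: addr_ge0; first exact: (sp_h0 sp).
by apply: mulr_ge0; [rewrite mulr_ge0// sqr_ge0|exact: (sp_h1 sp)].
Qed.
Let mkb b e : measurable_fun setT (kb b e).
Proof. by rewrite /kb; case: ifP => _; [exact: (sp_mh1 sp)|]. Qed.
Let kb0 b e x : 0 <= kb b e x.
Proof. by rewrite /kb; case: ifP => _; [exact: (sp_h1 sp)|]. Qed.

Definition energy : R := \sum_e tb e ^+ 2.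

Let expE : 1 <= expR (C * energy).
Proof. by rewrite -expR0 ler_expR mulr_ge0// sumr_ge0// => e _; rewrite sqr_ge0. Qed.

Lemma kb_total phi : \sum_(b : {set E}) wt (kb b) phi <= expR (C * energy) * wt (fun=> h) phi.
Proof.
rewrite -(wt_expand K (fun=> h1)) /energy mulr_sumr expR_sum -big_split /=.
apply: ler_prod => e _; rewrite addr_ge0 ?(sp_h1 sp)//=.
set x := _ - _; have x0 := sp_h0 sp x; have x1 := sp_h1 sp x.
apply: (@le_trans _ _ ((1 + C * tb e ^+ 2) * h x)); last first.
  by rewrite ler_wpM2r//; exact: expR_ge1Dx.
have t0 : 0 <= C * tb e ^+ 2 by rewrite mulr_ge0// sqr_ge0.
rewrite /K (sp_sum sp) mulrDl mul1r mulrDr.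
have : 0 <= C * tb e ^+ 2 * h0 x by exact: mulr_ge0.
lra.
Qed.

Lemma fb_shift b phi : G b -> wt (fb b) phi ^+ 2 <= expR (C * energy) *
  (wt (kb b) (fun v => phi v + tau b v) * wt (kb b) (fun v => phi v - tau b v)).
Proof.
move=> Gb; rewrite /wt /energy mulr_sumr expR_sum -prodrXl -!big_split /=.
apply: ler_prod => e _; rewrite sqr_ge0/=.
set g := phi (src e) - phi (tgt e); set d := tau b (src e) - tau b (tgt e).
have -> : phi (src e) + tau b (src e) - (phi (tgt e) + tau b (tgt e)) = g + d by rewrite /g /d; ring.
have -> : phi (src e) - tau b (src e) - (phi (tgt e) - tau b (tgt e)) = g - d by rewrite /g /d; ring.
have dt : `|d| <= tb e by exact: tau_tb.
have t0 : 0 <= tb e by exact: le_trans dt.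
have t1 : 1 <= expR (C * tb e ^+ 2) by rewrite -expR0 ler_expR mulr_ge0// sqr_ge0.
rewrite /fb /kb; case: ifPn => eb.
  have -> : d = 0 by rewrite /d tau_b// subrr.
  by rewrite addr0 subr0 expr2 ler_peMl// mulr_ge0// (sp_h1 sp).
have d2 : d ^+ 2 <= tb e ^+ 2 by rewrite -[d ^+ 2]real_normK ?num_real// lerXn2r.
have KK x : h0 x + C * d ^+ 2 * h1 x <= K e x.
  by rewrite /K lerD2l ler_wpM2r ?(sp_h1 sp)// ler_wpM2l.
have k0 x : 0 <= h0 x + C * d ^+ 2 * h1 x.
  apply: addr_ge0; first exact: (sp_h0 sp).
  by apply: mulr_ge0; [rewrite mulr_ge0// sqr_ge0|exact: (sp_h1 sp)].
apply: le_trans (sp_edge sp g _) _; first exact: le_trans dt _.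
apply: ler_pM; rewrite ?expR_ge0 ?mulr_ge0//; first by rewrite ler_expR ler_wpM2l.
exact: ler_pM.
Qed.

Lemma mermin_wagner (A Ap Am : set (V -> R)) : jset A -> jset Ap -> jset Am ->
  (forall b phi, G b -> A phi -> Ap (fun v => phi v + tau b v)) ->
  (forall b phi, G b -> A phi -> Am (fun v => phi v - tau b v)) ->
  (I (fun phi => (wt (fun=> h) phi * \1_A phi)%:E) <=
   I (fun phi => (\sum_(b : {set E} | ~~ G b) wt (fb b) phi)%:E) +
   (expR (2 * C * energy) / 2 * (pr Ap + pr Am))%:E * Z)%E.
Proof.
move=> mA mAp mAm HAp HAm.
pose M := expR (C * energy); have M1 : 1 <= M by exact: expE.
have M0 : 0 < M by exact: expR_gt0.
have jkb (B : set (V -> R)) b : jset B -> jnn (fun phi => (wt (kb b) phi * \1_B phi)%:E).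
  by move=> mB; apply: jnn_mul => // [|phi]; [exact: jmeas_wt|exact: wt_ge0].
have jsh F (t : V -> R) : jnn F -> jnn (fun phi => F (fun v => phi v + t v)).
  move=> [mF F0]; split => // d X x mx.
  by apply: (mF _ _ (fun v z => x v z + t v)) => v; apply: measurable_funD.
pose Fp b := fun phi => (wt (kb b) (fun v => phi v + tau b v) * \1_Ap (fun v => phi v + tau b v))%:E.
pose Fm b := fun phi => (wt (kb b) (fun v => phi v - tau b v) * \1_Am (fun v => phi v - tau b v))%:E.
have jFp b : jnn (Fp b) by exact: (jsh (fun phi => (wt (kb b) phi * \1_Ap phi)%:E) _ (jkb _ _ mAp)).
have jFm b : jnn (Fm b) by exact: (jsh (fun phi => (wt (kb b) phi * \1_Am phi)%:E) (fun v => - tau b v) (jkb _ _ mAm)).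
have IFp b : G b -> I (Fp b) = I (fun phi => (wt (kb b) phi * \1_Ap phi)%:E).
  by move=> Gb; rewrite -(ipin_translate (jkb _ b mAp) (tau0 Gb)).
have IFm b : G b -> I (Fm b) = I (fun phi => (wt (kb b) phi * \1_Am phi)%:E).
  move=> Gb; rewrite -(@ipin_translate _ (fun v => - tau b v) (jkb _ b mAm))//.
  by rewrite tau0// oppr0.
have jB : jnn (fun phi => (\sum_(b : {set E} | ~~ G b) wt (fb b) phi)%:E).
  have := @jnn_sum R n _ (index_enum _) (fun b => ~~ G b) (fun b phi => (wt (fb b) phi)%:E).
  move=> /(_ (fun b _ => jnn_wt (mfb b) (fb0 b))).
  by under [X in jnn X -> _]eq_fun do rewrite sumEFin.
have jS F : (forall b, jnn (F b)) -> jnn (fun phi => \sum_(b : {set E} | G b) F b phi)%E.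
  by move=> jF; apply: jnn_sum => b _; exact: jF.
have M20 : 0 <= M / 2 by rewrite divr_ge0// ltW.
apply: (@le_trans _ _ (I (fun phi => ((\sum_(b : {set E} | ~~ G b) wt (fb b) phi)%R%:E +
   (M / 2)%:E * (\sum_(b : {set E} | G b) Fp b phi + \sum_(b : {set E} | G b) Fm b phi))%E))).
  apply: le_iint => [||phi]; first exact: jnn_pr.
    by apply: jnnD => //; apply: jnnZ; [rewrite lee_fin|apply: jnnD; exact: jS].
  rewrite /Fp /Fm !sumEFin -[X in (_ * X)%E]EFinD -[X in (_ + X)%E]EFinM -EFinD lee_fin wt_fb (bigID G) /= mulrDl addrC.
  apply: lerD.
    by rewrite ler_piMr// sumr_ge0// => b _; exact: wt_ge0.
  rewrite mulr_suml -big_split /= mulr_sumr; apply: ler_sum => b Gb.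
  rewrite indicE; have [/set_mem Aphi|_] := boolP (phi \in A); last first.
    by rewrite mulr0 mulr_ge0// addr_ge0// mulr_ge0// wt_ge0.
  rewrite !indicE (mem_set (HAp _ _ Gb Aphi)) (mem_set (HAm _ _ Gb Aphi)) !mulr1.
  have := fb_shift phi Gb; rewrite -/M.
  set x := wt (fb b) phi; set y := wt _ _; set z := wt _ _ => xyz.
  have x0 : 0 <= x by exact: wt_ge0.
  have y0 : 0 <= y by exact: wt_ge0.
  have z0 : 0 <= z by exact: wt_ge0.
  (* From [x ^ 2 <= M y z] the bound [x <= M / 2 * (y + z)] follows by the inequality between the
     means, with [M >= 1] absorbing the square root of [M]. *)
  rewrite -(@ler_pXn2r _ 2)// ?nnegrE ?mulr_ge0 ?addr_ge0 ?(ltW M0)//.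
  apply: (le_trans xyz); rewrite exprMn.
  apply: (@le_trans _ _ (M ^+ 2 * (y * z))).
    by rewrite ler_wpM2r ?mulr_ge0// expr2 ler_peMl// ltW.
  have -> : (M / 2) ^+ 2 * (y + z) ^+ 2 = M ^+ 2 * ((y + z) ^+ 2 / 4) by field.
  apply: ler_wpM2l; first by rewrite exprn_ge0 ?(ltW M0).
  have : 0 <= (y - z) ^+ 2 by exact: sqr_ge0.
  rewrite !expr2; lra.
rewrite /ipin iintD//; last by apply: jnnZ; [rewrite lee_fin|apply: jnnD; exact: jS].
rewrite leeD2l// iintZ//; last by apply: jnnD; exact: jS.
rewrite iintD; try exact: jS.
have half (B : set (V -> R)) (F : {set E} -> (V -> R) -> \bar R) : jset B -> (forall b, jnn (F b)) ->
   (forall b, G b -> I (F b) = I (fun phi => (wt (kb b) phi * \1_B phi)%:E)) ->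
   (I (fun phi => \sum_(b : {set E} | G b) F b phi) <= (M * pr B)%:E * Z)%E.
  move=> mB jF IF; rewrite /ipin iint_sum//.
  rewrite (eq_bigr _ IF) /ipin -iint_sum; last by move=> b _; exact: jkb.
  rewrite EFinM -muleA -prE// /ipin -iintZ ?(ltW M0)//; last exact: jnn_pr.
  apply: le_iint => [||phi].
  - by apply: jnn_sum => b _; exact: jkb.
  - by apply: jnnZ; [rewrite lee_fin ltW|exact: jnn_pr].
  - rewrite sumEFin -EFinM lee_fin -mulr_suml mulrA ler_wpM2r//.
    apply: le_trans (kb_total phi); rewrite -/M [leRHS](bigID G) /= lerDl sumr_ge0// => b _.
    exact: wt_ge0.
have := leeD (half _ _ mAp jFp IFp) (half _ _ mAm jFm IFm).
move=> /(lee_wpmul2l (_ : 0 <= (M / 2)%:E)%E); rewrite lee_fin => /(_ M20) /le_trans; apply.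
rewrite -ZK -(EFinM (M * pr Ap)) -(EFinM (M * pr Am)) -(EFinD (M * pr Ap * _)) -(EFinM (M / 2)) -EFinM lee_fin.
(* One factor [M] comes from comparing weights for a fixed [b], the other from resumming over
   [b]. *)
have -> : expR (2 * C * energy) = M * M by rewrite -expRD; congr expR; ring.
by rewrite le_eqVlt; apply/orP; left; apply/eqP; ring.
Qed.

Lemma union_bound (J : finType) (P : pred J) (S : J -> {set E}) :
  (forall b, ~~ G b -> exists2 j, P j & S j \subset b) ->
  (I (fun phi => (\sum_(b : {set E} | ~~ G b) wt (fb b) phi)%:E) <=
    (\sum_(j | P j) eps ^+ #|S j|)%:E * Z)%E.
Proof.
move=> cov.
have jw j : jnn (fun phi => (wt (badwt h h1 (S j)) phi)%:E).
  by apply: jnn_wt => [e|e x]; rewrite /badwt; case: ifP => _ //; [exact: (sp_mh1 sp)|exact: (sp_h1 sp)].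
rewrite -sumEFin ge0_sume_distrl; last by move=> j _; rewrite lee_fin exprn_ge0// ltW// (sp_eps sp).
apply: (@le_trans _ _ (\sum_(j | P j) I (fun phi => (wt (badwt h h1 (S j)) phi)%:E))%E); last first.
  by apply: lee_sum => j _; exact: (sp_peierls sp).
rewrite /ipin -iint_sum//.
apply: le_iint => [||phi].
- have := @jnn_sum R n _ (index_enum _) (fun b => ~~ G b) (fun b phi => (wt (fb b) phi)%:E).
  move=> /(_ (fun b _ => jnn_wt (mfb b) (fb0 b))).
  by under [X in jnn X -> _]eq_fun do rewrite sumEFin.
- by apply: jnn_sum => j _.
- rewrite sumEFin lee_fin.
  under [leRHS]eq_bigr do rewrite badwt_fb.
  rewrite (exchange_big_dep xpredT)//= [leRHS](bigID G) /= -[leLHS]add0r; apply: lerD.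
    by apply: sumr_ge0 => b _; apply: sumr_ge0 => j _; exact: wt_ge0.
  apply: ler_sum => b /cov[j Pj Sj]; rewrite (bigD1 j) ?Pj//= lerDl.
  by apply: sumr_ge0 => i _; exact: wt_ge0.
Qed.

Lemma mermin_wagner_pr (J : finType) (P : pred J) (S : J -> {set E}) (A Ap Am : set (V -> R)) :
  jset A -> jset Ap -> jset Am ->
  (forall b phi, G b -> A phi -> Ap (fun v => phi v + tau b v)) ->
  (forall b phi, G b -> A phi -> Am (fun v => phi v - tau b v)) ->
  (forall b, ~~ G b -> exists2 j, P j & S j \subset b) ->
  pr A <= \sum_(j | P j) eps ^+ #|S j| + expR (2 * C * energy) / 2 * (pr Ap + pr Am).
Proof.
move=> mA mAp mAm HAp HAm cov; apply: pr_le => //.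
apply: le_trans (mermin_wagner mA mAp mAm HAp HAm) _.
rewrite [in leRHS]EFinD ge0_muleDl; last 2 first.
- by rewrite lee_fin sumr_ge0// => j _; rewrite exprn_ge0// ltW// (sp_eps sp).
- by rewrite lee_fin mulr_ge0 ?divr_ge0 ?expR_ge0// addr_ge0// pr_ge0.
by rewrite leeD2r// union_bound.
Qed.

End MerminWagner.

(** * Splitting of a regular potential *)

Section SecondDifference.
Context {R : realType}.

(** The mean value theorem for [u] on both sides of [g], and then for its derivative, gives the
    second derivative at an intermediate point times [(x - y) d] with [0 < x - y < 2 d]; hence the
    factor 2. *)
Lemma C2_second_difference (u : R -> R) (M : R) : 0 < M ->
  C2_on [set x | `|x| <= M] u ->
  exists2 B, 0 <= B & forall g d, `|g| + `|d| <= M ->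
    u (g + d) + u (g - d) - 2 * u g <= B * d ^+ 2.
Proof.
move=> M0 u2.
have inM x : x \in `[- M, M] -> `|x| <= M by rewrite in_itv/= ler_norml.
have MM : - M <= M by lra.
have [B B0 uB] : exists2 B, 0 <= B & forall x, `|x| <= M -> `|derive1 (derive1 u) x| <= B.
  have cn : {within `[- M, M], continuous (fun x => `|derive1 (derive1 u) x|)}.
    apply/continuous_in_subspaceT => z /[1!inE] /inM zM.
    have [_ _ c2] := u2 _ zM.
    exact: (continuous_comp c2 (@norm_continuous _ _ _)).
  have [c cM cmax] := EVT_max MM cn.
  exists `|derive1 (derive1 u) c|; first exact: normr_ge0.
  move=> x xM; apply: cmax.
  by rewrite in_itv/= -ler_norml.
have mvt (f : R -> R) a b : a < b -> `|a| <= M -> `|b| <= M ->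
   (forall x, `|x| <= M -> derivable f x 1) ->
   exists2 c, (a < c < b) && (`|c| <= M) & f b - f a = derive1 f c * (b - a).
  move=> ab aM bM df.
  have cM c : a <= c <= b -> `|c| <= M.
    by move: aM bM; rewrite !ler_norml => /andP[? ?] /andP[? ?] /andP[? ?]; apply/andP; split; lra.
  have [||c] := @MVT R f (derive1 f) a b ab.
  - move=> x; rewrite in_itv/= => /andP[ax xb].
    have xM : `|x| <= M by apply: cM; rewrite !ltW.
    by apply: DeriveDef; [exact: df|rewrite derive1E].
  - apply: derivable_within_continuous => x; rewrite in_itv/= => /cM xM.
    exact: df.
  - by rewrite in_itv/= => /andP[ac cb] E; exists c; rewrite ?E// ac cb cM// !ltW.
have du x : `|x| <= M -> derivable u x 1 by move=> /u2[].
have ddu x : `|x| <= M -> derivable (derive1 u) x 1 by move=> /u2[].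
have main g d : 0 < d -> `|g| + d <= M -> u (g + d) + u (g - d) - 2 * u g <= 2 * B * d ^+ 2.
  move=> d0 gd.
  have gM : `|g| <= M by lra.
  have gp : `|g + d| <= M by rewrite (le_trans (ler_normD _ _))// [`|d|]gtr0_norm.
  have gm : `|g - d| <= M by rewrite (le_trans (ler_normB _ _))// [`|d|]gtr0_norm.
  have [|x /andP[/andP[x1 x2] xM] E1] := mvt u g (g + d) _ gM gp du; first by lra.
  have [|y /andP[/andP[y1 y2] yM] E2] := mvt u (g - d) g _ gm gM du; first by lra.
  have [|z /andP[_ zM] E3] := mvt (derive1 u) y x _ yM xM ddu; first by lra.
  have -> : u (g + d) + u (g - d) - 2 * u g = (u (g + d) - u g) - (u g - u (g - d)) by ring.
  rewrite E1 E2.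
  have -> : derive1 u x * (g + d - g) - derive1 u y * (g - (g - d)) = (derive1 u x - derive1 u y) * d by ring.
  rewrite E3.
  have zB := uB _ zM.
  apply: (@le_trans _ _ (B * (2 * d) * d)); last by rewrite le_eqVlt; apply/orP; left; apply/eqP; ring.
  apply: ler_wpM2r; first exact: ltW.
  apply: (@le_trans _ _ (B * (x - y))).
    by apply: ler_wpM2r; [lra|exact: le_trans (ler_norm _) zB].
  by apply: ler_wpM2l => //; lra.
exists (2 * B); first lra.
move=> g d gd; have [d0|d0|->] := ltrgtP d 0.
- have := main g (- d); rewrite opprK sqrrN oppr_gt0 => /(_ d0).
  by rewrite (ltr0_norm d0) in gd; move=> /(_ gd); lra.
- by rewrite (gtr0_norm d0) in gd; exact: main.
- by rewrite addr0 subr0 expr0n/= mulr0; lra.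
Qed.

End SecondDifference.

(** * A cutoff that is stable under symmetric shifts *)

Section Cutoff.
Context {R : realType}.
Variables (K D eta : R).
Hypotheses (K0 : 0 < K) (D0 : 0 < D) (eta01 : 0 < eta <= 1).

(* signed distance to [-K, K] *)
Definition excess (g : R) : R := g - Num.max (- K) (Num.min g K).

(** The square makes the bump vanish to second order at the ends of its support. The height
    [1 - eta] leaves a share [eta] of [h] to [h1] everywhere, which pays for the correction
    terms. *)
Definition cutoff (g : R) : R := (1 - eta) * Num.max 0 (1 - (excess g / D) ^+ 2) ^+ 2.

Lemma excessE g : excess g = if K < g then g - K else if g < - K then g + K else 0.
Proof.
rewrite /excess; case: (ltP K g) => Kg.
  by have := K0; case: (ltP (- K) K) => ? ?; lra.
by case: (ltP g (- K)) => ?; lra.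
Qed.

(** The left side is the squared distance from [g + d] to the interval; the point of the interval
    nearest to [g] is a competitor. *)
Lemma excess_shift g d : excess (g + d) ^+ 2 <= (excess g + d) ^+ 2.
Proof.
have K0' := K0; rewrite -subr_ge0 subr_sqr !excessE.
case: (ltP K (g + d)) => ?; case: (ltP K g) => ?; case: (ltP (g + d) (- K)) => ?;
  case: (ltP g (- K)) => ?; nra.
Qed.

Lemma excess_bound g : `|g| <= K + D -> excess g ^+ 2 <= D ^+ 2.
Proof.
have K0' := K0; have D0' := D0; rewrite ler_norml excessE => /andP[? ?].
by case: (ltP K g) => ?; [|case: (ltP g (- K)) => ?]; nra.
Qed.

Lemma excess_far g : K + D <= `|g| -> D ^+ 2 <= excess g ^+ 2.
Proof.
have K0' := K0; have D0' := D0; rewrite ler_normr excessE => /orP[] ?;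
  (case: (ltP K g) => ?; [|case: (ltP g (- K)) => ?]); nra.
Qed.

Lemma cutoff_ge0 g : 0 <= cutoff g.
Proof. by rewrite mulr_ge0 ?sqr_ge0// subr_ge0; case/andP: eta01. Qed.

Lemma cutoff_le g : cutoff g <= 1 - eta.
Proof.
have e1 : 0 <= 1 - eta by rewrite subr_ge0; case/andP: eta01.
rewrite /cutoff ler_piMr// exprn_ile1// ?le_max ?lexx// ge_max ler01/= gerBl.
exact: sqr_ge0.
Qed.

Lemma cutoff_in g : `|g| <= K -> cutoff g = 1 - eta.
Proof.
rewrite ler_norml /cutoff excessE => /andP[g1 g2].
rewrite ifF; last by apply/negbTE; rewrite -leNgt.
rewrite ifF; last by apply/negbTE; rewrite -leNgt.
by rewrite mul0r expr0n/= subr0 maxEle ler01 expr1n mulr1.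
Qed.

Lemma cutoff_out g : K + D <= `|g| -> cutoff g = 0.
Proof.
move=> /excess_far gD; rewrite /cutoff (_ : Num.max _ _ = 0) ?expr0n/= ?mulr0//.
apply/max_idPl; rewrite subr_le0 expr_div_n ler_pdivlMr ?mul1r//.
exact: exprn_gt0.
Qed.

Lemma cutoffN g : cutoff (- g) = cutoff g.
Proof.
rewrite /cutoff (_ : excess (- g) = - excess g) ?mulNr ?sqrrN// !excessE.
by have K0' := K0; case: (ltP K g) => ?; case: (ltP g (- K)) => ?; case: (ltP K (- g)) => ?; case: (ltP (- g) (- K)) => ?; lra.
Qed.

Lemma measurable_cutoff : measurable_fun setT cutoff.
Proof.
have me : measurable_fun setT excess.
  by apply: measurable_funB => //; apply: measurable_maxr => //; exact: measurable_minr.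
apply: measurable_funM => //; apply: measurable_funX; apply: measurable_maxr => //.
by apply: measurable_funB => //; apply: measurable_funX; exact: measurable_funM.
Qed.

(* The cutoff f is nonnegative with f'' bounded below, so (f')^2 <= const * f and a
   correction of order d^2 makes f log-concave at scale d. *)
Lemma cutoff_shift g d : `|g| <= K + D ->
  cutoff g ^+ 2 <= (cutoff (g + d) + 10 / D ^+ 2 * d ^+ 2) *
                   (cutoff (g - d) + 10 / D ^+ 2 * d ^+ 2).
Proof.
move=> gK; set m := 1 - eta.
have m0 : 0 <= m by rewrite subr_ge0; case/andP: eta01.
have m1 : m <= 1 by rewrite gerBl; case/andP: eta01 => /ltW.
pose y := excess g / D; pose e := d / D; pose z := 1 - y ^+ 2.
have D0' := D0.
have y1 : y ^+ 2 <= 1.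
  by rewrite expr_div_n ler_pdivrMr ?exprn_gt0// mul1r excess_bound.
have z0 : 0 <= z by rewrite subr_ge0.
have z1 : z <= 1 by rewrite gerBl sqr_ge0.
have D00 : D != 0 by rewrite gt_eqF.
have e2 : 10 / D ^+ 2 * d ^+ 2 = 10 * e ^+ 2 by rewrite expr_div_n; field.
have cg : cutoff g = m * z ^+ 2 by rewrite /cutoff (max_idPr z0).
have low s : s ^+ 2 = 1 ->
    m * (z ^+ 2 - 4 * z * y * (s * e) - 2 * e ^+ 2) <= cutoff (g + s * d).
  move=> s2; apply: ler_wpM2l => //.
  set w := 1 - _ ^+ 2.
  have wz : z - 2 * y * (s * e) - e ^+ 2 <= w.
    have : (excess (g + s * d) / D) ^+ 2 <= (y + s * e) ^+ 2.
      rewrite /y /e expr_div_n mulrA -mulrDl expr_div_n ler_pM2r ?invr_gt0 ?exprn_gt0//.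
      exact: excess_shift.
    have se2 : (s * e) ^+ 2 = e ^+ 2 by rewrite exprMn s2 mul1r.
    rewrite sqrrD se2 /w /z mulr2n => ?; lra.
  have wmax : w <= Num.max 0 w by rewrite le_max lexx orbT.
  have max0 : 0 <= Num.max 0 w by rewrite le_max lexx.
  set t := Num.max 0 w in wmax max0 *.
  (* The square is linearized: [t ^ 2 >= 2 t z - z ^ 2], with [t >= w]. *)
  have : 0 <= (t - z) ^+ 2 by exact: sqr_ge0.
  nra.
have lp : m * (z ^+ 2 - 4 * z * y * e - 2 * e ^+ 2) <= cutoff (g + d).
  by have := low 1 (expr1n _ _); rewrite !mul1r.
have lm : m * (z ^+ 2 + 4 * z * y * e - 2 * e ^+ 2) <= cutoff (g - d).
  by have := low (- 1); rewrite sqrrN expr1n !mulN1r mulrN opprK; exact.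
rewrite cg e2; set x1 := cutoff (g + d) in lp *; set x2 := cutoff (g - d) in lm *.
(* The two factors are at least [a + F - p] and [a + F + p]. The constant is [10 = 2 + 8]: 2 covers
   the quadratic loss of the linearization, and [8 e ^ 2] makes [2 a F] dominate [p ^ 2]. *)
pose a := m * z ^+ 2; pose p := 4 * (m * z * y * e); pose F := (10 - 2 * m) * e ^+ 2.
have a0 : 0 <= a by apply: mulr_ge0 => //; exact: sqr_ge0.
have ee : 0 <= e ^+ 2 by exact: sqr_ge0.
have F8 : 8 * e ^+ 2 <= F by apply: ler_wpM2r => //; lra.
have X1 : a + F - p <= x1 + 10 * e ^+ 2 by rewrite /a /F /p; lra.
have X2 : a + F + p <= x2 + 10 * e ^+ 2 by rewrite /a /F /p; lra.
have p2 : p ^+ 2 <= 16 * a * e ^+ 2.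
  have -> : p ^+ 2 = 16 * a * e ^+ 2 * (m * y ^+ 2) by rewrite /p /a; ring.
  apply: ler_piMr; first by apply: mulr_ge0 => //; apply: mulr_ge0.
  by apply: mulr_ile1 => //; exact: sqr_ge0.
have XY : a ^+ 2 <= (a + F - p) * (a + F + p).
  have -> : (a + F - p) * (a + F + p) = a ^+ 2 + 2 * a * F + F ^+ 2 - p ^+ 2 by ring.
  have : 16 * a * e ^+ 2 <= 2 * a * F.
    have -> : 16 * a * e ^+ 2 = 2 * a * (8 * e ^+ 2) by ring.
    by apply: ler_wpM2l => //; rewrite mulr_ge0.
  have : 0 <= F ^+ 2 by exact: sqr_ge0.
  lra.
have aa : 0 <= a ^+ 2 by exact: sqr_ge0.
rewrite -/a; apply: (le_trans XY).
have sumXY : 0 <= a + F - p + (a + F + p) by lra.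
have X0 : 0 <= a + F - p.
  by rewrite leNgt; apply/negP => X0; nra.
have Y0 : 0 <= a + F + p.
  by rewrite leNgt; apply/negP => Y0; nra.
exact: ler_pM.
Qed.

End Cutoff.

Section Tail.
Context {R : realType}.
Notation leb := (@lebesgue_measure R).

(** Monotone convergence along an exhaustion. General sets [F i] serve both regimes: balls of
    unbounded radius, and balls increasing to the open interval where the potential is regular. *)
Lemma integral_tail (h : R -> R) (F : nat -> set R) (d : R) :
  measurable_fun setT h -> (forall x, 0 <= h x) ->
  (\int[leb]_x (h x)%:E < +oo)%E ->
  nondecreasing_seq F -> (forall i, measurable (F i)) ->
  (\int[leb]_(x in ~` \bigcup_i F i) (h x)%:E = 0)%E -> 0 < d ->
  exists i, (\int[leb]_(x in ~` F i) (h x)%:E <= d%:E)%E.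
Proof.
move=> mh h0 hfin Fn mF out d0.
have mh' D : measurable D -> measurable_fun D (fun x => (h x)%:E).
  by move=> mD; apply: measurable_funTS; exact/measurable_EFinP.
have h0' x : (0 <= (h x)%:E)%E by rewrite lee_fin.
have split D : measurable D ->
    (\int[leb]_x (h x)%:E = \int[leb]_(x in D) (h x)%:E + \int[leb]_(x in ~` D) (h x)%:E)%E.
  move=> mD; rewrite -ge0_integral_setU ?setUv//; try exact: measurableC.
    exact: mh'.
  by rewrite disj_set2E setICr.
have mU : measurable (\bigcup_i F i) by exact: bigcupT_measurable.
have cvF : (\int[leb]_(x in F i) (h x)%:E @[i --> \oo] -->
    \int[leb]_(x in \bigcup_i F i) (h x)%:E)%E.
  by apply: ge0_nondecreasing_set_cvg_integral => // i; exact: mh'.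
have fin D : measurable D -> ((\int[leb]_(x in D) (h x)%:E)%E \is a fin_num).
  move=> mD; rewrite ge0_fin_numE; last by apply: integral_ge0.
  by apply: le_lt_trans hfin; apply: ge0_subset_integral => //; exact: mh'.
have tot : (\int[leb]_x (h x)%:E = \int[leb]_(x in \bigcup_i F i) (h x)%:E)%E.
  by rewrite (split _ mU) out adde0.
rewrite -tot in cvF.
have finT := fin _ measurableT.
rewrite -(fineK finT) in cvF.
move/fine_cvgP : cvF => [_ /cvgrPdist_le/(_ d d0)[i _ /(_ i (leqnn i))]] /= H.
exists i.
have finF := fin _ (mF i); have finC := fin _ (measurableC (mF i)).
have := split _ (mF i).
rewrite -(fineK finT) -(fineK finF) -(fineK finC) -EFinD => -[E].
rewrite lee_fin; apply: le_trans H; apply: le_trans (ler_norm _).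
by rewrite E addrC addKr.
Qed.

End Tail.

Section ExistsSplitting.
Context {R : realType}.
Variable U : R -> \bar R.
Notation leb := (@lebesgue_measure R).
Hypotheses (U_meas : measurable_fun [set: R] U)
  (U_sym : forall x, U (- x) = U x)
  (U_inf : exists m : R, forall x, (m%:E <= U x)%E)
  (U_int : (0 < \int[leb]_x expeR (- U x))%E /\ (\int[leb]_x expeR (- U x) < +oo)%E).
Notation h := (boltz U).

Lemma U_neqNy x : U x != -oo%E.
Proof. by have [m /(_ x)] := U_inf; case: (U x). Qed.

Lemma boltzE x : (h x)%:E = expeR (- U x).
Proof. by have := U_neqNy x; rewrite /boltz; case: (U x). Qed.

Lemma boltz_ge0 x : 0 <= h x.
Proof. by rewrite /boltz fine_ge0// expeR_ge0. Qed.

Lemma boltzN x : h (- x) = h x.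
Proof. by rewrite /boltz U_sym. Qed.

Lemma measurable_boltz : measurable_fun setT h.
Proof.
rewrite (_ : h = fun x => if U x == +oo%E then 0 else expR (- fine (U x))); last first.
  apply/funext => x; have := U_neqNy x; rewrite /boltz.
  by case: (U x).
apply: measurable_fun_ifT => //; first exact: measurable_fun_eqe.
by apply: measurableT_comp => //; apply: measurableT_comp => //; exact: measurableT_comp.
Qed.

(** Here [K] bounds the typical gradients, [D] is the width on which the cutoff decays, and [e] the
    room for shifts; the potential must be regular over all three. Beyond [K] the mass of [h] is as
    small as desired. *)
Lemma exists_splitting (eps : R) : 0 < eps <= 1 ->
  (exists u : R -> R, forall d : R, 0 < d -> exists K D e : R,
     [/\ [/\ 0 < K, 0 < D & 0 < e], forall x : R, `|x| <= K + D + e -> U x = (u x)%:E,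
         C2_on [set x : R | `|x| <= K + D + e] u &
         (\int[leb]_(x in ~` [set x : R | (`|x| <= K)%R]) (h x)%:E <= d%:E)%E]) ->
  exists h0 h1 C d0, splitting h h0 h1 eps C d0.
Proof.
move=> eps01 [u reg].
have [m Um] := U_inf.
have mh := measurable_boltz.
pose H0 := Num.max 1 (expR (- m)).
have H01 : 1 <= H0 by rewrite le_max lexx.
have hH0 x : 0 <= h x <= H0.
  rewrite boltz_ge0/= le_max; apply/orP; right.
  by rewrite -lee_fin boltzE; change (expR (- m))%:E with (expeR (- m%:E)); rewrite lee_expeR leeN2.
have hint : (\int[leb]_x (h x)%:E < +oo)%E.
  by under eq_integral do rewrite boltzE; case: U_int.
pose J := fine (\int[leb]_x (h x)%:E)%E.
have J0 : 0 <= J by rewrite fine_ge0// integral_ge0// => x _; rewrite lee_fin boltz_ge0.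
have JE : (\int[leb]_x (h x)%:E)%E = J%:E.
  by rewrite fineK// ge0_fin_numE// integral_ge0// => x _; rewrite lee_fin boltz_ge0.
pose Jm := Num.max 1 J.
have Jm1 : 1 <= Jm by rewrite le_max lexx.
have JJm : J <= Jm by rewrite le_max lexx orbT.
have [c [r [c0 r0 r1 hc]]] : exists c r : R, [/\ 0 < c, 0 < r, 2 * r <= 1 & forall x, `|x| <= 2 * r -> c <= h x].
  have [K [D [e [[K0 D0 e0] Uu u2 _]]]] := reg 1 ltr01.
  have cu : {for 0, continuous u}.
    have [|du _ _] := u2 0; first by rewrite /= normr0; lra.
    exact/differentiable_continuous/derivable1_diffP.
  have := cu => /cvgrPdist_le/(_ 1 ltr01)/nbhs_ballP[s /= s0 us].
  pose r := Num.min (1 / 2) (Num.min (s / 4) (K / 2)).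
  have rs : r <= s / 4 by rewrite /r !ge_min lexx orbT.
  have rK : r <= K / 2 by rewrite /r !ge_min lexx !orbT.
  have r12 : r <= 1 / 2 by rewrite /r !ge_min lexx.
  have r0 : 0 < r by rewrite /r !lt_min !divr_gt0.
  exists (expR (- (u 0 + 1))), r; split => //; first exact: expR_gt0.
    by lra.
  move=> x xr; rewrite -lee_fin boltzE Uu; last by lra.
  rewrite -EFinN /= lee_fin ler_expR lerN2.
  have := us x; rewrite /ball /= sub0r normrN => /(_ _).
  have -> : `|x| < s by lra.
  by move=> /(_ isT) /ler_normlP[]; lra.
pose A := (H0 ^+ 2 * Jm) ^+ 4.
pose B := (eps ^+ 4 * (c ^+ 2 * (2 * r))) ^+ 4.
have [e0 e1] := andP eps01.
have A1 : 1 <= A by rewrite !exprn_ege1// mulr_ege1// exprn_ege1.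
have B0 : 0 < B by rewrite exprn_gt0// !mulr_gt0 ?exprn_gt0.
(* [J1] is the mass of [h1] that the Peierls estimate tolerates. One half is left to the tail beyond
   [K], the other to the share [eta] of [h] inside, which fixes [eta]. *)
pose J1 := Num.min 1 (B / A).
have A0 : 0 < A by lra.
have J10 : 0 < J1 by rewrite lt_min ltr01 divr_gt0.
have J11 : J1 <= 1 by rewrite ge_min lexx.
have small : A * J1 <= B by rewrite mulrC -ler_pdivlMr// ge_min lexx orbT.
pose eta := J1 / (2 * Jm).
have Jm0 : 0 < Jm by lra.
have eta0 : 0 < eta by rewrite divr_gt0// mulr_gt0.
have eta1 : eta <= 1 by rewrite ler_pdivrMr ?mulr_gt0//; lra.
have etaJ : eta * Jm = J1 / 2 by rewrite /eta; field; lra.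
have J12 : 0 < J1 / 2 by lra.
have [K [D [e [[K0 D0 e'0] Uu u2 tail]]]] := reg _ J12.
have eta01 : 0 < eta <= 1 by rewrite eta0.
pose chi := cutoff K D eta.
have chi0 x : 0 <= chi x by exact: cutoff_ge0.
have chi1 x : chi x <= 1 - eta by exact: cutoff_le.
have mchi : measurable_fun setT chi by exact: measurable_cutoff.
pose h0 x := chi x * h x.
pose h1 x := (1 - chi x) * h x.
have mh0 : measurable_fun setT h0 by exact: measurable_funM.
have mh1 : measurable_fun setT h1 by apply: measurable_funM => //; exact: measurable_funB.
have h1h x : eta * h x <= h1 x <= h x.
  rewrite /h1 ler_wpM2r ?boltz_ge0//=; last by have := chi1 x; lra.
  by rewrite ler_piMl ?boltz_ge0//; have := chi0 x; lra.
have h1N x : h1 (- x) = h1 x by rewrite /h1 boltzN /chi cutoffN.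
have h10 x : 0 <= h1 x.
  by have /andP[+ _] := h1h x; apply: le_trans; rewrite mulr_ge0 ?boltz_ge0// ltW.
have h1J : (\int[leb]_x (h1 x)%:E <= J1%:E)%E.
  pose F : set R := [set x : R | `|x| <= K].
  have mF : measurable F.
    rewrite (_ : F = `[- K, K]%classic); first exact: measurable_itv.
    by apply/seteqP; split => x; rewrite /F /= in_itv/= ler_norml.
  have mh' (f : R -> R) D' : measurable_fun setT f -> measurable D' -> measurable_fun D' (fun x => (f x)%:E).
    by move=> mf mD; apply: measurable_funTS; exact/measurable_EFinP.
  have mFC := measurableC mF.
  have mhT : measurable_fun (F `|` ~` F) (fun x => (h1 x)%:E).
    by rewrite setUv; exact: (mh' h1 setT mh1 measurableT).
  rewrite -(setUv F) ge0_integral_setU//; try (by rewrite disj_set2E setICr);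
    try (by move=> x _; rewrite lee_fin).
  have -> : J1 = J1 / 2 + J1 / 2 by lra.
  rewrite EFinD; apply: leeD; last first.
    apply: le_trans tail; apply: ge0_le_integral => //.
    - by move=> x _; rewrite lee_fin.
    - by apply: (mh' _ _ _ (measurableC mF)).
    - by apply: (mh' _ _ _ (measurableC mF)).
    - by move=> x _; rewrite lee_fin; have /andP[] := h1h x.
  apply: (@le_trans _ _ (\int[leb]_(x in F) (eta%:E * (h x)%:E))%E).
    apply: ge0_le_integral => //.
    - by move=> x _; rewrite lee_fin.
    - exact: mh'.
    - by apply: mh' => //; exact: measurable_funM.
    - by move=> x Fx; rewrite -EFinM lee_fin /h1 /chi cutoff_in// opprB addrC subrK.
  rewrite ge0_integralZl//; last 3 first.
  - exact: mh'.
  - by move=> x _; rewrite lee_fin boltz_ge0.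
  - by rewrite lee_fin ltW.
  rewrite -etaJ (EFinM eta Jm); apply: lee_pmul => //.
  - by rewrite lee_fin ltW.
  - by apply: integral_ge0 => x _; rewrite lee_fin boltz_ge0.
  apply: (@le_trans _ _ (\int[leb]_x (h x)%:E)%E).
    apply: ge0_subset_integral => //; first exact: mh'.
    by move=> x _; rewrite lee_fin boltz_ge0.
  by rewrite JE lee_fin.
have hJ : (\int[leb]_x (h x)%:E <= Jm%:E)%E by rewrite JE lee_fin.
have KDe : 0 < K + D + e by lra.
have [B2 B20 uB] := C2_second_difference KDe u2.
(* The first term bounds the second difference of [u]; the second turns a correction by
   [10 / D ^ 2 * d ^ 2 * h] into one by [h1], as [eta * h <= h1]. *)
pose C := B2 + 10 / D ^+ 2 / eta.
have D2 : 0 < 10 / D ^+ 2 by rewrite divr_gt0// exprn_gt0.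
have C10 : 0 < 10 / D ^+ 2 / eta by rewrite divr_gt0.
have C0 : 0 <= C by rewrite addr_ge0// ltW.
exists h0, h1, C, e; split => //.
- by move=> x; rewrite /h0 /h1; ring.
- by move=> x; rewrite mulr_ge0 ?boltz_ge0.
- exact: boltzN.
- move=> n n0; exact: (Z_gt0 n0 mh hH0 c0 r0 r1 hc).
- move=> n n0; exact: (Z_fin n0 mh boltzN hH0 H01 Jm1 hJ).
- move=> n n0 S; exact: (peierls n0 mh mh1 boltzN h1N hH0 h1h eta01 H01 Jm1 hJ h1J
    c0 r0 r1 (ltW J10) J11 hc eps01 small S).
- move=> d g de.
  have rhs0 x : 0 <= h0 x + C * d ^+ 2 * h1 x.
    apply: addr_ge0; first by apply: mulr_ge0; [exact: chi0|exact: boltz_ge0].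
    by apply: mulr_ge0; [rewrite mulr_ge0// sqr_ge0|exact: h10].
  have [gK|gK] := leP (K + D) `|g|.
    rewrite {1}/h0 /chi cutoff_out// mul0r expr0n/=.
    by rewrite !mulr_ge0 ?expR_ge0.
  have near s : `|s| <= e -> h (g + s) = expR (- u (g + s)).
    by move=> se; apply: EFin_inj; rewrite boltzE Uu// (le_trans (ler_normD _ _))//; lra.
  have hg : h g = expR (- u g) by have := near 0; rewrite normr0 addr0; apply; exact: ltW.
  have hp := near d de; have hm : h (g - d) = expR (- u (g - d)) by apply: near; rewrite normrN.
  have kE x : (cutoff K D eta x + 10 / D ^+ 2 * d ^+ 2) * h x <= h0 x + C * d ^+ 2 * h1 x.
    have : 10 / D ^+ 2 * d ^+ 2 * h x <= C * d ^+ 2 * h1 x.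
      have -> : 10 / D ^+ 2 * d ^+ 2 * h x = (10 / D ^+ 2 / eta) * d ^+ 2 * (eta * h x).
        by field; rewrite !gt_eqF.
      apply: ler_pM.
      - by apply: mulr_ge0; [exact: ltW C10|exact: sqr_ge0].
      - by rewrite mulr_ge0 ?boltz_ge0// ltW.
      - by rewrite ler_wpM2r ?sqr_ge0// lerDr.
      - by have /andP[] := h1h x.
    rewrite /h0 /chi; lra.
  have cut0 x : 0 <= cutoff K D eta x + 10 / D ^+ 2 * d ^+ 2.
    by apply: addr_ge0; [exact: chi0|rewrite mulr_ge0 ?sqr_ge0// ltW].
  apply: (@le_trans _ _ (expR (C * d ^+ 2) *
    (((cutoff K D eta (g + d) + 10 / D ^+ 2 * d ^+ 2) * h (g + d)) *
     ((cutoff K D eta (g - d) + 10 / D ^+ 2 * d ^+ 2) * h (g - d))))); last first.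
    rewrite ler_wpM2l ?expR_ge0//; apply: ler_pM => //; by rewrite mulr_ge0 ?boltz_ge0.
  have -> : forall a b p q k : R, k * ((a * p) * (b * q)) = (a * b) * (k * (p * q)) by move=> *; ring.
  rewrite /h0 exprMn; apply: ler_pM; rewrite ?sqr_ge0//.
    by apply: cutoff_shift => //; exact: ltW.
  rewrite hg hp hm -!expRD expr2 -expRD ler_expR.
  have := uB g d; have : `|g| + `|d| <= K + D + e by lra.
  move=> -> /(_ isT).
  have : B2 * d ^+ 2 <= C * d ^+ 2.
    by rewrite ler_wpM2r ?sqr_ge0// lerDl ltW.
  lra.
Qed.

Lemma regular_splitting (eps : R) : 0 < eps <= 1 ->
  (exists u : R -> R, (forall x, U x = (u x)%:E) /\ C2_on [set: R] u)
  \/ (exists K : R, 0 < K /\ (forall x, K < `|x| -> U x = +oo%E) /\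
        exists u : R -> R, (forall x, `|x| < K -> U x = (u x)%:E) /\
                           C2_on [set x | `|x| < K] u) ->
  exists h0 h1 C d0, splitting h h0 h1 eps C d0.
Proof.
move=> eps01 reg; apply: exists_splitting => //.
have hint : (\int[leb]_x (h x)%:E < +oo)%E.
  by under eq_integral do rewrite boltzE; case: U_int.
have mball (r : R) : measurable ([set x : R | `|x| <= r] : set (measurableTypeR R)).
  rewrite (_ : [set x | _] = `[- r, r]%classic); first exact: measurable_itv.
  by apply/seteqP; split => x; rewrite /= in_itv/= ler_norml.
case: reg => [[u [Uu u2]]|[K [K0 [Uy [u [Uu u2]]]]]]; exists u => d d0.
  have [|||i Hi] := @integral_tail R h (fun i => [set x | `|x| <= i.+1%:R]) d measurable_boltz boltz_ge0 hint _ _ _ d0.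
  - by move=> i j ij; apply/subsetPset => x /= /le_trans; apply; rewrite ler_nat.
  - by move=> i; exact: mball.
  - rewrite (_ : ~` _ = set0) ?integral_set0//; apply/seteqP; split => // x; apply.
    by exists (Num.truncn `|x|) => //=; rewrite ltW// truncnS_gt.
  exists i.+1%:R, 1, 1; split => //.
  by move=> x _; exact: u2.
(* These radii increase to [K] and stay below it, so that a margin remains for [D] and [e]. *)
pose Km i : R := K * (i.+1%:R / i.+2%:R).
have Kmi i : 0 < Km i < K.
  rewrite /Km mulr_gt0 ?divr_gt0 ?ltr0Sn//= gtr_pMr// ltr_pdivrMr ?ltr0Sn// mul1r ltr_nat.
  by [].
have [|||i Hi] := @integral_tail R h (fun i => [set x | `|x| <= Km i]) d measurable_boltz boltz_ge0 hint _ _ _ d0.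
- move=> i j ij; apply/subsetPset => x /= /le_trans; apply.
  rewrite /Km ler_pM2l// ler_pdivrMr ?ltr0Sn// mulrAC ler_pdivlMr ?ltr0Sn//.
  by rewrite -!natrM ler_nat; lia.
- by move=> i; exact: mball.
- rewrite (_ : ~` _ = [set x : R | K <= `|x|]); last first.
    apply/seteqP; split => x /=.
      move=> nx; rewrite leNgt; apply/negP => xK; apply: nx.
      pose t := K / (K - `|x|).
      exists (Num.truncn t) => //=.
      have Kx : 0 < K - `|x| by lra.
      have := truncnS_gt t; set j := (Num.truncn t).+1 => tj.
      have {}tj : K < j%:R * (K - `|x|) by rewrite -ltr_pdivrMr.
      rewrite /Km mulrA ler_pdivlMr ?ltr0Sn// -/j -(natr1 j) -/j.
      lra.
    move=> Kx [i _] /= xi; have /andP[_] := Kmi i; lra.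
  have mD : measurable ([set x : R | K <= `|x|] : set (measurableTypeR R)).
    rewrite (_ : [set x | _] = (`]-oo, - K] `|` `[K, +oo[)%classic).
      by apply: measurableU; exact: measurable_itv.
    apply/funext => x; apply/propext; rewrite /= !in_itv/= andbT ler_normr (lerNr x K) orbC.
    by split=> [/orP|H]; last exact/orP.
  (* The regularity assumption says nothing about [U] at [K] and [- K], but two points are
     negligible. *)
  have N0 : countable ([set K; - K] : set R) by apply: finite_set_countable; exact: finite_set2.
  rewrite (@ge0_negligible_integral _ _ _ _ _ ([set K; - K] : set (measurableTypeR R)))//.
  - apply: integral0_eq => x [/= Kx nx].
    rewrite boltzE Uy//= lt_neqAle Kx andbT; apply/eqP => Kx'; apply: nx.
    by rewrite Kx'; case: (ltP 0 x) => x0; [left; rewrite gtr0_norm|right; rewrite ler0_norm ?opprK].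
  - by apply: measurableU; exact: measurable_set1.
  - by apply: measurable_funTS; apply/measurable_EFinP; exact: measurable_boltz.
  - by move=> x _; rewrite lee_fin boltz_ge0.
  - exact: countable_lebesgue_measure0.
have /andP[K1 K2] := Kmi i.
exists (Km i), ((K - Km i) / 4), ((K - Km i) / 4); split => //.
- by split=> //; lra.
- by move=> x xK; apply: Uu; lra.
- by move=> x /= xK; apply: u2 => /=; lra.
Qed.

End ExistsSplitting.

(** * Geometry of sparse sets of edges *)

Section Paths.
Context {n : nat} (n0 : (0 < n)%N).
Notation V := (vertex n).
Notation E := (edge n).
Notation N := (2 * n)%N.

(* A lattice path is a word of steps (direction, orientation). *)
Definition step (z : V) (d : bool * bool) : V := if d.2 then tgt (z, d.1) else tgtV (z, d.1).
Definition step_edge (z : V) (d : bool * bool) : E :=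
  if d.2 then (z, d.1) else (tgtV (z, d.1), d.1).
Fixpoint edges_of (z : V) (ws : seq (bool * bool)) : seq E :=
  if ws is d :: ws' then step_edge z d :: edges_of (step z d) ws' else [::].

Lemma step_edgeP z d : (z = src (step_edge z d) /\ step z d = tgt (step_edge z d)) \/
  (z = tgt (step_edge z d) /\ step z d = src (step_edge z d)).
Proof.
case: d => d [] /=; [left|right]; rewrite /step_edge /step /src //=.
by split=> //; rewrite (tgtK d z).
Qed.

Lemma edges_of_cat z ws1 ws2 :
  edges_of z (ws1 ++ ws2) = edges_of z ws1 ++ edges_of (foldl step z ws1) ws2.
Proof. by elim: ws1 z => //= d ws1 IH z; rewrite IH. Qed.

Lemma size_edges_of z ws : size (edges_of z ws) = size ws.
Proof. by elim: ws z => //= d ws IH z; rewrite IH. Qed.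

Variables (v : V) (b : {set E}).

(** Edges are not repeated along the path: its edges in [b] then form a set of known cardinality, to
    which the Peierls estimate applies. *)
Definition reach (k : nat) (w : V) : Prop := exists ws, [/\ foldl step v ws = w,
  uniq (edges_of v ws) & (count [predC b] (edges_of v ws) <= k)%N].

Lemma reach0 : reach 0 v.
Proof. by exists [::]. Qed.

Lemma reach_prefix k ws1 ws2 : uniq (edges_of v (ws1 ++ ws2)) ->
  (count [predC b] (edges_of v (ws1 ++ ws2)) <= k)%N -> reach k (foldl step v ws1).
Proof.
rewrite edges_of_cat cat_uniq count_cat => /andP[u _] ck.
by exists ws1; split => //; apply: leq_trans ck; exact: leq_addr.
Qed.

(** If the new edge already lies on the path, the path is cut just before or just after it, which
    reaches either of its endpoints at no greater cost. *)
Lemma reach_step k x d : reach k x -> reach (k + (step_edge x d \notin b)) (step x d).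
Proof.
move=> [ws [wx uw ck]]; set e := step_edge x d.
have [ein|nin] := boolP (e \in edges_of v ws); last first.
  exists (rcons ws d); rewrite -cats1 edges_of_cat foldl_cat /= wx; split => //.
    by rewrite cat_uniq uw /= orbF nin.
  by rewrite count_cat /= addn0 leq_add.
have [ws1 [d' [ws2 [wsE eE]]]] : exists ws1 d' ws2,
    ws = ws1 ++ d' :: ws2 /\ step_edge (foldl step v ws1) d' = e.
  move: ein; clear; elim: ws v => //= d0 ws IH z; rewrite inE => /orP[/eqP ->|/IH].
    by exists [::], d0, ws.
  by move=> [ws1 [d' [ws2 [-> ?]]]]; exists (d0 :: ws1), d', ws2.
have ck' : (count [predC b] (edges_of v ws) <= k + (e \notin b))%N.
  by apply: leq_trans ck _; exact: leq_addr.
have pre1 : reach (k + (e \notin b)) (foldl step v ws1).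
  by apply: (@reach_prefix _ ws1 (d' :: ws2)); rewrite -wsE.
have pre2 : reach (k + (e \notin b)) (step (foldl step v ws1) d').
  have -> : step (foldl step v ws1) d' = foldl step v (rcons ws1 d') by rewrite foldl_rcons.
  by apply: (@reach_prefix _ (rcons ws1 d') ws2); rewrite cat_rcons -wsE.
have := step_edgeP (foldl step v ws1) d'; rewrite eE.
have := step_edgeP x d; rewrite -/e.
by move=> [[_ ->]|[_ ->]] [[e1 e2]|[e1 e2]]; rewrite -?e1 -?e2.
Qed.

Lemma reach_edge k (e : E) : (reach k (src e) -> reach (k + (e \notin b)) (tgt e)) /\
  (reach k (tgt e) -> reach (k + (e \notin b)) (src e)).
Proof.
case: e => z d; split.
  by move=> /(@reach_step _ _ (d, true)).
move=> /(@reach_step _ _ (d, false)); rewrite /step_edge /step /=.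
by rewrite /src /= (_ : tgtV (tgt (z, d), d) = z)//; exact: (tgtVK d z).
Qed.

(* Distance from [v] when crossing an edge of [b] is free, truncated at [cap]. *)
Definition pdist (cap : nat) (w : V) : nat := find (fun k => `[< reach k w >]) (iota 0 cap).

Lemma pdist_cap cap w : (pdist cap w <= cap)%N.
Proof. by rewrite /pdist -[leqRHS](size_iota 0) find_size. Qed.

Lemma pdist_reach cap w : (pdist cap w < cap)%N -> reach (pdist cap w) w.
Proof.
move=> lt; have : has (fun k => `[< reach k w >]) (iota 0 cap).
  by rewrite has_find size_iota.
by move=> /(nth_find 0%N); rewrite nth_iota// add0n => /asboolP.
Qed.

Lemma pdist_le cap w k : (k < cap)%N -> reach k w -> (pdist cap w <= k)%N.
Proof.
move=> kc rk; rewrite leqNgt; apply/negP => /(before_find 0%N).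
by rewrite nth_iota// add0n => /asboolP.
Qed.

Lemma pdist_center cap : (0 < cap)%N -> pdist cap v = 0%N.
Proof. by move=> c0; apply/eqP; rewrite -leqn0; apply: pdist_le => //; exact: reach0. Qed.

Lemma pdist_edge cap (e : E) : (pdist cap (tgt e) <= pdist cap (src e) + (e \notin b))%N /\
  (pdist cap (src e) <= pdist cap (tgt e) + (e \notin b))%N.
Proof.
have H x y : (forall k, reach k x -> reach (k + (e \notin b)) y) ->
    (pdist cap y <= pdist cap x + (e \notin b))%N.
  move=> xy; have [lt|ge] := ltnP (pdist cap x + (e \notin b)) cap; last first.
    by apply: leq_trans ge; exact: pdist_cap.
  apply: pdist_le => //; apply: xy; apply: pdist_reach.
  by apply: leq_ltn_trans lt; exact: leq_addr.
by split; apply: H => k; have [] := reach_edge k e.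
Qed.

(* No long path from [v] has half of its edges in [b]. *)
Definition sparse (l : nat) : Prop := forall ws, (l <= size ws)%N -> uniq (edges_of v ws) ->
  (2 * count (mem b) (edges_of v ws) < size ws)%N.

End Paths.

Section CyclicDistance.
Context {n : nat} (n0 : (0 < n)%N).
Notation V := (vertex n).
Notation E := (edge n).
Notation N := (2 * n)%N.

Definition cdist (a b : 'I_N) : nat := minn (off a b) (N - off a b).
Definition nearby (v : V) (r : nat) (w : V) : bool :=
  (cdist v.1 w.1 <= r)%N && (cdist v.2 w.2 <= r)%N.

Lemma cdist_ordS a b : (cdist a (ordS b) <= (cdist a b).+1)%N.
Proof. by rewrite /cdist off_ordS//; have := ltn_off n0 a b; case: ifP => H; lia. Qed.

Lemma cdist_ord_pred a b : (cdist a (ord_pred b) <= (cdist a b).+1)%N.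
Proof.
rewrite -{2}(ord_predK b) /cdist off_ordS//.
by have := ltn_off n0 a (ord_pred b); case: ifP => H; lia.
Qed.

Lemma nearby_step v r w d : nearby v r w -> nearby v r.+1 (step w d).
Proof.
case: w => x y /andP[/= h1 h2]; case: d => [[] []]; rewrite /step /nearby /= ?(leqW h1) ?(leqW h2) ?andbT /=.
- by apply: leq_trans (cdist_ordS _ _) _.
- by apply: leq_trans (cdist_ord_pred _ _) _.
- by apply: leq_trans (cdist_ordS _ _) _.
- by apply: leq_trans (cdist_ord_pred _ _) _.
Qed.

Lemma nearby_refl v : nearby v 0 v.
Proof. by rewrite /nearby /cdist /off !leqnn !subnn !min0n. Qed.

Lemma nearby_path v ws : nearby v (size ws) (foldl step v ws).
Proof.
elim/last_ind: ws => [|ws d IH]; first exact: nearby_refl.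
by rewrite size_rcons foldl_rcons; exact: nearby_step.
Qed.

Lemma nearby_le v r r' w : (r <= r')%N -> nearby v r w -> nearby v r' w.
Proof. by move=> rr /andP[h1 h2]; rewrite /nearby (leq_trans h1 rr) (leq_trans h2 rr). Qed.

Lemma card_cdist a r : (#|[set b : 'I_N | (cdist a b <= r)%N]%SET| <= 2 * r + 2)%N.
Proof.
have card1 (f : 'I_N -> nat) : injective f -> (#|[set b : 'I_N | (f b <= r)%N]%SET| <= r.+1)%N.
  move=> fi; pose g (b : 'I_N) : 'I_r.+1 := inord (f b).
  rewrite -[leqRHS](card_ord r.+1) -(card_in_imset (f := g) (D := [set b | (f b <= r)%N]%SET)).
    exact: max_card.
  move=> x y; rewrite !inE => fx fy /(congr1 (@nat_of_ord _)); rewrite /g !inordK ?ltnS//.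
  exact: fi.
have f1 : injective (off a) by exact: off_inj.
have f2 : injective (fun b => (N - off a b)%N).
  move=> x y /= e; apply: f1; have := ltn_off n0 a x; have := ltn_off n0 a y; lia.
have := card1 _ f1; have := card1 _ f2.
set A := finset _; set B := finset _ => cA cB.
apply: (@leq_trans (#|B| + #|A|)); last by lia.
apply: leq_trans (leq_card_setU _ _); apply: subset_leq_card; apply/fintype.subsetP => x.
by rewrite !inE /cdist; lia.
Qed.

Lemma card_nearby v r : (#|[set w : V | nearby v r w]%SET| <= (2 * r + 2) ^ 2)%N.
Proof.
rewrite (_ : [set w | nearby v r w]%SET =
  finset.setX [set b : 'I_N | (cdist v.1 b <= r)%N]%SET [set b : 'I_N | (cdist v.2 b <= r)%N]%SET).
  by rewrite cardsX -mulnn leq_mul// card_cdist.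
by apply/setP => w; rewrite !inE.
Qed.

(** A path of length at least [2 ^ q] has fewer than half of its edges in [b], so its length is at
    most twice its cost; a shorter one stays within [2 ^ q] anyway. *)
Lemma sparse_nearby v b q cap w : sparse v b (2 ^ q) -> (pdist v b cap w < cap)%N ->
  nearby v (maxn (2 ^ q) (2 * pdist v b cap w)) w.
Proof.
move=> sp lt; have [ws [<- uw ck]] := pdist_reach lt.
apply: nearby_le (nearby_path v ws).
have [l|l] := leqP (2 ^ q) (size ws); last by rewrite leq_max (ltnW l).
rewrite leq_max; apply/orP; right.
have := sp ws l uw; have := count_predC (mem b) (edges_of v ws).
rewrite size_edges_of => <-.
have -> : count (predC (mem b)) (edges_of v ws) = count [predC b] (edges_of v ws).
  exact: eq_count.
lia.
Qed.

End CyclicDistance.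

(** * The logarithmic profile *)

Section Profile.
Context {R : realType}.

(* Logarithmic profile: it decreases linearly by [a / q] on each dyadic scale
   [2 ^ i, 2 ^ i.+1] for q <= i < 2 q, from [a] to [0]. *)
Definition ramp (i k : nat) : R := (minn (2 ^ i) (2 ^ i.+1 - k))%:R / 2 ^+ i.
Definition profile (q : nat) (a : R) (k : nat) : R := a / q%:R * \sum_(j < q) ramp (q + j) k.

Lemma ramp_lo i k : (k <= 2 ^ i)%N -> ramp i k = 1.
Proof.
move=> ki; rewrite /ramp (minn_idPl _); last by rewrite expnS; lia.
by rewrite natrX divff// expf_neq0.
Qed.

Lemma ramp_hi i k : (2 ^ i.+1 <= k)%N -> ramp i k = 0.
Proof. by rewrite -subn_eq0 /ramp => /eqP ->; rewrite minn0 mul0r. Qed.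

Lemma ramp_step i k : (2 ^ i <= k < 2 ^ i.+1)%N -> ramp i k - ramp i k.+1 = (2 ^+ i)^-1.
Proof.
move=> /andP[k1 k2]; rewrite /ramp -mulrBl -natrB; last lia.
rewrite (_ : (minn _ _ - minn _ _)%N = 1%N) ?mul1r//.
by move: k1 k2; rewrite expnS; lia.
Qed.

Lemma profile0 q a : (0 < q)%N -> profile q a 0 = a.
Proof.
move=> q0; rewrite /profile (eq_bigr (fun=> 1)); last by move=> j _; rewrite ramp_lo.
by rewrite sumr_const card_ord divfK// pnatr_eq0 -lt0n.
Qed.

Lemma profile_far q a k : (2 ^ (2 * q) <= k)%N -> profile q a k = 0.
Proof.
move=> qk; rewrite /profile big1 ?mulr0// => j _; apply: ramp_hi.
by apply: leq_trans qk; rewrite leq_exp2l//; have := ltn_ord j; lia.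
Qed.

(** At most one ramp varies between [k] and [k.+1], so the square has no cross terms. *)
Lemma profile_step_sqr q a k : (profile q a k - profile q a k.+1) ^+ 2 <=
  \sum_(j < q) (if (2 ^ (q + j) <= k < 2 ^ (q + j).+1)%N then (a / q%:R) ^+ 2 * (4 ^+ (q + j))^-1 else 0).
Proof.
rewrite /profile -mulrBr -sumrB exprMn.
have sq i : ((2 ^+ i)^-1 : R) ^+ 2 = (4 ^+ i)^-1.
  by rewrite exprVn -exprM mulnC exprM -natrX.
have term0 i : ~~ (2 ^ i <= k < 2 ^ i.+1)%N -> ramp i k - ramp i k.+1 = 0.
  rewrite negb_and -!ltnNge => /orP[h|h]; first by rewrite !ramp_lo ?subrr// ltnW.
  by rewrite !ramp_hi ?subrr//; lia.
have nn j : 0 <= (if (2 ^ (q + j) <= k < 2 ^ (q + j).+1)%N then (a / q%:R) ^+ 2 * (4 ^+ (q + j))^-1 else 0).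
  by case: ifP => // _; rewrite mulr_ge0 ?sqr_ge0// invr_ge0 exprn_ge0.
have [/existsP[j Hj]|/existsPn none] := boolP [exists j : 'I_q, (2 ^ (q + j) <= k < 2 ^ (q + j).+1)%N].
  rewrite (bigD1 j)//= [X in (_ + X) ^+ 2]big1 => [|i ij].
    rewrite addr0 ramp_step// sq (bigD1 j)//= Hj lerDl.
    by apply: sumr_ge0 => i _; exact: nn.
  apply: term0; apply: contra ij => /andP[i1 i2]; apply/eqP/ord_inj.
  have /andP[j1 j2] := Hj.
  have := leq_ltn_trans j1 i2; have := leq_ltn_trans i1 j2.
  by rewrite !ltn_exp2l//; lia.
rewrite big1 => [|j _]; last by apply: term0; exact: none.
by rewrite expr0n/= mulr0; apply: sumr_ge0 => j _; exact: nn.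
Qed.

Lemma geometric_tail (x : R) (l M : nat) : x = 4^-1 ->
  \sum_(L < M | (l <= L)%N) x ^+ L <= 2 * x ^+ l.
Proof.
move=> ->; set y : R := 4^-1; have y0 : 0 <= y by rewrite invr_ge0.
(* Adding the remainder of the geometric series, [4 / 3 * y ^ M], closes the induction. *)
suff : \sum_(L < M | (l <= L)%N) y ^+ L + 4 / 3 * y ^+ (maxn l M) <= 4 / 3 * y ^+ l.
  have : 0 <= y ^+ (maxn l M) by exact: exprn_ge0.
  have : 0 <= y ^+ l by exact: exprn_ge0.
  lra.
elim: M => [|M IH]; first by rewrite big_ord0 maxn0 add0r.
rewrite big_mkcond big_ord_recr /= -big_mkcond /=.
case: (leqP l M) => lM; last first.
  by move: IH; rewrite (maxn_idPl (ltnW lM)) (maxn_idPl lM) addr0.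
move: IH; rewrite (maxn_idPr lM) (maxn_idPr (leqW lM)) exprS.
have : y ^+ M * y = y ^+ M / 4 by [].
lra.
Qed.

End Profile.

(** * Shift estimates over dyadic scales and at a single vertex *)

Section Scales.
Context {R : realType} {n : nat} (n0 : (0 < n)%N).
Variables (h h0 h1 : R -> R) (C d0 : R).
Notation theta := (32^-1 : R).
Hypothesis sp : splitting h h0 h1 (theta ^+ 2) C d0.
Notation V := (vertex n).
Notation E := (edge n).
Notation N := (2 * n)%N.
Notation pr := (pr n0 h).

(** Each of the [q] scales [i] has [O(4 ^ i)] edges of squared gradient [(a / q) ^ 2 / 4 ^ i], hence
    energy [O(a ^ 2 / q ^ 2)]. The condition on [a] keeps all gradients below [d0]. The first term
    of the bound comes from summing [8 ^ L / 32 ^ L] over the lengths [L >= 2 ^ q]. *)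
Lemma mw_scale (v : V) (q : nat) (a : R) (A Ap Am : set (V -> R)) : (0 < q)%N ->
  ~~ nearby v (2 ^ (2 * q).+1) (origin n0) -> a ^+ 2 <= d0 ^+ 2 * (q%:R * 4 ^+ q) ->
  jset A -> jset Ap -> jset Am ->
  (forall (t : V -> R) phi, t v = a -> (forall w, ~~ nearby v (2 ^ (2 * q).+1) w -> t w = 0) ->
     A phi -> Ap (fun w => phi w + t w) /\ Am (fun w => phi w - t w)) ->
  pr A <= 2 * (4^-1) ^+ (2 ^ q) + expR (400 * C * a ^+ 2 / q%:R) / 2 * (pr Ap + pr Am).
Proof.
move=> q0 far ad mA mAp mAm HA.
have q0' : 0 < q%:R :> R by rewrite ltr0n.
have C0 := sp_C sp; have d00 := sp_d0 sp.
(* An edge with one endpoint at distance exactly [2 ^ (2 * q)] may still carry a gradient, so the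
   truncation must lie beyond it. *)
pose cap := (2 ^ (2 * q)).+1.
pose G (b : {set E}) := `[< sparse v b (2 ^ q) >].
pose tau (b : {set E}) (w : V) := profile q a (pdist v b cap w).
(* A bound on the squared gradient that does not depend on [b]: when [b] is sparse, a vertex at
   first-passage distance at most [2 ^ i.+1], with [i >= q], lies within [2 ^ i.+2] of [v] in the
   torus. *)
pose S (e : E) := \sum_(j < q) (if nearby v (2 ^ (q + j).+2) (src e) then (a / q%:R) ^+ 2 * (4 ^+ (q + j))^-1 else 0).
pose tb e := Num.sqrt (S e).
have S0 e : 0 <= S e.
  by apply: sumr_ge0 => j _; case: ifP => // _; rewrite mulr_ge0 ?sqr_ge0// invr_ge0 exprn_ge0.
have tau0 b w : G b -> ~~ nearby v (2 ^ (2 * q).+1) w -> tau b w = 0.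
  move=> /asboolP sb farw; apply: profile_far; rewrite leqNgt; apply: contra farw => lt.
  have := sparse_nearby n0 sb (leq_trans lt (leqW (leqnn _))).
  apply: nearby_le; rewrite geq_max; apply/andP; split; first by rewrite leq_exp2l//; lia.
  by rewrite expnS leq_mul2l ltnW.
have tau_b (b : {set E}) (e : E) : e \in b -> tau b (src e) = tau b (tgt e).
  move=> eb; have [] := pdist_edge v b cap e; rewrite eb !addn0 => l1 l2.
  by rewrite /tau (_ : pdist v b cap (src e) = pdist v b cap (tgt e))//; apply/eqP; rewrite eqn_leq l1 l2.
have tau_tb b e : G b -> `|tau b (src e) - tau b (tgt e)| <= tb e.
  move=> /asboolP sb; rewrite -sqrtr_sqr; apply: ler_wsqrtr.
  have [e1 e2] := pdist_edge v b cap e.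
  have [m [dm1 dm2]] : exists m, (pdist v b cap (src e) <= m.+1)%N /\
     (tau b (src e) - tau b (tgt e)) ^+ 2 <= (profile q a m - profile q a m.+1) ^+ 2.
    rewrite /tau; case: (ltngtP (pdist v b cap (src e)) (pdist v b cap (tgt e))) => lt.
    - exists (pdist v b cap (src e)); split => //.
      by rewrite (_ : pdist v b cap (tgt e) = (pdist v b cap (src e)).+1)//; lia.
    - exists (pdist v b cap (tgt e)); rewrite -(sqrrN (profile q a (pdist v b cap (tgt e)) - _)) opprB.
      by rewrite (_ : pdist v b cap (src e) = (pdist v b cap (tgt e)).+1)//; lia.
    - by exists (pdist v b cap (src e)); rewrite lt subrr expr0n/= sqr_ge0.
  apply: (le_trans dm2); apply: (le_trans (profile_step_sqr _ _ _)); apply: ler_sum => j _.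
  case: ifPn => [/andP[m1 m2]|_]; last first.
    by case: ifP => // _; rewrite mulr_ge0 ?sqr_ge0// invr_ge0 exprn_ge0.
  rewrite ifT//.
  have le2 : (2 ^ (q + j).+1 <= 2 ^ (2 * q))%N by rewrite leq_exp2l//; have := ltn_ord j; lia.
  have lt : (pdist v b cap (src e) < cap)%N.
    by rewrite ltnS; apply: leq_trans le2; apply: leq_trans dm1 _.
  apply: nearby_le (sparse_nearby n0 sb lt); rewrite geq_max; apply/andP; split.
    by rewrite leq_exp2l//; lia.
  by rewrite (expnS 2 (q + j).+1) leq_mul2l; apply: leq_trans dm1 _.
have tb2 e : tb e ^+ 2 = S e by rewrite sqr_sqrtr.
have tb_d0 e : tb e <= d0.
  rewrite -(ger0_norm (ltW d00)) -sqrtr_sqr; apply: ler_wsqrtr.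
  apply: (@le_trans _ _ (\sum_(j < q) (a / q%:R) ^+ 2 * (4 ^+ q)^-1)).
    apply: ler_sum => j _; case: ifP => _; last by rewrite mulr_ge0 ?sqr_ge0// invr_ge0 exprn_ge0.
    apply: ler_wpM2l; first exact: sqr_ge0.
    by rewrite lef_pV2 ?posrE ?exprn_gt0// ler_weXn2l// ?leq_addr// ler1n.
  rewrite sumr_const card_ord -[leLHS]mulr_natr expr_div_n.
  have y0 : 0 < 4 ^+ q :> R by exact: exprn_gt0.
  move: (4 ^+ q) (q%:R : R) y0 q0' ad => y x y0 x0 ad.
  rewrite (_ : _ * _ = a ^+ 2 / (x * y)); last by field; rewrite !gt_eqF.
  by rewrite ler_pdivrMr// mulr_gt0.
have en : energy tb <= 200 * a ^+ 2 / q%:R.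
  rewrite /energy (eq_bigr _ (fun e _ => tb2 e)) /S exchange_big /=.
  apply: (@le_trans _ _ (\sum_(j < q) 200 * a ^+ 2 / q%:R ^+ 2)).
    apply: ler_sum => j _; rewrite -big_mkcond /= sumr_const -[leLHS]mulr_natr.
    set i := (q + j)%N.
    (* The side of the box is at most [2 * 2 ^ i.+2 + 2 <= 10 * 2 ^ i], and two edges leave each
       vertex. *)
    have card : (#|[pred e : E | nearby v (2 ^ i.+2) (src e)]| <= 200 * 4 ^ i)%N.
      apply: (@leq_trans (#|[set w : V | nearby v (2 ^ i.+2) w]%SET| * 2)%N).
        rewrite -[2%N]card_bool -cardX; apply: subset_leq_card; apply/fintype.subsetP => -[w d].
        by rewrite !inE /= andbT.
      apply: (@leq_trans ((2 * 2 ^ i.+2 + 2) ^ 2 * 2)%N); first by rewrite leq_mul2r card_nearby.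
      have -> : (4 ^ i = 2 ^ i * 2 ^ i)%N by rewrite -expnMn.
      have : (0 < 2 ^ i)%N by rewrite expn_gt0.
      rewrite !expnS; move: (2 ^ i)%N => x x0; nia.
    apply: (@le_trans _ _ ((a / q%:R) ^+ 2 / 4 ^+ i * (200 * 4 ^ i)%:R)).
      by apply: ler_wpM2l; [rewrite divr_ge0 ?sqr_ge0// exprn_ge0|rewrite ler_nat].
    have y0 : 0 < 4 ^+ i :> R by exact: exprn_gt0.
    rewrite natrM natrX expr_div_n le_eqVlt; apply/orP; left; apply/eqP.
    move: (4 ^+ i) (q%:R : R) y0 q0' => y x y0 x0.
    by field; rewrite !gt_eqF.
  rewrite sumr_const card_ord -[leLHS]mulr_natr le_eqVlt; apply/orP; left; apply/eqP.
  by field; rewrite gt_eqF.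
pose M := #|E|.+1.
(* Codes for the union bound: a word of steps with a mark on each, the marked edges being those
   placed in [b]. The edges of a relevant word are distinct, so its length is below [M]. *)
pose J := {L : 'I_M & L.-tuple (bool * bool * bool)}.
pose word (j : J) : seq (bool * bool) := map fst (tagged j).
pose msk (j : J) : seq E := mask (map snd (tagged j)) (edges_of v (word j)).
pose P (j : J) := [&& (2 ^ q <= tag j)%N, uniq (edges_of v (word j)) & (tag j <= 2 * size (msk j))%N].
pose SS (j : J) : {set E} := [set e in msk j]%SET.
have cov b : ~~ G b -> exists2 j, P j & SS j \subset b.
  move=> /asboolPn /existsNP[ws /not_implyP[l /not_implyP[uw /negP]]]; rewrite -leqNgt => half.
  have sM : (size ws < M)%N.
    by rewrite ltnS -(size_edges_of v) -(card_uniqP uw) max_card.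
  pose t := zip ws (map (mem b) (edges_of v ws)).
  have st : size t = size ws by rewrite size_zip size_map size_edges_of minnn.
  pose j : J := Tagged (fun L : 'I_M => L.-tuple (bool * bool * bool)) (Tuple (introT eqP (st : size t = Ordinal sM))).
  have wj : word j = ws by rewrite /word /j /= /t -/unzip1 unzip1_zip// size_map size_edges_of.
  have mj : msk j = [seq e <- edges_of v ws | e \in b].
    rewrite /msk wj /j /= /t -/unzip2 unzip2_zip; last by rewrite size_map size_edges_of.
    by rewrite filter_mask.
  exists j.
    by rewrite /P wj uw /= l mj size_filter.
  by apply/fintype.subsetP => e; rewrite inE mj mem_filter => /andP[].
apply: le_trans (mermin_wagner_pr sp (fun b Gb => tau0 b _ Gb far) (fun b e _ => @tau_b b e) tau_tb tb_d0 mA mAp mAm _ _ cov) _.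
- move=> b phi Gb Aphi.
  have tv : tau b v = a by rewrite /tau pdist_center// profile0.
  by have [] := HA (tau b) phi tv (fun w => tau0 b w Gb) Aphi.
- move=> b phi Gb Aphi.
  have tv : tau b v = a by rewrite /tau pdist_center// profile0.
  by have [] := HA (tau b) phi tv (fun w => tau0 b w Gb) Aphi.
apply: lerD.
  have -> : \sum_(j | P j) (theta ^+ 2) ^+ #|SS j| =
      \sum_(L < M) \sum_(t : L.-tuple (bool * bool * bool)) (if P (Tagged _ t) then (theta ^+ 2) ^+ #|SS (Tagged _ t)| else 0).
    rewrite big_mkcond /= (sig_big_dep xpredT (fun _ => xpredT) (fun (L : 'I_M) (t : L.-tuple (bool * bool * bool)) => if P (Tagged _ t) then (theta ^+ 2) ^+ #|SS (Tagged _ t)| else 0)) /=.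
    by apply: eq_bigr => -[].
  apply: le_trans (geometric_tail (2 ^ q) M erefl).
  rewrite [leRHS]big_mkcond /=; apply: ler_sum => L _.
  have th0 : 0 <= theta by rewrite invr_ge0.
  have th1 : theta <= 1 by rewrite invf_le1// ler1n.
  apply: (@le_trans _ _ (\sum_(t : L.-tuple (bool * bool * bool)) (if (2 ^ q <= L)%N then theta ^+ L else 0))).
    apply: ler_sum => t _; rewrite /P; case: (2 ^ q <= L)%N => //=.
    case: ifP => [/andP[u s]|_]; last by rewrite exprn_ge0.
    rewrite -exprM; apply: ler_wiXn2l => //; apply: leq_trans s _.
    have um : uniq (msk (Tagged _ t)) by exact: mask_uniq.
    by rewrite leq_mul2l /SS cardsE (card_uniqP um) leqnn.
  rewrite sumr_const card_tuple !card_prod card_bool; case: ifP => _; last by rewrite mul0rn.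
  rewrite -[leLHS]mulr_natr natrX -exprMn (_ : theta * _ = 4^-1)//.
  by field.
apply: ler_wpM2r; first by apply: addr_ge0; [exact: (pr_ge0 n0 sp mAp)|exact: (pr_ge0 n0 sp mAm)].
apply: ler_wpM2r => //; rewrite ler_expR.
have : C * energy tb <= C * (200 * a ^+ 2 / q%:R) by rewrite ler_wpM2l.
lra.
Qed.

(** Shifting a single height serves where there is no room for a dyadic scale. The only bad event is
    that one of the four incident edges is in [b]. *)
Lemma mw_local (v : V) (a : R) (A Ap Am : set (V -> R)) :
  v != origin n0 -> `|a| <= d0 -> jset A -> jset Ap -> jset Am ->
  (forall phi, A phi ->
     Ap (fun w => phi w + (if w == v then a else 0)) /\ Am (fun w => phi w - (if w == v then a else 0))) ->
  pr A <= 4 * theta ^+ 2 + expR (8 * C * a ^+ 2) / 2 * (pr Ap + pr Am).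
Proof.
move=> vo ad mA mAp mAm HA.
have C0 := sp_C sp; have d00 := sp_d0 sp.
pose inc (e : E) := (src e == v) || (tgt e == v).
pose G (b : {set E}) := [forall e in b, ~~ inc e].
pose tau (b : {set E}) (w : V) : R := if w == v then a else 0.
pose tb e : R := if inc e then `|a| else 0.
have tau0 b : G b -> tau b (origin n0) = 0 by rewrite /tau eq_sym (negbTE vo).
have tau_b (b : {set E}) (e : E) : G b -> e \in b -> tau b (src e) = tau b (tgt e).
  by move=> /forall_inP H /H; rewrite negb_or /tau => /andP[/negbTE -> /negbTE ->].
have tau_tb (b : {set E}) (e : E) : G b -> `|tau b (src e) - tau b (tgt e)| <= tb e.
  move=> _; rewrite /tau /tb /inc.
  by do 2 case: eqP => _ /=; rewrite ?subrr ?subr0 ?sub0r ?normrN ?normr0.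
have tb_d0 e : tb e <= d0 by rewrite /tb; case: ifP => // _; exact: ltW.
have inc4 e : inc e -> exists d, e = step_edge v d.
  case: e => z d; rewrite /inc /src /= => /orP[/eqP ->|/eqP <-]; first by exists (d, true).
  by exists (d, false); rewrite /step_edge /= (_ : tgtV (tgt (z, d), d) = z)//; exact: (tgtVK d z).
have en : energy tb <= 4 * a ^+ 2.
  rewrite /energy (bigID inc) /= [X in _ + X]big1 ?addr0; last first.
    by move=> e /negbTE ie; rewrite /tb ie expr0n.
  rewrite (eq_bigr (fun=> a ^+ 2)); last by move=> e ie; rewrite /tb ie real_normK ?num_real.
  rewrite sumr_const -[leLHS]mulr_natr mulrC ler_wpM2r ?sqr_ge0//.
  have -> : 4 = #|{: bool * bool}|%:R :> R by rewrite card_prod card_bool.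
  rewrite ler_nat -cardsT; apply: leq_trans (leq_imset_card (step_edge v) _).
  apply: subset_leq_card; apply/fintype.subsetP => e ie.
  by have [d ->] := inc4 e ie; apply/imsetP; exists d.
have cov b : ~~ G b -> exists2 d : bool * bool, true & [set step_edge v d]%SET \subset b.
  rewrite negb_forall => /existsP[e]; rewrite negb_imply negbK => /andP[eb ie].
  by have [d ed] := inc4 e ie; exists d; rewrite // finset.sub1set -ed.
apply: le_trans (mermin_wagner_pr sp tau0 tau_b tau_tb tb_d0 mA mAp mAm _ _ cov) _.
- by move=> b phi _ /HA[].
- by move=> b phi _ /HA[].
apply: lerD.
  under eq_bigr do rewrite cards1 expr1.
  by rewrite sumr_const card_prod card_bool -[leLHS]mulr_natl.
apply: ler_wpM2r; first by apply: addr_ge0; [exact: (pr_ge0 n0 sp mAp)|exact: (pr_ge0 n0 sp mAm)].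
apply: ler_wpM2r => //; rewrite ler_expR.
have : C * energy tb <= C * (4 * a ^+ 2) by rewrite ler_wpM2l.
lra.
Qed.

End Scales.

(** * Delocalization *)

Section Events.
Context {R : realType} {n : nat}.
Notation V := (vertex n).

Lemma jset_pre (f : (V -> R) -> R) (B : set (measurableTypeR R)) :
  jmeas (f : _ -> measurableTypeR R) -> measurable B -> jset [set phi | B (f phi)].
Proof.
move=> mf mB d X x mx.
rewrite (_ : (fun z => _) = (\1_B : _ -> R) \o (fun z => f (fun v => x v z)))//.
by apply: measurableT_comp; [exact: measurable_indic|exact: mf].
Qed.

Lemma jmeas_coord (v : V) : jmeas ((fun phi : V -> R => phi v) : _ -> measurableTypeR R).
Proof. by move=> d X x mx; exact: mx. Qed.

Lemma jmeas_norm (v : V) : jmeas ((fun phi : V -> R => `|phi v|) : _ -> measurableTypeR R).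
Proof. by move=> d X x mx; apply: measurableT_comp => //; exact: mx. Qed.

Lemma jmeas_bigmax (I : Type) (r : seq I) (P : pred I) (F : I -> (V -> R) -> R) :
  (forall i, jmeas (F i : _ -> measurableTypeR R)) ->
  jmeas ((fun phi => \big[Num.max/0]_(i <- r | P i) F i phi) : _ -> measurableTypeR R).
Proof.
move=> mF d X x mx; elim: r => [|i r IH].
  rewrite [X in measurable_fun _ X](_ : _ = fun=> 0); first exact: measurable_cst.
  by apply/funext => z; rewrite big_nil.
case: (boolP (P i)) => Pi; last first.
  have -> : (fun z => \big[Num.max/0]_(i <- i :: r | P i) F i (x^~ z)) =
      (fun z => \big[Num.max/0]_(i <- r | P i) F i (x^~ z)); last exact: IH.
  by apply/funext => z; rewrite big_cons (negbTE Pi).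
have -> : (fun z => \big[Num.max/0]_(i <- i :: r | P i) F i (x^~ z)) =
    (fun z => Num.max (F i (x^~ z)) (\big[Num.max/0]_(i <- r | P i) F i (x^~ z))).
  by apply/funext => z; rewrite big_cons Pi.
by apply: measurable_maxr => //; exact: mF.
Qed.

Lemma jset_le (f : (V -> R) -> R) (x : R) : jmeas (f : _ -> measurableTypeR R) ->
  jset [set phi | (f phi <= x)%R].
Proof.
move=> mf; pose B : set (measurableTypeR R) := `]-oo, x]%classic.
rewrite (_ : [set phi | _] = [set phi | B (f phi)]); first by apply: jset_pre => //; exact: measurable_itv.
by apply/seteqP; split => phi; rewrite /B /= in_itv.
Qed.

Lemma jset_ge (f : (V -> R) -> R) (x : R) : jmeas (f : _ -> measurableTypeR R) ->
  jset [set phi | (x <= f phi)%R].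
Proof.
move=> mf; pose B : set (measurableTypeR R) := `[x, +oo[%classic.
rewrite (_ : [set phi | _] = [set phi | B (f phi)]); first by apply: jset_pre => //; exact: measurable_itv.
by apply/seteqP; split => phi; rewrite /B /=; rewrite in_itv/= andbT.
Qed.

Lemma jset_lt (f : (V -> R) -> R) (x : R) : jmeas (f : _ -> measurableTypeR R) ->
  jset [set phi | (f phi < x)%R].
Proof.
move=> mf; pose B : set (measurableTypeR R) := `]-oo, x[%classic.
rewrite (_ : [set phi | _] = [set phi | B (f phi)]); first by apply: jset_pre => //; exact: measurable_itv.
by apply/seteqP; split => phi; rewrite /B /=; rewrite in_itv.
Qed.

Lemma jset_gt (f : (V -> R) -> R) (x : R) : jmeas (f : _ -> measurableTypeR R) ->
  jset [set phi | (x < f phi)%R].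
Proof.
move=> mf; pose B : set (measurableTypeR R) := `]x, +oo[%classic.
rewrite (_ : [set phi | _] = [set phi | B (f phi)]); first by apply: jset_pre => //; exact: measurable_itv.
by apply/seteqP; split => phi; rewrite /B /=; rewrite in_itv/= andbT.
Qed.

Lemma jsetI (A B : set (V -> R)) : jset A -> jset B -> jset (A `&` B).
Proof.
move=> mA mB d X x mx.
rewrite [X in measurable_fun _ X](_ : _ = fun z => \1_A (x^~ z) * \1_B (x^~ z)).
  by apply: measurable_funM; [exact: mA|exact: mB].
by apply/funext => z; rewrite !indicE in_setI -natrM mulnb.
Qed.

Lemma sum_indic_le1 (J : finType) (A : J -> set (V -> R)) phi :
  (forall i j, A i phi -> A j phi -> i = j) -> \sum_j (\1_(A j) phi : R) <= 1.
Proof.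
move=> dis; have [[i Ai]|none] := pselect (exists i, A i phi).
  rewrite (bigD1 i)//= big1 ?addr0; first by rewrite indicE; case: (_ \in _).
  move=> j ji; rewrite indicE memNset// => Aj.
  by move/eqP: ji; apply; exact: dis.
by rewrite big1 ?ler01// => i _; rewrite indicE memNset// => Ai; apply: none; exists i.
Qed.

End Events.

Section Measure.
Context {R : realType} (U : R -> \bar R) (h0 h1 : R -> R) (eps C d0 : R).
Hypotheses (U_sym : forall x, U (- x) = U x)
  (U_inf : exists m : R, forall x, (m%:E <= U x)%E).
Notation h := (boltz U).
Hypothesis sp : splitting h h0 h1 eps C d0.
Context {n : nat} (n2 : (1 < n)%N).
Notation n0 := (ltnW n2).
Notation V := (vertex n).
Notation I := (ipin (origin n0)).
Notation Z := (Z n0 h).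

Let h_ge0 x : 0 <= h x. Proof. exact: boltz_ge0. Qed.
Let mh : measurable_fun setT h.
Proof.
rewrite (_ : h = (fun x => h0 x + h1 x)); last by apply/funext => x; rewrite (sp_sum sp).
by apply: measurable_funD; [exact: (sp_mh0 sp)|exact: (sp_mh1 sp)].
Qed.

Let Zf : 0 < fine Z. Proof. by rewrite fine_gt0// (sp_Z0 sp) (sp_Zy sp). Qed.
Let ZK : (fine Z)%:E = Z.
Proof. by rewrite fineK// ge0_fin_numE ?(sp_Zy sp)// ltW// (sp_Z0 sp). Qed.

Lemma weight_boltz (phi : V -> R) : weight U phi = (wt (fun=> h) phi)%:E.
Proof. by apply: weightE => // x; exact: U_neqNy. Qed.

Lemma EmuE (g : (V -> R) -> \bar R) :
  Emu U g = (I (fun phi => (wt (fun=> h) phi)%:E * g phi) * ((fine Z)^-1)%:E)%E.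
Proof.
rewrite /Emu /partition_fn !(pin_integralE n0) /Z /ipin; congr (_ * _)%E.
  by apply: eq_iint => phi; rewrite weight_boltz.
by congr ((fine _)^-1%:E); apply: eq_iint => phi; rewrite weight_boltz.
Qed.

Lemma PmuE (A : set (V -> R)) : jset A -> Pmu U A = (pr n0 h A)%:E.
Proof.
move=> mA; rewrite /Pmu EmuE.
under [X in (ipin _ X * _)%E]eq_fun do rewrite -EFinM.
by rewrite (prE n0 sp)// -ZK -!EFinM -mulrA divff ?mulr1// gt_eqF.
Qed.

(** This is Chebyshev's inequality. The positive and negative parts have equal means by the symmetry
    [phi -> - phi], and [y <= 1 + y ^ 2] makes them finite when the second moment is, so that their
    difference is 0. *)
Lemma Varmu_lb (v : V) (x : R) : 0 <= x ->
  ((x ^+ 2 * pr n0 h [set phi | (x <= `|phi v|)%R])%:E <= Varmu U v)%E.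
Proof.
move=> x0.
have mB : jset [set phi : V -> R | (x <= `|phi v|)%R] by apply: jset_ge; exact: jmeas_norm.
have jw : jnn (fun phi : V -> R => (wt (fun=> h) phi)%:E) by exact: jnn_wt.
have jF (f : R -> R) : measurable_fun setT f -> (forall y, 0 <= f y) ->
    jnn (fun phi : V -> R => ((wt (fun=> h) phi)%:E * (f (phi v))%:E)%E).
  move=> mf f0; apply: jnnM => //; apply: jnn_EFin => // d X y my.
  by apply: measurableT_comp => //; exact: my.
have msq : measurable_fun setT (fun y : R => y ^+ 2) by exact: measurable_funX.
have mpos : measurable_fun setT (fun y : R => Num.max y 0) by exact: measurable_maxr.
have mneg : measurable_fun setT (fun y : R => Num.max (- y) 0).
  by apply: measurable_maxr => //; exact: measurableT_comp.
have max0 (y : R) : 0 <= Num.max y 0 by rewrite le_max lexx orbT.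
have j2 := jF _ msq (fun y => sqr_ge0 y).
have jp := jF _ mpos max0.
have jn := jF _ mneg (fun y => max0 (- y)).
rewrite /Varmu !EmuE.
set m2 := (I _ * _)%E; set mp := (I _ * _)%E; set mn := (I _ * _)%E.
have Zi0 : 0 < (fine Z)^-1 by rewrite invr_gt0.
have m2lb : ((x ^+ 2 * pr n0 h [set phi | (x <= `|phi v|)%R])%:E <= m2)%E.
  rewrite /m2 EFinM -(PmuE mB) /Pmu EmuE muleA.
  apply: lee_wpmul2r; first by rewrite lee_fin ltW.
  under eq_fun do rewrite -EFinM.
  rewrite /ipin -iintZ ?sqr_ge0//; last exact: (jnn_pr sp).
  apply: le_iint => //.
    by apply: jnnZ; [rewrite lee_fin sqr_ge0|exact: (jnn_pr sp)].
  move=> phi; rewrite -!EFinM lee_fin mulrCA; apply: ler_wpM2l; first exact: wt_ge0.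
  rewrite indicE; have [/set_mem /= xphi|_] := boolP (_ \in _); last by rewrite mulr0 sqr_ge0.
  by rewrite mulr1 -(real_normK (num_real (phi v))) lerXn2r// nnegrE.
case: ifPn => m2y; first by rewrite leey.
have pn : mp = mn.
  rewrite /mp /mn; congr (_ * _)%E; rewrite /ipin.
  have := @iint_opp R n (unpinned (origin n0)) _ (fun=> 0) jn.
  under eq_iint do rewrite opprK.
  rewrite (_ : (fun=> - 0) = (fun=> 0)); last by apply/funext => w; rewrite oppr0.
  move=> <-; apply: eq_iint => phi; congr (_%:E * _)%E.
  apply: eq_bigr => e _; rewrite -[in RHS](sp_even sp); congr (h _); ring.
have m20 : (0 <= m2)%E by rewrite mule_ge0 ?lee_fin ?(ltW Zi0)//; exact: iint_ge0.
have m2fin : m2 \is a fin_num by rewrite ge0_fin_numE// ltey.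
have mpfin : mp \is a fin_num.
  have mp0 : (0 <= mp)%E by rewrite mule_ge0 ?lee_fin ?(ltW Zi0)//; exact: iint_ge0.
  rewrite ge0_fin_numE//; apply: (@le_lt_trans _ _ (1 + m2)%E); last first.
    by rewrite -(fineK m2fin) -EFinD ltry.
  have -> : 1%E = (I (fun phi : V -> R => (wt (fun=> h) phi)%:E) * ((fine Z)^-1)%:E)%E.
    by rewrite -/Z -ZK -EFinM divff// gt_eqF.
  rewrite /mp /m2 -ge0_muleDl; try exact: iint_ge0.
  rewrite /ipin -iintD//; apply: lee_wpmul2r; first by rewrite lee_fin ltW.
  apply: le_iint => //; first exact: jnnD.
  move=> phi; rewrite -!EFinM -EFinD lee_fin -{2}[wt _ _]mulr1 -mulrDr.
  apply: ler_wpM2l; first exact: wt_ge0.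
  rewrite ge_max; apply/andP; split; last by rewrite addr_ge0// sqr_ge0.
  have : 0 <= (phi v - 1 / 2) ^+ 2 by exact: sqr_ge0.
  by rewrite !expr2; lra.
by rewrite -pn subee// mul0e sube0.
Qed.

End Measure.

Section Bounds.
Context {R : realType}.

Lemma ln_le_sub1 (x : R) : 0 < x -> ln x <= x - 1.
Proof. by move=> x0; have := expR_ge1Dx (ln x); rewrite lnK ?posrE//; lra. Qed.

Lemma ln4_le : ln (4 : R) <= 3.
Proof. by have := @ln_le_sub1 4 _; lra. Qed.

Lemma ln_nat_le (s k : nat) : (1 + s <= 4 ^ k)%N -> ln (1 + s%:R : R) <= 3 * k%:R.
Proof.
move=> sk; apply: (@le_trans _ _ (ln ((4 : R) ^+ k))).
  have s0 : 0 < 1 + s%:R :> R by rewrite ltr_wpDr.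
  by rewrite ler_ln ?posrE ?exprn_gt0// -natrX -[X in X + _]/(1%:R) -natrD ler_nat.
rewrite lnXn ?ltr0n// -[leLHS]mulr_natr; apply: ler_wpM2r => //; exact: ln4_le.
Qed.

Lemma quarter_pow (q : nat) : (4^-1 : R) ^+ (2 ^ q) <= (4^-1) ^+ q.
Proof. by apply: ler_wiXn2l; rewrite ?invr_ge0 ?invf_le1 ?ler1n// ltnW// ltn_expl. Qed.

Lemma quarter_pow2 (q : nat) : (0 < q)%N -> (4^-1 : R) ^+ (2 ^ q) <= 16^-1.
Proof.
move=> q0; have -> : (16^-1 : R) = 4^-1 ^+ 2 by field.
apply: ler_wiXn2l; rewrite ?invr_ge0 ?invf_le1 ?ler1n//.
by rewrite -[2%N in leqLHS]expn1 leq_exp2l.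
Qed.

End Bounds.

Section Geometry.
Context {n : nat} (n2 : (1 < n)%N).
Notation n0 := (ltnW n2).
Notation V := (vertex n).

Lemma cdist_origin (k : 'I_(2 * n)) : cdist k (origin0 n0) = `|Defs.coord k|%N.
Proof.
have o : nat_of_ord (origin0 n0) = n.-1 by rewrite val_insubd ifT//; lia.
rewrite /cdist /off o /Defs.coord; have := ltn_ord k; move: (nat_of_ord k) => a.
by case: (leqP a n.-1) => H al; [rewrite distnEr//|rewrite distnEl//; last exact: ltnW]; lia.
Qed.

Lemma far_origin (v : V) r : (2 * r < l1norm v)%N -> ~~ nearby v r (origin n0).
Proof.
rewrite /nearby /l1norm /= !cdist_origin.
by move: `|_|%N `|_|%N => a b; lia.
Qed.

Lemma l1norm_origin : l1norm (origin n0) = 0%N.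
Proof. by rewrite /l1norm -!cdist_origin /cdist /off leqnn subnn min0n. Qed.

End Geometry.

(** * Windows and their disjoint translates *)

Section Claims.
Context {R : realType} (h h0 h1 : R -> R) (C d0 : R).
Notation theta := (32^-1 : R).
Hypothesis sp : splitting h h0 h1 (theta ^+ 2) C d0.
Notation mass n2 v x := (pr (ltnW n2) h [set phi : vertex _ -> R | (`|phi v| <= x)%R]).

Let C0 : 0 <= C. Proof. exact: (sp_C sp). Qed.
Let d00 : 0 < d0. Proof. exact: (sp_d0 sp). Qed.

Lemma jset_ball n (v : vertex n) (x : R) : jset [set phi : vertex n -> R | (`|phi v| <= x)%R].
Proof. by apply: jset_le; exact: jmeas_norm. Qed.

Lemma jset_ball_shift n (v : vertex n) (t x : R) : jset [set phi : vertex n -> R | (`|phi v + t| <= x)%R].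
Proof.
apply: jset_le => d X y my; apply: measurableT_comp => //.
by apply: measurable_funD => //; exact: my.
Qed.

(* The translates of the window [[- x, x]] by multiples of [3 x] are disjoint. *)
Lemma mass_le n (n2 : (1 < n)%N) (v : vertex n) (x M e : R) (m : nat) :
  0 < x -> (0 < m)%N -> 0 <= M ->
  (forall k, (0 < k <= m)%N -> mass n2 v x <= e + M / 2 *
     (pr (ltnW n2) h [set phi : vertex n -> R | (`|phi v + - (3 * k%:R * x)| <= x)%R] +
      pr (ltnW n2) h [set phi : vertex n -> R | (`|phi v + 3 * k%:R * x| <= x)%R])) ->
  mass n2 v x <= e + M / (2 * m%:R).
Proof.
move=> x0 m0 M0 H.
have m0' : 0 < m%:R :> R by rewrite ltr0n.
pose A (j : 'I_m * bool) : set (vertex n -> R) :=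
  [set phi | (`|phi v + (if j.2 then 3 * j.1.+1%:R * x else - (3 * j.1.+1%:R * x))| <= x)%R].
have sumA : \sum_j pr (ltnW n2) h (A j) <= 1.
  apply: (pr_sum _ sp) => [j|phi]; first exact: jset_ball_shift.
  apply: sum_indic_le1 => -[i b] [j c]; rewrite /A /= => Ai Aj.
  have i1 : 1 <= i.+1%:R :> R by rewrite ler1n.
  have j1 : 1 <= j.+1%:R :> R by rewrite ler1n.
  have lin (s t : R) : `|phi v + s| <= x -> `|phi v + t| <= x -> s - t <= 2 * x /\ t - s <= 2 * x.
    by rewrite !ler_norml => /andP[? ?] /andP[? ?]; split; lra.
  have ord : (if b then 1 else -1) * i.+1%:R = (if c then 1 else -1) * j.+1%:R :> R -> (i, b) = (j, c).
    case: b c {Ai Aj} => -[] /= E; try (exfalso; lra);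
      by congr pair; apply: ord_inj; apply: succn_inj; apply/eqP; rewrite -(eqr_nat R); apply/eqP; lra.
  have key (p r : R) : (p - r) * x * 3 <= 2 * x -> p - r < 1.
    by move=> pr; rewrite -(ltr_pM2r x0); lra.
  have nat_eq (p r : nat) : p%:R - r%:R < 1 :> R -> r%:R - p%:R < 1 :> R -> p = r.
    move=> h1' h2'; apply/eqP; rewrite eqn_leq; apply/andP; split; rewrite -ltnS -(ltr_nat R) -natr1; lra.
  apply: ord; case: b Ai => Ai; case: c Aj => Aj; have [l1 l2] := lin _ _ Ai Aj.
  - by rewrite !mul1r; congr _%:R; apply: nat_eq; apply: key; lra.
  - by exfalso; nra.
  - by exfalso; nra.
  - by rewrite (_ : i.+1 = j.+1)//; apply: nat_eq; apply: key; lra.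
have {}sumA : \sum_(k < m) (pr (ltnW n2) h (A (k, false)) + pr (ltnW n2) h (A (k, true))) <= 1.
  apply: le_trans sumA; rewrite le_eqVlt; apply/orP; left; apply/eqP.
  rewrite [RHS](eq_bigr (fun j => pr (ltnW n2) h (A (j.1, j.2)))); last by case.
  rewrite -(pair_big xpredT xpredT (fun k b => pr (ltnW n2) h (A (k, b)))) /=.
  by apply: eq_bigr => k _; rewrite big_bool/= addrC.
(* In the sum of the [m] hypotheses the translates have total probability at most 1; division by [m]
   gives [M / (2 m)]. *)
have : \sum_(k < m) mass n2 v x <= \sum_(k < m) (e + M / 2 *
    (pr (ltnW n2) h (A (k, false)) + pr (ltnW n2) h (A (k, true)))).
  by apply: ler_sum => k _; apply: H; rewrite ltn_ord.
have cst (y : R) : \sum_(k < m) y = y * m%:R by rewrite sumr_const card_ord mulr_natr.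
rewrite big_split /= !cst -mulr_sumr => H'.
rewrite -(ler_pM2r m0'); apply: (le_trans H'); rewrite mulrDl lerD2l.
apply: (@le_trans _ _ (M / 2)); first by rewrite ler_piMr// divr_ge0.
by rewrite le_eqVlt; apply/orP; left; apply/eqP; field; rewrite gt_eqF.
Qed.

Lemma shift_ball (y a x : R) : `|y| <= x -> `|(y + a) + - a| <= x /\ `|(y - a) + a| <= x.
Proof. by rewrite addrK subrK. Qed.

Lemma local_spread : exists2 delta : R, 0 < delta & forall n (n2 : (1 < n)%N) (v : vertex n),
  v != origin (ltnW n2) -> mass n2 v delta <= 1 / 2.
Proof.
pose M := expR (8 * C * d0 ^+ 2).
have M0 : 0 < M by exact: expR_gt0.
(* With [m > 2 M] the term [M / (2 m)] is at most [1 / 4], and [x] is such that the farthest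
   translate, [3 m x], equals [d0]. *)
pose m := (Num.truncn (2 * M)).+1.
have mM : 2 * M < m%:R by exact: truncnS_gt.
have m0 : 0 < m%:R :> R by rewrite ltr0n.
pose x := d0 / (3 * m%:R).
have x0 : 0 < x by rewrite divr_gt0// mulr_gt0.
exists x => // n n2 v vo.
have main : mass n2 v x <= 4 * theta ^+ 2 + M / (2 * m%:R).
  apply: mass_le => //; first exact: ltW.
  move=> k /andP[k0 km].
  have t0 : 0 <= 3 * k%:R * x by rewrite mulr_ge0 ?(ltW x0)// mulr_ge0.
  have td : 3 * k%:R * x <= d0.
    apply: (@le_trans _ _ (3 * m%:R * x)).
      by apply: ler_wpM2r; [exact: ltW|rewrite ler_pM2l// ler_nat].
    by rewrite /x le_eqVlt; apply/orP; left; apply/eqP; field; rewrite gt_eqF.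
  have := @mw_local R n (ltnW n2) h h0 h1 C d0 sp v (3 * k%:R * x) _ _ _ vo _ (jset_ball v x)
    (jset_ball_shift v (- (3 * k%:R * x)) x) (jset_ball_shift v (3 * k%:R * x) x) _.
  rewrite ger0_norm// => /(_ td) H; apply: le_trans (H _) _.
    by move=> phi; rewrite /= eqxx; exact: shift_ball.
  rewrite lerD2l; apply: ler_wpM2r.
    by apply: addr_ge0; apply: (pr_ge0 _ sp); exact: jset_ball_shift.
  apply: ler_wpM2r => //; rewrite /M ler_expR; apply: ler_wpM2l; first by rewrite mulr_ge0.
  by rewrite lerXn2r// nnegrE// ltW.
apply: (le_trans main).
have : M / (2 * m%:R) <= 1 / 4 by rewrite ler_pdivrMr ?mulr_gt0//; lra.
have -> : 4 * theta ^+ 2 = 1 / 256 by field.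
lra.
Qed.

End Claims.

(** [q + 2] is the integer part of the logarithm of the norm in base 4, so the box of radius
    [2 * 4 ^ q] around [v] misses the origin; the threshold 64 ensures [q >= 1]. *)
Lemma scale_exists {R : realType} n (n2 : (1 < n)%N) (v : vertex n) : (64 <= l1norm v)%N ->
  exists q, [/\ (0 < q)%N, ~~ nearby v (2 ^ (2 * q).+1) (origin (ltnW n2)),
    ln (1 + (l1norm v)%:R : R) <= 12 * q%:R & (l1norm v <= 64 * 4 ^ q)%N].
Proof.
move=> s64; set s := l1norm v in s64 *.
have s0 : (0 < s)%N by apply: leq_trans s64.
have /andP[lo hi] := @trunc_log_bounds 4 s isT s0.
have t3 : (3 <= trunc_log 4 s)%N by apply: trunc_log_max.
move: (trunc_log 4 s) t3 lo hi => t t3 lo hi.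
have [q [tq q0]] : exists q, t = (q + 2)%N /\ (0 < q)%N by exists (t - 2)%N; split; lia.
subst t; exists q; split => //.
- apply: far_origin; apply: leq_trans lo.
  rewrite -expnS (_ : (2 * q).+2 = 2 * q.+1)%N; last lia.
  by rewrite expnM addn2 ltn_exp2l.
- apply: (@le_trans _ _ (3 * (q + 3)%:R)); first by apply: ln_nat_le; rewrite add1n addnS.
  by rewrite natrD; have : 1 <= q%:R :> R; [rewrite ler1n|lra].
- by rewrite -[64%N]/(4 ^ 3)%N -expnD addnC ltnW// addnS.
Qed.

Lemma sqrt_le {R : realType} (x y : R) : 0 <= y -> x <= y ^+ 2 -> Num.sqrt x <= y.
Proof. by move=> y0 xy; rewrite -(ger0_norm y0) -sqrtr_sqr; exact: ler_wsqrtr. Qed.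

(** * The tail bound *)

Section Tail.
Context {R : realType} (h h0 h1 : R -> R) (C d0 : R).
Notation theta := (32^-1 : R).
Hypothesis sp : splitting h h0 h1 (theta ^+ 2) C d0.

Let C0 : 0 <= C. Proof. exact: (sp_C sp). Qed.
Let d00 : 0 < d0. Proof. exact: (sp_d0 sp). Qed.

(** A shift by [2 x] in either direction sends [|phi v| < x] to [|phi v| >= x], so the probability
    of the complement is at most [1 / 8] plus the shift factor times the probability sought.
    Vertices of norm below 64 are covered by [spread]. *)
Lemma tail_from_spread (delta c : R) n (n2 : (1 < n)%N) (v : vertex n) (t : R) :
  (forall n (n2 : (1 < n)%N) (v : vertex n), v != origin (ltnW n2) ->
     pr (ltnW n2) h [set phi : vertex n -> R | (`|phi v| <= delta)%R] <= 1 / 2) ->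
  0 < c -> c <= 1 -> c * 72 <= delta -> c * 128 <= d0 ->
  v != origin (ltnW n2) -> 1 <= t -> t <= 1 + Num.sqrt (l1norm v)%:R ->
  1 / 4 * expR (- (400 * C * (48 * t ^+ 2))) <=
  pr (ltnW n2) h [set phi : vertex n -> R | (c * t * Num.sqrt (ln (1 + (l1norm v)%:R)) <= `|phi v|)%R].
Proof.
move=> spread c0 c1 cdelta cd vo t1 ts.
have Cp := C0; have dp := d00.
set L := ln (1 + (l1norm v)%:R); set x := c * t * Num.sqrt L.
have L0 : 0 <= L by rewrite ln_ge0// lerDl.
have x0 : 0 <= x by rewrite !mulr_ge0 ?sqrtr_ge0//; lra.
have jB : jset [set phi : vertex n -> R | (x <= `|phi v|)%R] by apply: jset_ge; exact: jmeas_norm.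
set B := [set phi | _] in jB *.
have CB : ~` B = [set phi : vertex n -> R | (`|phi v| < x)%R].
  by apply/seteqP; split => phi; rewrite /B /= ltNge => /negP.
have sumB := pr_setC (ltnW n2) sp jB.
have e0 : 0 <= 400 * C * (48 * t ^+ 2)
  by exact: (mulr_ge0 (mulr_ge0 (ler0n R 400) Cp) (mulr_ge0 (ler0n R 48) (sqr_ge0 t))).
have e1 : expR (- (400 * C * (48 * t ^+ 2))) <= 1.
  by rewrite -[leRHS]expR0 ler_expR oppr_le0.
have [s64|s64] := ltnP (l1norm v) 64.
  have xd : x <= delta.
    have t9 : t <= 9.
      apply: (le_trans ts); rewrite (_ : 9 = 1 + 8 :> R); last by ring.
      rewrite lerD2l; apply: sqrt_le => //.
      by rewrite -natrX ler_nat ltnW// (leq_trans s64).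
    have L3 : Num.sqrt L <= 3.
      apply: sqrt_le => //; apply: (@le_trans _ _ (3 * 3%:R)); last lra.
      by apply: ln_nat_le; rewrite add1n.
    have t9' : c * t <= c * 9 by rewrite ler_pM2l.
    have ct0 : 0 <= c * t by rewrite mulr_ge0 ?(ltW c0)// (le_trans ler01 t1).
    apply: (@le_trans _ _ (c * 9 * 3)); last lra.
    by apply: ler_pM; rewrite ?sqrtr_ge0.
  have : pr (ltnW n2) h (~` B) <= 1 / 2.
    apply: le_trans (spread n n2 v vo); apply: (pr_sub _ sp).
    - exact: jsetC.
    - by apply: jset_le; exact: jmeas_norm.
    - by rewrite CB => phi /= /ltW H; apply: le_trans xd.
  by move: sumB; lra.
have [q [q0 far Lq sq]] := @scale_exists R n n2 v s64.
have q1 : 1 <= q%:R :> R by rewrite ler1n.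
pose a := 2 * x.
(* With [L <= 12 q] and [t ^ 2 <= 256 * 4 ^ q] this is at most [12288 c ^ 2 q 4 ^ q], below
   [(128 c) ^ 2 q 4 ^ q]; moreover [a ^ 2 / q] is at most [48 t ^ 2]. *)
have a2 : a ^+ 2 = 4 * c ^+ 2 * t ^+ 2 * L.
  by rewrite /a /x !exprMn sqr_sqrtr//; ring.
have c2 : c ^+ 2 <= 1 by rewrite expr_le1// ltW.
have t20 : 0 <= t ^+ 2 by exact: sqr_ge0.
pose P : R := q%:R * 4 ^+ q; have P0 : 0 <= P by rewrite mulr_ge0// exprn_ge0.
have t2 : t ^+ 2 <= 256 * 4 ^+ q.
  have s1 : 1 <= Num.sqrt (l1norm v)%:R :> R.
    by rewrite -{1}sqrtr1; apply: ler_wsqrtr; rewrite ler1n; apply: leq_trans s64.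
  apply: (@le_trans _ _ ((2 * Num.sqrt (l1norm v)%:R) ^+ 2)).
    have ts2 : t <= 2 * Num.sqrt (l1norm v)%:R by lra.
    by rewrite lerXn2r// nnegrE ?(le_trans ler01 t1)// mulr_ge0 ?sqrtr_ge0.
  rewrite exprMn sqr_sqrtr// (_ : 256 * 4 ^+ q = 2 ^+ 2 * (64 * 4 ^ q)%:R); last first.
    by rewrite natrM natrX; ring.
  by rewrite ler_pM2l ?ler_nat// exprn_gt0.
have ad : a ^+ 2 <= d0 ^+ 2 * P.
  have tL : t ^+ 2 * L <= 256 * 12 * P.
    apply: (@le_trans _ _ (256 * 4 ^+ q * (12 * q%:R))); first exact: ler_pM.
    by rewrite le_eqVlt /P; apply/orP; left; apply/eqP; ring.
  have cd2 : (c * 128) ^+ 2 <= d0 ^+ 2 by rewrite lerXn2r// nnegrE ?mulr_ge0 ?(ltW c0) ?(ltW dp).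
  apply: (@le_trans _ _ (4 * c ^+ 2 * (256 * 12 * P))).
    by rewrite a2 -mulrA; apply: ler_wpM2l tL; rewrite mulr_ge0 ?sqr_ge0.
  rewrite mulrA; apply: ler_wpM2r => //.
  have : 0 <= c ^+ 2 by exact: sqr_ge0.
  by move: cd2; rewrite exprMn; lra.
have HA (tau phi : vertex n -> R) : tau v = a ->
    (forall w, ~~ nearby v (2 ^ (2 * q).+1) w -> tau w = 0) -> (~` B) phi ->
    B (fun w => phi w + tau w) /\ B (fun w => phi w - tau w).
  move=> tv _; rewrite CB /B /= tv /a ltr_norml => /andP[H1 H2].
  by split; rewrite ler_normr; apply/orP; [left|right]; lra.
have := mw_scale sp q0 far ad (jsetC jB) jB jB HA.
have Q := @quarter_pow2 R q q0.
have aq : 400 * C * a ^+ 2 / q%:R <= 400 * C * (48 * t ^+ 2).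
  rewrite ler_pdivrMr ?ltr0n// (_ : 400 * C * (48 * t ^+ 2) * q%:R = 400 * C * (4 * 1 * t ^+ 2 * (12 * q%:R))); last by ring.
  apply: ler_wpM2l; first exact: (mulr_ge0 (ler0n R 400) Cp).
  rewrite a2; apply: ler_pM => //; first exact: (mulr_ge0 (mulr_ge0 (ler0n R 4) (sqr_ge0 c)) (sqr_ge0 t)).
  by apply: ler_wpM2r => //; rewrite ler_pM2l.
set E := expR (400 * C * (48 * t ^+ 2)) => H.
have E1 : 1 <= E by rewrite -[leLHS]expR0 ler_expR.
have p0 := pr_ge0 (ltnW n2) sp jB.
have Hle : pr (ltnW n2) h (~` B) <= 1 / 8 + E * pr (ltnW n2) h B.
  apply: (le_trans H); apply: lerD.
    by rewrite (_ : 1 / 8 = 2 * 16^-1); [rewrite ler_pM2l|field].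
  have YE : expR (400 * C * a ^+ 2 / q%:R) <= E by rewrite ler_expR.
  apply: le_trans (ler_wpM2r p0 YE); rewrite le_eqVlt; apply/orP; left; apply/eqP; by field.
have E0 : 0 < E by exact: lt_le_trans ltr01 E1.
have pE : pr (ltnW n2) h B <= E * pr (ltnW n2) h B by rewrite ler_peMl.
by rewrite expRN -/E -[1 / 4 * _]/(1 / 4 / E) ler_pdivrMr//; lra.
Qed.

End Tail.

(** * The small ball bound *)

Section SmallBall.
Context {R : realType} (h h0 h1 : R -> R) (C d0 : R).
Notation theta := (32^-1 : R).
Hypothesis sp : splitting h h0 h1 (theta ^+ 2) C d0.

Let C0 : 0 <= C. Proof. exact: (sp_C sp). Qed.
Let d00 : 0 < d0. Proof. exact: (sp_d0 sp). Qed.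

Lemma pr_le1 n (n0 : (0 < n)%N) (A : set (vertex n -> R)) : jset A -> pr n0 h A <= 1.
Proof.
move=> jA; rewrite -(pr_setC n0 sp jA) lerDl; apply: (pr_ge0 _ sp); exact: jsetC.
Qed.

(** About [1 / delta] disjoint translates fit within distance [3 sqrt L], at a cost bounded
    independently of [v] because [L <= 12 q]. The Peierls error is at most of order
    [1 / q <= 12 / L <= 12 delta]. *)
Lemma small_ball : exists2 K : R, 1 <= K & forall n (n2 : (1 < n)%N) (v : vertex n) (delta : R),
  (0 < l1norm v)%N -> 1 / Num.sqrt (ln (1 + (l1norm v)%:R)) <= delta -> delta <= 1 ->
  pr (ltnW n2) h [set phi : vertex n -> R | (`|phi v| <= delta * Num.sqrt (ln (1 + (l1norm v)%:R)))%R]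
    <= K * delta.
Proof.
have Cp := C0; have dp := d00.
have d2 : 0 < d0 ^+ 2 by rewrite exprn_gt0.
(* For [q > b] the bound [a ^ 2 <= 9 L <= 108 q] meets the gradient condition; for [q <= b] the
   logarithm [L] is bounded, hence [delta] is bounded below and the claim is trivial. *)
pose b := (Num.truncn (108 / d0 ^+ 2)).+1.
have bd : 108 <= d0 ^+ 2 * b%:R.
  by rewrite mulrC -ler_pdivrMr// ltW// truncnS_gt.
pose M := expR (400 * C * 108).
have M0 : 0 < M by exact: expR_gt0.
have b1 : 1 <= b%:R :> R by rewrite ler1n.
exists (24 + M + 12 * b%:R); first lra.
move=> n n2 v delta s0; set L := ln (1 + (l1norm v)%:R) => Ldelta delta1.
have L0 : 0 < L by rewrite ln_gt0// ltrDl ltr0n.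
have rL0 : 0 < Num.sqrt L by rewrite sqrtr_gt0.
have LL : Num.sqrt L ^+ 2 = L by rewrite sqr_sqrtr// ltW.
have delta0 : 0 < delta by apply: lt_le_trans Ldelta; rewrite divr_gt0.
have Ld : 1 <= delta * Num.sqrt L by rewrite -ler_pdivrMr.
set x := delta * Num.sqrt L in Ld *.
have x0 : 0 < x by lra.
have jA : jset [set phi : vertex n -> R | (`|phi v| <= x)%R] by apply: jset_ball.
have small : L <= 12 * b%:R -> pr (ltnW n2) h [set phi : vertex n -> R | (`|phi v| <= x)%R] <=
    (24 + M + 12 * b%:R) * delta.
  move=> Lb; apply: (le_trans (pr_le1 _ jA)); apply: (le_trans Ld).
  rewrite /x mulrC; apply: ler_wpM2r; first exact: ltW.
  apply: sqrt_le; first lra.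
  by apply: (le_trans Lb); nra.
have [s64|s64] := ltnP (l1norm v) 64.
  apply: small; apply: (@le_trans _ _ (3 * 3%:R)); last lra.
  by apply: ln_nat_le; rewrite add1n.
have [q [q0 far Lq _]] := @scale_exists R n n2 v s64.
rewrite -/L in Lq.
have [bq|bq] := leqP q b.
  by apply: small; apply: (le_trans Lq); rewrite ler_pM2l// ler_nat.
have q0' : 0 < q%:R :> R by rewrite ltr0n.
have dq : 108 <= d0 ^+ 2 * 4 ^+ q.
  apply: (le_trans bd); rewrite ler_pM2l// -natrX ler_nat; apply: (leq_trans (ltnW bq)).
  by rewrite ltnW// ltn_expl.
pose m := Num.truncn delta^-1.
have di1 : 1 <= delta^-1 by rewrite invf_ge1.
have md : m%:R <= delta^-1 by rewrite truncn_le// ltW// invr_gt0.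
have m1 : (0 < m)%N by rewrite truncn_gt0.
have m1' : 1 <= m%:R :> R by rewrite ler1n.
have md' : delta^-1 < m%:R + 1 by rewrite natr1 truncnS_gt.
have main : pr (ltnW n2) h [set phi : vertex n -> R | (`|phi v| <= x)%R] <=
    2 * (4^-1) ^+ (2 ^ q) + M / (2 * m%:R).
  apply: (mass_le sp) => //; first exact: ltW.
  move=> k /andP[k0 km]; pose a := 3 * k%:R * x.
  have kd : k%:R * delta <= 1.
    by rewrite -ler_pdivlMr// div1r; apply: le_trans md; rewrite ler_nat.
  have a2 : a ^+ 2 <= 9 * L.
    have -> : a ^+ 2 = 9 * (k%:R * delta) ^+ 2 * L by rewrite -LL /a /x; ring.
    apply: ler_wpM2r; first exact: ltW.
    rewrite -[leRHS]mulr1; apply: ler_wpM2l => //; apply: exprn_ile1 => //.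
    by rewrite mulr_ge0// ltW.
  have a2q : a ^+ 2 <= 108 * q%:R by lra.
  have ad : a ^+ 2 <= d0 ^+ 2 * (q%:R * 4 ^+ q).
    apply: (le_trans a2q); rewrite (_ : _ * _ = d0 ^+ 2 * 4 ^+ q * q%:R); last by ring.
    by apply: ler_wpM2r => //; exact: ltW.
  have HA (tau phi : vertex n -> R) : tau v = a ->
      (forall w, ~~ nearby v (2 ^ (2 * q).+1) w -> tau w = 0) ->
      [set phi : vertex n -> R | (`|phi v| <= x)%R] phi ->
      [set phi : vertex n -> R | (`|phi v + - a| <= x)%R] (fun w => phi w + tau w) /\
      [set phi : vertex n -> R | (`|phi v + a| <= x)%R] (fun w => phi w - tau w).
    by move=> tv _ /=; rewrite tv; exact: shift_ball.
  have H := mw_scale sp q0 far ad jA (jset_ball_shift v (- a) x) (jset_ball_shift v a x) HA.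
  apply: (le_trans H); rewrite lerD2l; apply: ler_wpM2r.
    by apply: addr_ge0; apply: (pr_ge0 _ sp); exact: jset_ball_shift.
  apply: ler_wpM2r => //; rewrite ler_expR ler_pdivrMr// -[leRHS]mulrA.
  by apply: ler_wpM2l a2q; exact: (mulr_ge0 (ler0n R 400) Cp).
apply: (le_trans main).
have eq1 : (4^-1 : R) ^+ (2 ^ q) <= 12 * delta.
  apply: (le_trans (quarter_pow _)).
  apply: (@le_trans _ _ q%:R^-1).
    by rewrite exprVn lef_pV2 ?posrE ?exprn_gt0// -natrX ler_nat ltnW// ltn_expl.
  have Ld2 : 1 <= delta * L.
    have : 1 <= x * x by nra.
    rewrite (_ : x * x = delta * (delta * L)); last by rewrite -LL /x; ring.
    by nra.
  by rewrite -div1r ler_pdivrMr//; nra.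
have eq2 : M / (2 * m%:R) <= M * delta.
  apply: ler_wpM2l; first exact: ltW.
  rewrite -[leRHS]invrK lef_pV2 ?posrE ?invr_gt0//; lra.
have : 0 <= 12 * b%:R * delta by rewrite mulr_ge0 ?(ltW delta0)//; lra.
by lra.
Qed.
End SmallBall.

Lemma l1norm_far n (n2 : (1 < n)%N) (v : vertex n) : nat_of_ord v.2 = (2 * n).-1 ->
  (n <= l1norm v)%N.
Proof.
move=> v2; rewrite /l1norm; apply: leq_trans (leq_addl _ _).
rewrite -(cdist_origin n2) /cdist /off v2 val_insubd.
have -> : (n.-1 < 2 * n)%N by lia.
rewrite ifN; lia.
Qed.

(** The centers lie on the line where the second coordinate is [n], spaced by twice the radius.
    Together they need length [4 ^ (2 q + 1) <= n], at most half of the cycle, so they are separated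
    around it as well. *)
Lemma separated_centers n (n2 : (1 < n)%N) : (64 <= n)%N ->
  exists q (vc : 'I_(4 ^ q) -> vertex n), [/\ (0 < q)%N, (n < 4 ^ (2 * q + 3))%N,
    forall i, ~~ nearby (vc i) (2 ^ (2 * q).+1) (origin (ltnW n2)) &
    forall i j, i != j -> ~~ nearby (vc i) (2 ^ (2 * q).+1) (vc j)].
Proof.
move=> n64.
have n1 : (0 < n)%N by exact: ltnW.
have /andP[lo hi] := @trunc_log_bounds 4 n isT n1.
have t3 : (3 <= trunc_log 4 n)%N by apply: trunc_log_max.
move: (trunc_log 4 n) t3 lo hi => t t3 lo hi.
pose q := (t.-1)./2.
have [q0 qt tq] : [/\ (0 < q)%N, (2 * q + 1 <= t)%N & (t.+1 <= 2 * q + 3)%N].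
  by rewrite /q; have := odd_double_half t.-1; case: (odd _) => /=; rewrite -muln2 => ?; split; lia.
have {}hi : (n < 4 ^ (2 * q + 3))%N by apply: (leq_trans hi); rewrite leq_exp2l.
have {lo} lo : (4 ^ (2 * q + 1) <= n)%N by apply: leq_trans lo; rewrite leq_exp2l.
pose r := (2 ^ (2 * q).+1)%N.
have r0 : (0 < r)%N by rewrite expn_gt0.
have rE : (2 * r = 4 ^ q.+1)%N by rewrite /r -expnS (_ : 4 = 2 ^ 2)%N// -expnM; congr (2 ^ _)%N; lia.
have mr : (4 ^ q * (2 * r) <= n)%N by rewrite rE -expnD; apply: leq_trans lo; rewrite leq_exp2l//; lia.
have r2n : (2 * r < n)%N.
  by apply: leq_trans lo; rewrite rE ltn_exp2l//; lia.
pose vc (i : 'I_(4 ^ q)) : vertex n :=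
  (insubd (origin0 (ltnW n2)) (i * (2 * r))%N, insubd (origin0 (ltnW n2)) (2 * n).-1).
have iD (i : 'I_(4 ^ q)) : (i * (2 * r) + 2 * r <= n)%N.
  by apply: leq_trans mr; rewrite -mulSnr leq_mul2r ltn_ord orbT.
have vc1 i : nat_of_ord (vc i).1 = (i * (2 * r))%N.
  by rewrite val_insubd; have := iD i; move: (i * _)%N => z; case: ifP => //; lia.
have vc2 i : nat_of_ord (vc i).2 = (2 * n).-1.
  by rewrite val_insubd; case: ifP => //; lia.
exists q, vc; split => // [i|i j ij].
  by apply: far_origin; apply: leq_trans (l1norm_far n2 (vc2 i)).
rewrite /nearby -/r negb_and; apply/orP; left; rewrite -ltnNge /cdist /off !vc1.
have := iD i; have := iD j.
have : (i * (2 * r) + 2 * r <= j * (2 * r))%N \/ (j * (2 * r) + 2 * r <= i * (2 * r))%N.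
  move: ij; rewrite -val_eqE /= neq_ltn => /orP[] H; [left|right];
    by rewrite -mulSnr leq_mul2r H orbT.
move: (i * _)%N (j * _)%N => a b.
by clearbody r; clear -r0 r2n; case: ifP; lia.
Qed.

(** * The maximum of the surface *)

Section Maximum.
Context {R : realType} (h h0 h1 : R -> R) (C d0 : R).
Notation theta := (32^-1 : R).
Hypothesis sp : splitting h h0 h1 (theta ^+ 2) C d0.

Let C0 : 0 <= C. Proof. exact: (sp_C sp). Qed.
Let d00 : 0 < d0. Proof. exact: (sp_d0 sp). Qed.

Lemma expR_half_le2 (q : nat) : expR (q%:R / 2) <= 2 ^+ q :> R.
Proof.
rewrite mulrC expRM_natr; apply: lerXn2r; rewrite ?nnegrE ?expR_ge0//.
have := expR_ge1Dx (- 2^-1 : R); have := expR_gt0 (2^-1 : R).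
rewrite expRN => e0; rewrite -[leRHS]div1r ler_pdivlMr//; lra.
Qed.

(* For well separated centers [v_i], shifting near [v_i] turns the event that all
   fields are small into one of disjoint events, that only [phi (v_i)] is large. *)
Lemma max_small_le n (n2 : (1 < n)%N) q (vc : 'I_(4 ^ q) -> vertex n) (x : R) :
  (0 < q)%N -> 0 < x ->
  (forall i, ~~ nearby (vc i) (2 ^ (2 * q).+1) (origin (ltnW n2))) ->
  (forall i j, i != j -> ~~ nearby (vc i) (2 ^ (2 * q).+1) (vc j)) ->
  (2 * x) ^+ 2 <= d0 ^+ 2 * (q%:R * 4 ^+ q) ->
  400 * C * (2 * x) ^+ 2 / q%:R <= q%:R / 2 ->
  pr (ltnW n2) h [set phi : vertex n -> R | (\big[Num.max/0%R]_(w : vertex n) `|phi w| < x)%R] <= 1 / 2.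
Proof.
move=> q0 x0 far sep ad aq.
pose sg (b : bool) (y : R) := if b then y else - y.
pose D (j : 'I_(4 ^ q) * bool) : set (vertex n -> R) :=
  [set phi | (x < sg j.2 (phi (vc j.1)))%R] `&`
  [set phi | (\big[Num.max/0%R]_(i | i != j.1) `|phi (vc i)| < x)%R].
have jD j : jset (D j).
  apply: jsetI; last by apply: jset_lt; apply: jmeas_bigmax => i; exact: jmeas_norm.
  apply: jset_gt; case: j.2 => //=; first exact: jmeas_coord.
  by move=> d X y my; apply: measurableT_comp => //; exact: my.
set A := [set phi | _].
have jA : jset A by apply: jset_lt; apply: jmeas_bigmax => i; exact: jmeas_norm.
have sg_norm b y : sg b y <= `|y| by case: b; rewrite /sg ?ler_norm// -normrN ler_norm.
have sumD : \sum_j pr (ltnW n2) h (D j) <= 1.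
  apply: (pr_sum _ sp) => // phi; apply: sum_indic_le1 => -[i b] [j c] [/= Di _] [/= Dj].
  have [ij _|ij] := eqVneq i j.
    by subst j; move: Di Dj; case: b; case: c => //; rewrite /sg /= => l1 l2; exfalso; lra.
  move/bigmax_ltP => [_ /(_ i ij)] Hi; exfalso.
  by have := lt_le_trans Di (sg_norm b _); lra.
have step1 i : pr (ltnW n2) h A <= 1 / 8 + 2 ^+ q / 2 * (pr (ltnW n2) h (D (i, true)) + pr (ltnW n2) h (D (i, false))).
  have HA (t phi : vertex n -> R) : t (vc i) = 2 * x ->
      (forall w, ~~ nearby (vc i) (2 ^ (2 * q).+1) w -> t w = 0) -> A phi ->
      D (i, true) (fun w => phi w + t w) /\ D (i, false) (fun w => phi w - t w).
    move=> tv t0 /bigmax_ltP[_ Hphi]; split; (split => /=;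
      [have := Hphi (vc i) isT; rewrite tv ltr_norml => /andP[? ?]; lra
      |apply/bigmax_ltP; split => // j ji; rewrite t0 ?addr0 ?subr0; [exact: Hphi|by apply: sep; rewrite eq_sym]]).
  have H := mw_scale sp q0 (far i) ad jA (jD _) (jD _) HA.
  apply: (le_trans H); apply: lerD; first by have := @quarter_pow2 R q q0; lra.
  apply: ler_wpM2r; first by apply: addr_ge0; apply: (pr_ge0 _ sp).
  apply: ler_wpM2r => //; apply: le_trans (expR_half_le2 q); by rewrite ler_expR.
(* Averaging over the centers: the target events are disjoint and each shift costs at most [2 ^ q],
   so the average is at most [1 / 8 + 2 ^ q / (2 * 4 ^ q) <= 3 / 8]. The number of centers is what
   allows a height of order [q] rather than its square root. *)
have cst (y : R) : \sum_(k < 4 ^ q) y = y * 4 ^+ q by rewrite sumr_const card_ord -natrX mulr_natr.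
have : \sum_(i < 4 ^ q) pr (ltnW n2) h A <= \sum_(i < 4 ^ q)
    (1 / 8 + 2 ^+ q / 2 * (pr (ltnW n2) h (D (i, true)) + pr (ltnW n2) h (D (i, false)))).
  by apply: ler_sum => i _; exact: step1.
rewrite big_split /= !cst -mulr_sumr.
have -> : \sum_(i < 4 ^ q) (pr (ltnW n2) h (D (i, true)) + pr (ltnW n2) h (D (i, false))) = \sum_j pr (ltnW n2) h (D j).
  rewrite [RHS](eq_bigr (fun j => pr (ltnW n2) h (D (j.1, j.2)))); last by case.
  rewrite -(pair_big xpredT xpredT (fun k b => pr (ltnW n2) h (D (k, b)))) /=.
  by apply: eq_bigr => k _; rewrite big_bool.
have -> : 4 ^+ q = 2 ^+ q * 2 ^+ q :> R by rewrite -exprMn; congr (_ ^+ _); ring.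
have : 2 <= 2 ^+ q :> R by rewrite -[leLHS]expr1 ler_weXn2l// ler1n.
move: sumD; move: (\sum_j _) (pr _ _ A) (2 ^+ q : R) => S p y S1 y2 H.
rewrite -(@ler_pM2r _ (y * y)); last by rewrite mulr_gt0; lra.
apply: (le_trans H); have : y / 2 * S <= y / 2 by rewrite ler_piMr//; lra.
nra.
Qed.

Lemma max_lb (delta c : R) n (n2 : (1 < n)%N) :
  (forall n (n2 : (1 < n)%N) (v : vertex n), v != origin (ltnW n2) ->
     pr (ltnW n2) h [set phi : vertex n -> R | (`|phi v| <= delta)%R] <= 1 / 2) ->
  0 < c -> c * 72 <= delta -> c * 128 <= d0 -> 30 * c * (30 * (1 + C)) <= 1 ->
  1 / 2 <= pr (ltnW n2) h
    [set phi : vertex n -> R | (c * ln n%:R <= \big[Num.max/0%R]_(w : vertex n) `|phi w|)%R].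
Proof.
move=> spread c0 cdelta cd cC.
have Cp := C0; have dp := d00.
set x := c * ln n%:R.
have ln0 : 0 < ln n%:R :> R by rewrite ln_gt0// ltr1n.
have x0 : 0 < x by rewrite mulr_gt0.
have jB : jset [set phi : vertex n -> R | (x <= \big[Num.max/0%R]_(w : vertex n) `|phi w|)%R].
  by apply: jset_ge; apply: jmeas_bigmax => i; exact: jmeas_norm.
set B := [set phi | _] in jB *.
have CB : ~` B = [set phi : vertex n -> R | (\big[Num.max/0%R]_(w : vertex n) `|phi w| < x)%R].
  by apply/seteqP; split => phi; rewrite /B /= ltNge => /negP.
have sumB := pr_setC (ltnW n2) sp jB.
suff : pr (ltnW n2) h (~` B) <= 1 / 2 by lra.
have [n64|n64] := ltnP n 64.
  have xd : x <= delta.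
    apply: le_trans cdelta; rewrite ler_pM2l//.
    have := @ln_le_sub1 R n%:R; rewrite ltr0n (ltnW n2) => /(_ isT) H.
    by apply: (le_trans H); rewrite lerBlDr natr1 ler_nat; apply: ltnW; apply: leq_trans n64 _.
  have N0 : ((2 * n).-1 < 2 * n)%N by rewrite ltn_predL muln_gt0 (ltnW n2).
  pose v : vertex n := (Ordinal N0, Ordinal N0).
  have vo : v != origin (ltnW n2).
    apply/eqP => vE; have := @l1norm_far n n2 v erefl.
    by rewrite vE (l1norm_origin n2) leqNgt (ltnW n2).
  apply: le_trans (spread n n2 v vo); apply: (pr_sub _ sp).
  - exact: jsetC.
  - by apply: jset_le; exact: jmeas_norm.
  - by rewrite CB => phi /= /bigmax_ltP[_ /(_ v isT)] H; apply: ltW; apply: lt_le_trans xd.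
have [q [vc [q0 nq far sep]]] := @separated_centers n n2 n64.
have q1 : 1 <= q%:R :> R by rewrite ler1n.
(* [n < 4 ^ (2 q + 3)] gives [ln n <= 3 (2 q + 3) <= 15 q]. *)
have xq : 2 * x <= 30 * c * q%:R.
  have ln15 : ln n%:R <= 15 * q%:R :> R.
    apply: (@le_trans _ _ (ln (1 + n%:R))); first by rewrite ler_ln ?posrE ?ltr0n ?(ltnW n2)//; lra.
    apply: (@le_trans _ _ (3 * (2 * q + 3)%:R)); first by apply: ln_nat_le; rewrite add1n.
    by rewrite natrD natrM; lra.
  have : x <= c * (15 * q%:R) by rewrite ler_pM2l.
  by lra.
have x2 : (2 * x) ^+ 2 <= (30 * c * q%:R) ^+ 2.
  by apply: lerXn2r => //; rewrite nnegrE; lra.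
rewrite CB; apply: (@max_small_le n n2 q vc) => //.
- apply: (le_trans x2); rewrite exprMn expr2 [X in _ * X]expr2.
  apply: ler_pM.
  + by rewrite mulr_ge0; lra.
  + by rewrite mulr_ge0.
  + by rewrite -expr2; apply: lerXn2r; rewrite ?nnegrE; lra.
  + apply: ler_wpM2l => //; rewrite -natrX ler_nat ltnW// ltn_expl//.
- rewrite ler_pdivrMr ?ltr0n//; apply: (@le_trans _ _ (400 * C * (30 * c * q%:R) ^+ 2)).
    by apply: ler_wpM2l x2; exact: (mulr_ge0 (ler0n R 400) Cp).
  (* The choice of [c] gives [900 C g ^ 2 <= 1], hence [400 C g ^ 2 <= 1 / 2]: the exponent stays
     below [q / 2]. *)
  set g := 30 * c in cC *.
  have g0 : 0 < g by rewrite mulr_gt0.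
  have gle : 30 * g <= 1 by nra.
  have Cg : 30 * (C * g) <= 1 by nra.
  have Cgg : 900 * (C * g * g) <= 1.
    have Cg0 : 0 <= C * g by rewrite mulr_ge0// ltW.
    have : (30 * (C * g)) * (30 * g) <= 1 by apply: mulr_ile1 => //; lra.
    by lra.
  rewrite exprMn (_ : _ * _ = 400 * (C * g * g) * q%:R ^+ 2); last by ring.
  rewrite (_ : _ / 2 * _ = 2^-1 * q%:R ^+ 2); last by field.
  by apply: ler_wpM2r; [exact: sqr_ge0|lra].
Qed.

End Maximum.

Theorem theorem1p1 (R : realType) (U : R -> \bar R)
  (U_meas : measurable_fun [set: R] U)
  (U_sym : forall x, U (- x) = U x)
  (U_inf : exists m : R, forall x, (m%:E <= U x)%E)
  (U_int : (0 < \int[@lebesgue_measure R]_x expeR (- U x))%E /\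
           (\int[@lebesgue_measure R]_x expeR (- U x) < +oo)%E)
  (U_reg : (exists u : R -> R, (forall x, U x = (u x)%:E) /\ C2_on [set: R] u)
        \/ (exists K : R, 0 < K /\ (forall x, K < `|x| -> U x = +oo%E) /\
              exists u : R -> R, (forall x, `|x| < K -> U x = (u x)%:E) /\
                                 C2_on [set x | `|x| < K] u)) :
  exists C c : R, 0 < C /\ 0 < c /\
  forall n : nat, (2 <= n)%N ->
    (forall v : vertex n, (ln (n%:R : R)) ^+ 2 <= (l1norm v)%:R ->
      [/\ (Varmu U v >= (c * ln (1 + (l1norm v)%:R))%:E)%E,
          (forall delta : R, 1 / Num.sqrt (ln (1 + (l1norm v)%:R)) <= delta ->
             (Pmu U [set phi : vertex n -> R | (`|phi v| <= delta * Num.sqrt (ln (1 + (l1norm v)%:R)))%R]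
                <= (C * powR delta (2 / 3))%:E)%E) &
          (forall t : R, 1 <= t ->
             t <= (1 + Num.sqrt (l1norm v)%:R) / (1 + ln (n%:R : R)) ->
             (Pmu U [set phi : vertex n -> R | (c * t * Num.sqrt (ln (1 + (l1norm v)%:R)) <= `|phi v|)%R]
                >= (c * expR (- (C * t ^+ 2)))%:E)%E)])
    /\ (Pmu U [set phi : vertex n -> R | (c * ln (n%:R : R) <= \big[Num.max/0%R]_(w : vertex n) `|phi w|)%R]
          >= (1 / 2)%:E)%E.
Proof.
have eps01 : 0 < (32^-1 : R) ^+ 2 <= 1.
  by rewrite exprn_gt0 ?invr_gt0//= exprn_ile1// invf_le1// ler1n.
have [h0 [h1 [C [d0 sp]]]] := regular_splitting U_meas U_sym U_inf U_int eps01 U_reg.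
have C0 := sp_C sp; have d00 := sp_d0 sp.
have [r r0 spread] := local_spread sp.
have [K K1 ball] := small_ball sp.
pose A := 400 * C * 48.
have A0 : 0 <= A by exact: (mulr_ge0 (mulr_ge0 (ler0n R 400) C0) (ler0n R 48)).
have [c [c0 c4 cr cd cC]] : exists c, [/\ 0 < c, c <= 1 / 4, c * 72 <= r, c * 128 <= d0
    & 30 * c * (30 * (1 + C)) <= 1].
  have C1 : 0 < 30 * (30 * (1 + C)) by lra.
  exists (Num.min (Num.min (1 / 4) (r / 72)) (Num.min (d0 / 128) ((30 * (30 * (1 + C)))^-1))).
  split; rewrite ?lt_min.
  - by rewrite !divr_gt0//= invr_gt0.
  - by rewrite !ge_min lexx.
  - by rewrite -ler_pdivlMr// !ge_min lexx orbT.
  - by rewrite -ler_pdivlMr// !ge_min lexx !orbT.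
  - set m := Num.min _ _.
    have : m <= (30 * (30 * (1 + C)))^-1 by rewrite /m !ge_min lexx !orbT.
    by rewrite -[_^-1]div1r ler_pdivlMr//; lra.
have eA0 := expR_gt0 (- A).
have eA1 : expR (- A) <= 1 by rewrite -[leRHS]expR0 ler_expR oppr_le0.
(* At [t = 1] the tail bound gives probability at least [exp (- A) / 4] at height [c sqrt L], and
   Chebyshev's inequality yields this constant for the variance. It is also at most [1 / 4], the
   prefactor of the general tail bound. *)
pose c' := c * c / 4 * expR (- A).
have c'0 : 0 < c' by rewrite !mulr_gt0.
have c'c : c' <= c by rewrite /c'; nra.
have [c'1 c'r c'd] : [/\ c' <= 1, c' * 72 <= r & c' * 128 <= d0] by split; lra.
have c'C : 30 * c' * (30 * (1 + C)) <= 1.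
  by apply: le_trans cC; apply: ler_wpM2r; lra.
exists (K + A), c'; split; [lra|split => //] => n n2.
split; last first.
  rewrite (PmuE U_sym U_inf sp n2) ?lee_fin.
    by apply: (max_lb sp n2 spread).
  by apply: jset_ge; apply: jmeas_bigmax => i; exact: jmeas_norm.
move=> v vn.
have ln0 : 0 < ln n%:R :> R by rewrite ln_gt0// ltr1n.
have s0 : (0 < l1norm v)%N by rewrite -(ltr0n R); apply: lt_le_trans vn; rewrite exprn_gt0.
have vo : v != origin (ltnW n2).
  by apply/eqP => vE; move: s0; rewrite vE l1norm_origin.
have L0 : 0 < ln (1 + (l1norm v)%:R) :> R by rewrite ln_gt0// ltrDl ltr0n.
have rs0 : 0 <= Num.sqrt (l1norm v)%:R :> R by exact: sqrtr_ge0.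
split.
- have x0 : 0 <= c * 1 * Num.sqrt (ln (1 + (l1norm v)%:R)).
    by rewrite !mulr_ge0 ?sqrtr_ge0// ltW.
  apply: le_trans (Varmu_lb U_sym U_inf sp n2 v x0); rewrite lee_fin.
  have c1 : c <= 1 by lra.
  have t1 : 1 <= 1 + Num.sqrt (l1norm v)%:R :> R by lra.
  have := tail_from_spread sp spread c0 c1 cr cd vo (lexx _) t1.
  rewrite expr1n mulr1 -/A => T.
  rewrite exprMn sqr_sqrtr ?(ltW L0)// mulr1 in T *.
  apply: le_trans (ler_wpM2l _ T); last by rewrite mulr_ge0 ?sqr_ge0// ltW.
  by rewrite le_eqVlt /c'; apply/orP; left; apply/eqP; field.
- move=> delta Ld.
  have delta0 : 0 < delta by apply: lt_le_trans Ld; rewrite divr_gt0// sqrtr_gt0.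
  rewrite (PmuE U_sym U_inf sp n2) ?lee_fin; last exact: jset_ball.
  (* For [delta <= 1] the linear bound suffices, as [delta <= delta ^ (2 / 3)]; for [delta > 1] the
     right side is at least 1. *)
  have [d1|d1] := leP delta 1.
    apply: (le_trans (ball n n2 v delta s0 Ld d1)).
    have := @ger1_powR R delta (2 / 3); rewrite delta0 d1 => /(_ isT) H.
    have {}H : delta <= powR delta (2 / 3) by apply: H; lra.
    by apply: ler_pM H; [exact: le_trans ler01 K1|exact: ltW|rewrite lerDl].
  apply: (le_trans (pr_le1 sp _ (jset_ball _ _))).
  have H : 1 <= powR delta (2 / 3).
    have one : 1 = powR 1 (2 / 3) :> R by rewrite powR1.
    by rewrite [leLHS]one; apply: ge0_ler_powR; rewrite ?nnegrE ?divr_ge0// ltW.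
  by rewrite -[leLHS]mulr1; apply: ler_pM => //; rewrite (le_trans K1)// lerDl.
- move=> t t1 ts.
  rewrite (PmuE U_sym U_inf sp n2) ?lee_fin; last by apply: jset_ge; exact: jmeas_norm.
  have ts' : t <= 1 + Num.sqrt (l1norm v)%:R.
    by apply: (le_trans ts); rewrite ler_pdivrMr ?addr_gt0// ler_peMr ?addr_ge0// lerDl ltW.
  apply: le_trans (tail_from_spread sp spread c'0 c'1 c'r c'd vo t1 ts').
  apply: ler_pM; rewrite ?expR_ge0 ?(ltW c'0)//; first lra.
  rewrite ler_expR lerN2.
  have t2 : 0 <= t ^+ 2 by exact: sqr_ge0.
  rewrite (_ : 400 * C * (48 * t ^+ 2) = A * t ^+ 2); last by rewrite /A; ring.
  by apply: ler_wpM2r => //; lra.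
Qed.
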